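(* Let $u^0_\varepsilon:I_\varepsilon\to\mathbb{R}$ be initial data satisfying $$\sup\{|(u^0_\varepsilon)_i|:0\le i\le N_\varepsilon,\ \varepsilon>0\}<\infty\quad\text{and}\quad F_\varepsilon(u^0_\varepsilon)\le M\ \text{ for some } M>0 \text{ and every }\varepsilon>0 .$$ Let $\varepsilon_n\to0$, $\tau_n\to0$ and let $v_n=u_{\varepsilon_n,\tau_n}$ be (a subsequence, not relabeled) converging to a function $u\in C^{1/2}([0,+\infty);L^2(0,1))$ in the following sense: with $\tilde v_n$ the partial linear interpolation of $v_n$, $v_n\to u$ and $\tilde v_n\to u$ in $L^\infty([0,T];L^2(0,1))$ and a.e. in $(0,1)\times(0,T)$ for every $T\ge0$; for all $t\ge0$, $u(\cdot,t)$ is piecewise-$H^1(0,1)$ and $(\tilde v_n)_x(\cdot,t)\rightharpoonup u_x(\cdot,t)$ in $L^2(0,1)$; and for every $t\ge 0$ and $\bar x\in S(u(\cdot,t))$ there are a subsequence $\{v_{n_h}\}$ and points $x^h\in S(\tilde v_{n_h}(\cdot,t))$ with $x^h\to\bar x$. Then $$u_t=2\,u_{xx}$$ in the distributional sense in $(0,1)\times(0,+\infty)$, where $u_{xx}=(u_x)_x$. Moreover $$u(\cdot,0)=u^0\ \text{ a.e. in }(0,1),\qquad u_x(\cdot,t)=0\ \text{ on } S(u(\cdot,t))\cup\{0,1\}\ \text{ for a.e. } t\ge0,$$ where $u^0$ is the a.e.-limit of the sequence $\{u^0_{\varepsilon}\}$ (along $\varepsilon=\varepsilon_n$).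
   Context: For $\varepsilon=1/N_\varepsilon$, $I_\varepsilon=\varepsilon\mathbb{Z}\cap[0,1]$; a function $u:I_\varepsilon\to\mathbb{R}$ is written $(u_0,\dots,u_{N_\varepsilon})$ and identified with its piecewise-constant extension $u(x)=u_{\lfloor x/\varepsilon\rfloor}$. The scaled Perona-Malik functional is $$F_\varepsilon(u)=\sum_{i=1}^{N_\varepsilon}\frac{1}{|\log\varepsilon|}\log\Bigl(1+|\log\varepsilon|\frac{|u_i-u_{i-1}|^2}{\varepsilon}\Bigr).$$ Given $\varepsilon,\tau>0$ and $u^0_\varepsilon$, put $u^0_{\varepsilon,\tau}=u^0_\varepsilon$ and for $k\ge1$ let $u^k_{\varepsilon,\tau}$ be a minimizer over $v:I_\varepsilon\to\mathbb{R}$ of $F_\varepsilon(v)+\frac1{2\tau}\sum_{i=0}^{N_\varepsilon}\varepsilon|v_i-(u^{k-1}_{\varepsilon,\tau})_i|^2$. Define $u_{\varepsilon,\tau}(x,t)=(u^k_{\varepsilon,\tau})_i$ with $k=\lfloor t/\tau\rfloor$, $i=\lfloor x/\varepsilon\rfloor$. Partial linear interpolation: for $z:I_\varepsilon\to\mathbb{R}$ let $I^j_\varepsilon(z)=\{0\le i\le N_\varepsilon-1:\ |z_{i+1}-z_i|/\varepsilon>1/\sqrt{\varepsilon|\log\varepsilon|}\}$ and set $\tilde z(x)=z_i$ if $i=\lfloor x/\varepsilon\rfloor\in I^j_\varepsilon(z)$ or $i=N_\varepsilon$, and $\tilde z(x)=(1-\mu)z_i+\mu z_{i+1}$ otherwise,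 with $\mu=x/\varepsilon-\lfloor x/\varepsilon\rfloor$. Then $\tilde v_n(\cdot,t)$ is obtained by applying this to $v_n(\cdot,t)$ with $\varepsilon=\varepsilon_n$. For a piecewise-$H^1$ function (finitely many jumps, $H^1$ in between), $S(\cdot)$ is the set of jump points and the subscript $x$ denotes the a.e. derivative (density of the absolutely continuous part of the distributional derivative). *)

(* Defs.v *)
From HB Require Import structures.
From mathcomp Require Import all_boot all_order all_algebra.
From mathcomp Require Import all_classical all_reals all_analysis.

Set Implicit Arguments.
Unset Strict Implicit.
Unset Printing Implicit Defensive.

Import Order.TTheory GRing.Theory Num.Theory.
Import numFieldNormedType.Exports.

Local Open Scope classical_set_scope.
Local Open Scope ring_scope.

(* Functions of space and time are curried with time first: [u t x] is the
   value u(x,t), so that [u t] is the function u(.,t).  Functions on (0,1) are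
   represented by functions on R whose values outside (0,1) are irrelevant. *)

Section discrete.
Variable R : realType.
Implicit Types (N : nat) (tau x t : R).

Definition eps N : R := N%:R^-1.

Definition abslog N : R := `|ln (eps N)|.

(* Functions I_eps -> R, with eps = 1/N, are indexed by 0, ..., N.  The case
   N = 1, where log eps = 0 and F_eps is undefined, is excluded in all uses. *)
Definition perona_malik N (u : 'I_N.+1 -> R) : R :=
  \sum_(1 <= i < N.+1)
    (abslog N)^-1 *
    ln (1 + abslog N * (`|u (inord i) - u (inord i.-1)| ^+ 2 / eps N)).

Definition step_energy N tau (w v : 'I_N.+1 -> R) : R :=
  perona_malik v + (2 * tau)^-1 * \sum_(i < N.+1) eps N * `|v i - w i| ^+ 2.

Definition minimizing_scheme N tau (u0 : 'I_N.+1 -> R)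
    (U : nat -> 'I_N.+1 -> R) : Prop :=
  U 0 = u0 /\
  forall k (v : 'I_N.+1 -> R),
    step_energy tau (U k) (U k.+1) <= step_energy tau (U k) v.

Definition pc_ext N (z : 'I_N.+1 -> R) x : R := z (inord (Num.truncn (x / eps N))).

Definition jump_cell N (z : 'I_N.+1 -> R) (i : nat) : bool :=
  (i < N)%N &&
  (1 / Num.sqrt (eps N * abslog N) < `|z (inord i.+1) - z (inord i)| / eps N).

Definition partial_interp N (z : 'I_N.+1 -> R) x : R :=
  let i := Num.truncn (x / eps N) in
  let mu := x / eps N - i%:R in
  if jump_cell z i || (i == N) then z (inord i)
  else (1 - mu) * z (inord i) + mu * z (inord i.+1).

Definition time_ext N tau (U : nat -> 'I_N.+1 -> R) t : 'I_N.+1 -> R :=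
  U (Num.truncn (t / tau)).

End discrete.

Section function_spaces.
Variable R : realType.
Implicit Types (a b x : R) (f g phi : R -> R).

Local Notation mu := (@lebesgue_measure R).

Definition L2norm a b f : \bar R := 'N[mu]_2%:E[EFin \o (f \_ `]a, b[)].

Definition L2 a b f : Prop := (f \_ `]a, b[) \in Lfun mu 2%:E.

Definition test_fun a b phi : Prop :=
  (forall k x, derivable (derive1n k phi) x 1) /\
  exists2 K : set R, compact K /\ K `<=` `]a, b[ &
    forall x, ~ K x -> phi x = 0.

Definition H1 a b f : Prop :=
  L2 a b f /\
  exists2 g, L2 a b g &
    forall phi, test_fun a b phi ->
      \int[mu]_(x in `]a, b[) (f x * derive1 phi x) =
      - \int[mu]_(x in `]a, b[) (g x * phi x).

Definition piecewise_H1 f : Prop :=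
  exists2 s : seq R, itv_partition 0 1 s &
    forall i, (i < size s)%N -> H1 (nth 0 (0 :: s) i) (nth 0 (0 :: s) i.+1) f.

(* The distributional derivative of f on (0,1) is g dx + nup - nun, where the
   finite measures nup and nun are singular with respect to Lebesgue measure. *)
Definition ac_density f g : Prop :=
  mu.-integrable `]0, 1[ (EFin \o g) /\
  exists (nup nun : {finite_measure set (measurableTypeR R) -> \bar R})
         (A : set (measurableTypeR R)),
    [/\ measurable A, mu A = 0%E, nup (~` A) = 0%E, nun (~` A) = 0%E &
      forall phi, test_fun 0 1 phi ->
        \int[mu]_(x in `]0, 1[) (f x * derive1 phi x) =
        - (\int[mu]_(x in `]0, 1[) (g x * phi x)
           + \int[nup]_(x in `]0, 1[) phi x
           - \int[nun]_(x in `]0, 1[) phi x)].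

(* A representative of f_x, which is unique up to a.e. equality on (0,1)
   whenever it exists, in particular for piecewise-H^1 functions. *)
Definition ac_deriv f : R -> R := xget (cst 0) [set g | ac_density f g].

(* One-sided limits are taken up to null sets, so that the jump set depends
   only on the a.e.-class of f. *)
Definition ess_limit_right f x (l : R) : Prop :=
  forall e, 0 < e -> exists2 r, 0 < r &
    {ae mu, forall y, x < y < x + r -> `|f y - l| < e}.

Definition ess_limit_left f x (l : R) : Prop :=
  forall e, 0 < e -> exists2 r, 0 < r &
    {ae mu, forall y, x - r < y < x -> `|f y - l| < e}.

Definition jump_set f : set R :=
  [set x | 0 < x < 1 /\
     exists l r, [/\ ess_limit_left f x l, ess_limit_right f x r & l != r]].

Definition weak_cvg_L2 (f_ : nat -> R -> R) f : Prop :=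
  [/\ forall n, L2 0 1 (f_ n), L2 0 1 f &
    forall psi, L2 0 1 psi ->
      \int[mu]_(x in `]0, 1[) (f_ n x * psi x) @[n --> \oo] -->
      \int[mu]_(x in `]0, 1[) (f x * psi x)].

End function_spaces.

Section space_time.
Variable R : realType.
Implicit Types (u f phi : R -> R -> R) (T : R).

Local Notation mu := (@lebesgue_measure R).

Definition holder_half_L2 u : Prop :=
  (forall t, 0 <= t -> L2 0 1 (u t)) /\
  exists C : R, forall s t : R, 0 <= s -> 0 <= t ->
    (L2norm 0 1 (u t \- u s)%R <= (C * Num.sqrt `|t - s|)%:E)%E.

Definition cvg_LinftyL2 T (u_ : nat -> R -> R -> R) u : Prop :=
  'N[mu]_+oo[(fun t => L2norm 0 1 (u_ n t \- u t)%R) \_ `[0%R, T]]%E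
    @[n --> \oo] --> 0%E.

Definition cvg_ae_cylinder T (u_ : nat -> R -> R -> R) u : Prop :=
  {ae (mu \x mu)%E, forall p : R * R, 0 < p.1 < T -> 0 < p.2 < 1 ->
    u_ n p.1 p.2 @[n --> \oo] --> u p.1 p.2}.

Definition partial_t phi : R -> R -> R := fun t x => derive1 (phi^~ x) t.
Definition partial_x phi : R -> R -> R := fun t x => derive1 (phi t) x.

Fixpoint Ck (k : nat) phi : Prop :=
  continuous (fun p : R * R => phi p.1 p.2) /\
  if k is k'.+1 then
    [/\ forall t x, derivable (phi^~ x) t 1, forall t x, derivable (phi t) x 1,
        Ck k' (partial_t phi) & Ck k' (partial_x phi)]
  else True.

(* C^oo functions with compact support in (0,+oo) x (0,1), time first *)
Definition test_fun2 phi : Prop :=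
  (forall k, Ck k phi) /\
  exists2 K : set (R * R),
    compact K /\ (forall p, K p -> 0 < p.1 /\ 0 < p.2 < 1) &
    forall t x, ~ K (t, x) -> phi t x = 0.

(* The iterated integral makes sense without choosing a jointly measurable
   representative: f t is only defined up to a null set for each t. *)
Definition distribution_of f phi : R :=
  \int[mu]_(t in `]0, +oo[) \int[mu]_(x in `]0, 1[) (f t x * phi t x).

Definition distr_t (L : (R -> R -> R) -> R) phi : R := - L (partial_t phi).
Definition distr_x (L : (R -> R -> R) -> R) phi : R := - L (partial_x phi).

End space_time.

(* Main.v *)
Require Import Defs.
From HB Require Import structures.
From mathcomp Require Import all_boot all_order all_algebra.
From mathcomp Require Import all_classical all_reals all_analysis.
From mathcomp Require Import measurable_realfun ess_sup_inf.
From mathcomp Require Import ring lra zify.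

Import Order.TTheory GRing.Theory Num.Theory.
Import numFieldNormedType.Exports.

Local Open Scope classical_set_scope.
Local Open Scope ring_scope.

(** Minimality of each step, tested against translates of the values on the
    right of a given cell, gives an Euler-Lagrange equation in integrated form.
    With L = |log eps| and D the increment across a cell, the flux
    2 (D/eps) / (1 + L D^2/eps), extended by 0 beyond both ends of the lattice,
    has increments eps times the discrete velocity of the scheme (flux_step).
    Everything follows from two readings of the bound F <= M on this flux.

    - Across most cells the flux is nearly twice the slope of the partial linear
      interpolation: their L^1 distance is at most 2 sqrt(L eps) M (flux_slope).
      Hence the flux converges weakly to 2 u_x at every time (wflux_weak_cvg).
    - Across a cell with an increment larger than beta the flux is at most
      2/(L beta), which tends to 0 (flux_big).

    The equation (weak_equation) is the limit of the discrete one.  Let uhat be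
    affine on each time cell, from the value at the previous step to the value
    at the current one.  Integration by parts in time of uhat against the test
    function phi turns uhat phi_t into minus the velocity times phi; summation
    by parts in space turns the latter into the integral of the flux times
    phi_x; then uhat tends to u strongly and the flux to 2 u_x weakly.

    For the boundary and jump conditions, the energy dissipation bounds the
    space-time integral of the squared velocity.  By Fatou's lemma, for almost
    every t there is a subsequence along which the velocities at time t are
    bounded in L^2 (good_times).  Along it the fluxes are Hoelder continuous of
    exponent 1/2 up to an error eps, so they converge pointwise to a continuous
    function, which must be 2 u_x and which vanishes at 0 and 1 because the
    discrete fluxes do (flux_limit0, flux_limit1).  At a jump point of u(t) the
    bound on the energy forces a large increment, hence a small flux, in every
    neighbourhood (exists_small_flux); equicontinuity carries the zero over to
    the jump point itself (flux_limit_jump).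

    The initial condition rests on strong L^2 convergence at every single time,
    in particular at time 0 (sqL2_cvg).  Since u_x is a chosen representative of
    the absolutely continuous part of the distributional derivative, it must
    also be shown that this part is unique up to null sets (ac_density_unique)
    and that for a partial interpolation it is the function of slopes
    (ac_deriv_partial_interp). *)

Set Implicit Arguments.
Unset Strict Implicit.
Unset Printing Implicit Defensive.

(** * Elementary inequalities *)

(** A first variation vanishes at a minimum.  This algebraic form replaces the
    differentiation of the energy in the derivation of the Euler-Lagrange equation. *)
Lemma linear_term_eq0 (R : realFieldType) (X Y : R) :
  (forall s, 0 <= s * X + s ^+ 2 * Y) -> X = 0.
Proof.
move=> h; apply/eqP; apply: contraT => X0.
have X2 : 0 < X ^+ 2 by rewrite exprn_even_gt0.
have Y0 : 0 < `|Y| + 1 by rewrite ltr_wpDl.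
(* This s makes the quadratic term smaller than the linear one unless X = 0. *)
have := h (- X / (`|Y| + 1)).
have -> : - X / (`|Y| + 1) * X + (- X / (`|Y| + 1)) ^+ 2 * Y
  = X ^+ 2 / (`|Y| + 1) * (Y / (`|Y| + 1) - 1) by field; rewrite gt_eqF.
rewrite pmulr_rge0 ?divr_gt0// subr_ge0 ler_pdivlMr// mul1r.
by move=> /le_trans/(_ (ler_norm _)); rewrite gerDl ler10.
Qed.

Lemma amgm_norm (R : realFieldType) (d eta : R) : 0 < eta -> `|d| <= eta + d ^+ 2 / eta.
Proof.
move=> eta0; rewrite -(real_normK (num_real d)); set s := `|d|; have s0 : 0 <= s by exact: normr_ge0.
rewrite -subr_ge0 (_ : _ - _ = ((eta - s) ^+ 2 + eta * s) / eta); last by field; rewrite gt_eqF.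
by rewrite divr_ge0 ?(ltW eta0)// addr_ge0 ?sqr_ge0// mulr_ge0// ltW.
Qed.

(** Cauchy-Schwarz, from the nonnegativity of the variance. *)
Lemma sqr_sum_le (R : realFieldType) (a : nat -> R) m n : (m <= n)%N ->
  (\sum_(m <= i < n) a i) ^+ 2 <= (n - m)%:R * \sum_(m <= i < n) a i ^+ 2.
Proof.
rewrite leq_eqVlt => /orP[/eqP ->|mn].
  by rewrite !big_geq// expr0n/= mulr0.
set S := \sum_(m <= i < n) a i; set Q := \sum_(m <= i < n) _.
have k0 : 0 < (n - m)%:R :> R by rewrite ltr0n subn_gt0.
set k : R := (n - m)%:R in k0 *.
have : 0 <= \sum_(m <= i < n) (a i - S / k) ^+ 2 by apply: sumr_ge0 => i _; exact: sqr_ge0.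
rewrite (_ : \sum_(m <= i < n) _ = \sum_(m <= i < n) (a i ^+ 2 + (- (2 * S / k)) * a i + S ^+ 2 / k ^+ 2)); last first.
  by apply: eq_bigr => i _; field; rewrite gt_eqF.
rewrite !big_split/= -mulr_sumr -/S -/Q sumr_const_nat -mulr_natr -/k.
rewrite (_ : _ + _ = (k * Q - S ^+ 2) / k); last by field; rewrite gt_eqF.
by rewrite pmulr_lge0 ?invr_gt0// subr_ge0.
Qed.

Lemma ln1p_ge_half (R : realType) (y : R) : 0 <= y <= 1 -> y / 2 <= ln (1 + y).
Proof.
move=> /andP[y0 y1]; have p : 0 < 1 + y by lra.
have : ln ((1 + y)^-1) <= (1 + y)^-1 - 1.
  rewrite -[X in ln X](_ : 1 + ((1 + y)^-1 - 1) = _); last by rewrite addrC subrK.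
  by apply: le_ln1Dx; rewrite ltrBrDl subrr invr_gt0.
rewrite lnV ?posrE// lerNl opprB; apply: le_trans.
rewrite (_ : 1 - _ = y / (1 + y)); last by field; rewrite gt_eqF.
by rewrite ler_wpM2l// lef_pV2 ?posrE//; lra.
Qed.

(** * The Euler-Lagrange equation of one step *)

Section clamp.
Context {R : realFieldType}.
Implicit Types C x y : R.

Definition clamp C x := if x < - C then - C else if C < x then C else x.

Lemma clamp_lip C x y : 0 <= C -> `|clamp C x - clamp C y| <= `|x - y|.
Proof.
move=> C0; wlog xy : x y / x <= y => [hw'|].
  by case: (leP x y) => [|/ltW] /hw'//; rewrite distrC (distrC y).
rewrite (ler0_norm (_ : x - y <= 0)) ?subr_le0// ler_norml; apply/andP; rewrite /clamp.
by case: (ltP x (- C)); case: (ltP y (- C)); case: (ltP C x); case: (ltP C y) => *; split; lra.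
Qed.

Lemma clamp_id C x : `|x| <= C -> clamp C x = x.
Proof.
rewrite ler_norml /clamp => /andP[Cx xC].
by rewrite ltNge Cx ltNge xC.
Qed.

Lemma clamp_closer C x y : `|y| <= C -> C < `|x| -> `|clamp C x - y| < `|x - y|.
Proof.
rewrite ler_norml ltr_normr /clamp => /andP[Cy yC] /orP[Cx|Cx].
  rewrite Cx ifF; last by apply/negbTE; rewrite -leNgt; lra.
  by rewrite !ger0_norm; lra.
rewrite ifT; last lra.
by rewrite !ler0_norm; lra.
Qed.

End clamp.

Section discrete.
Variable R : realType.
Variable N : nat.
Hypothesis N1 : (1 < N)%N.
Local Notation e := (eps R N).
Local Notation L := (abslog R N).
Implicit Types (tau : R) (v w z : 'I_N.+1 -> R).

Lemma eps_gt0 : 0 < e.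
Proof. by rewrite /eps invr_gt0 ltr0n ltnW. Qed.

Lemma epsV_gt0 : 0 < e^-1.
Proof. by rewrite invr_gt0 eps_gt0. Qed.

Lemma eps_lt1 : e < 1.
Proof. by rewrite /eps invf_lt1 ?ltr1n// ltr0n ltnW. Qed.

Lemma epsE : N%:R * e = 1.
Proof. by rewrite /eps divff// pnatr_eq0 -lt0n ltnW. Qed.

Lemma abslog_gt0 : 0 < L.
Proof. by rewrite /abslog normr_gt0 lt_eqF// ln_lt0// eps_gt0 eps_lt1. Qed.

Lemma eps_expR : e = expR (- L).
Proof.
rewrite /abslog ltr0_norm; last by rewrite ln_lt0// eps_gt0 eps_lt1.
by rewrite opprK lnK// posrE eps_gt0.
Qed.

Definition incr z m : R := z (inord m) - z (inord m.-1).

Definition edens z m : R := L^-1 * ln (1 + L * (`|incr z m| ^+ 2 / e)).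

(** The derivative of the energy density of the increment across the cell
    ending at m.  The value 0 at m = 0 and m = N + 1 encodes the natural
    (Neumann) boundary conditions. *)
Definition flux z m : R :=
  if (0 < m <= N)%N then 2 * (incr z m / e) / (1 + L * (incr z m ^+ 2 / e))
  else 0.

Lemma edens_ge0 z m : 0 <= edens z m.
Proof.
rewrite /edens mulr_ge0 ?invr_ge0 ?(ltW abslog_gt0)// ln_ge0// lerDl.
by rewrite mulr_ge0 ?(ltW abslog_gt0)// divr_ge0 ?sqr_ge0 ?(ltW eps_gt0).
Qed.

Lemma perona_malikE z : perona_malik z = \sum_(1 <= m < N.+1) edens z m.
Proof. by []. Qed.

Lemma perona_malik_ge0 z : 0 <= perona_malik z.
Proof. by rewrite perona_malikE sumr_ge0// => m _; exact: edens_ge0. Qed.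

Lemma arg_gt0 (x : R) : 0 < 1 + L * (x ^+ 2 / e).
Proof.
by rewrite ltr_wpDr// mulr_ge0 ?(ltW abslog_gt0)// divr_ge0 ?sqr_ge0 ?(ltW eps_gt0).
Qed.

Lemma den_gt0 (x : R) : 0 < e + L * x ^+ 2.
Proof.
by rewrite ltr_wpDr ?eps_gt0// mulr_ge0 ?(ltW abslog_gt0)// sqr_ge0.
Qed.

(** Concavity of ln: ln (1 + t) <= t applied to the relative variation of the
    argument.  The right-hand side is quadratic in s, as linear_term_eq0 requires. *)
Lemma ln_shift_le (D s : R) :
  ln (1 + L * ((D + s) ^+ 2 / e)) - ln (1 + L * (D ^+ 2 / e)) <=
  L * (2 * D * s + s ^+ 2) / e / (1 + L * (D ^+ 2 / e)).
Proof.
rewrite -ln_div ?posrE ?arg_gt0//.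
rewrite -[leLHS](_ : ln (1 + ((1 + L * ((D + s) ^+ 2 / e)) / (1 + L * (D ^+ 2 / e)) - 1)) = _); last by rewrite addrC subrK.
apply: (le_trans (le_ln1Dx _)).
  by rewrite ltrBrDl subrr divr_gt0// arg_gt0.
rewrite le_eqVlt; apply/orP; left; apply/eqP.
by field; rewrite !gt_eqF ?den_gt0 ?eps_gt0//.
Qed.

Definition minimizer tau w v := forall z, step_energy tau w v <= step_energy tau w z.

Lemma sum_inord (F : 'I_N.+1 -> R) : \sum_(i < N.+1) F i = \sum_(0 <= i < N.+1) F (inord i).
Proof. by rewrite big_mkord; apply: eq_bigr => i _; rewrite inord_val. Qed.

(** The competitor is v + s on the indices from m on and v elsewhere.  Only the
    increment across the cell ending at m changes; to first order in s the energy varies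
    by s times the flux there, and the penalty by s times a sum of displacements. *)
Lemma flux_minimizer tau w v : 0 < tau -> minimizer tau w v ->
  forall m, (m <= N.+1)%N ->
  flux v m = - (e / tau) * \sum_(m <= j < N.+1) (v (inord j) - w (inord j)).
Proof.
move=> tau0 hmin m mN.
pose sh s (j : 'I_N.+1) := v j + s * (m <= j)%:R.
pose S1 := \sum_(m <= j < N.+1) (v (inord j) - w (inord j)).
pose n := (N.+1 - m)%N.
have quad s : (2 * tau)^-1 * \sum_(i < N.+1) e * `|sh s i - w i| ^+ 2
   - (2 * tau)^-1 * \sum_(i < N.+1) e * `|v i - w i| ^+ 2
   = s * (e / tau * S1) + s ^+ 2 * (e / (2 * tau) * n%:R).
  rewrite -mulrBr -sumrB sum_inord (big_cat_nat (leq0n m) mN)/=.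
  rewrite big_nat_cond big1 ?add0r; last first.
    move=> i /andP[/andP[_ im] _].
    by rewrite /sh (inordK (leq_trans im mN)) leqNgt im mulr0 addr0 subrr.
  rewrite (_ : \sum_(m <= i < N.+1) _ = \sum_(m <= i < N.+1)
     ((2 * e * s) * (v (inord i) - w (inord i)) + e * s ^+ 2)); last first.
    apply: eq_big_nat => i /andP[mi iN].
    rewrite /sh inordK// mi mulr1 !real_normK ?num_real//; ring.
  rewrite big_split/= -mulr_sumr -/S1 sumr_const_nat -/n -mulr_natr.
  by field; rewrite gt_eqF.
have incr_sh s i : (0 < i <= N)%N -> incr (sh s) i = incr v i + (if i == m then s else 0).
  move=> /andP[i0 iN]; rewrite /incr /sh !inordK ?ltnS// ?(leq_trans (leq_pred _))//.
  case: eqP => [<-|im].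
    by rewrite (_ : (i <= i.-1)%N = false) ?leqnn/=; [ring|lia].
  have -> : (m <= i.-1)%N = (m <= i)%N by lia.
  ring.
have key : forall s, 0 <= s * (flux v m + e / tau * S1) + s ^+ 2 *
   ((if (0 < m <= N)%N then (1 + L * (incr v m ^+ 2 / e))^-1 / e else 0) + e / (2 * tau) * n%:R).
  move=> s; have := hmin (sh s); rewrite -subr_ge0 /step_energy.
  rewrite opprD addrACA quad => /le_trans; apply.
  rewrite !mulrDr [leRHS]addrACA lerD2r.
  rewrite !perona_malikE -sumrB.
  rewrite (_ : \sum_(1 <= i < N.+1) _ = \sum_(1 <= i < N.+1 | i == m) (edens (sh s) i - edens v i)); last first.
    rewrite [in RHS]big_mkcond; apply: eq_big_nat => i /andP[i0 iN].
    by case: ifPn => // im; rewrite /edens incr_sh ?i0// (negbTE im) addr0 subrr.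
  (* At m = 0 and m = N + 1 no increment changes, which gives flux 0. *)
  rewrite /flux; case: ifPn => [/andP[m0 mN']|mN']; last first.
    by rewrite big_nat1_eq ifF ?mulr0 ?addr0//; apply/negP; lia.
  rewrite big_nat1_eq m0/= ltnS mN'.
  rewrite /edens incr_sh ?m0// eqxx -mulrBr !real_normK ?num_real//.
  rewrite ler_pdivrMl ?abslog_gt0//; apply: (le_trans (ln_shift_le _ _)).
  rewrite le_eqVlt; apply/orP; left; apply/eqP.
  by field; rewrite !gt_eqF ?den_gt0 ?eps_gt0//.
have := linear_term_eq0 key => /eqP; rewrite addr_eq0 => /eqP ->.
by rewrite mulNr.
Qed.

(** The Euler-Lagrange equation in divergence form, by subtracting the integrated
    form at m from the one at m + 1. *)
Lemma flux_step tau w v : 0 < tau -> minimizer tau w v ->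
  forall m, (m <= N)%N ->
  flux v m.+1 - flux v m = e / tau * (v (inord m) - w (inord m)).
Proof.
move=> tau0 hv m mN; rewrite !(flux_minimizer tau0 hv) ?ltnS ?leqW//.
rewrite [X in _ - X](_ : _ = - (e / tau) * ((v (inord m) - w (inord m)) +
   \sum_(m.+1 <= j < N.+1) (v (inord j) - w (inord j)))); first by ring.
by rewrite [in LHS]big_ltn// ltnS.
Qed.

(** Truncating v at the levels C and - C increases no increment, and strictly
    decreases the distance to w as soon as some value of v exceeds C. *)
Lemma minimizer_bounded tau w v C : 0 < tau -> minimizer tau w v ->
  (forall i, `|w i| <= C) -> forall i, `|v i| <= C.
Proof.
move=> tau0 hv hw i; rewrite leNgt; apply/negP => vC.
have C0 : 0 <= C by exact: le_trans (hw i).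
pose c := clamp C.
have cw x j : `|c x - w j| <= `|x - w j| by rewrite -{1}(clamp_id (hw j)) clamp_lip.
have cwi := clamp_closer (hw i) vC.
have := hv (c \o v); apply/negP; rewrite -ltNge /step_energy.
apply: ler_ltD.
  rewrite !perona_malikE; apply: ler_sum => m _; rewrite /edens.
  rewrite ler_pM2l ?invr_gt0 ?abslog_gt0// ler_ln ?posrE ?arg_gt0//.
  rewrite lerD2l ler_pM2l ?abslog_gt0// ler_pM2r ?epsV_gt0//.
  by rewrite lerXn2r ?nnegrE//; exact: clamp_lip.
rewrite ltr_pM2l ?invr_gt0 ?mulr_gt0//.
rewrite (bigD1 i)//= [ltRHS](bigD1 i)//=; apply: ltr_leD.
  by rewrite ltr_pM2l ?eps_gt0// ltrXn2r ?nnegrE.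
apply: ler_sum => j _; rewrite ler_pM2l ?eps_gt0//.
by rewrite lerXn2r ?nnegrE//; exact: cw.
Qed.

End discrete.

(** * Flux, slopes and energy of a lattice function *)

Section cells.
Variable R : realType.
Variable N : nat.
Hypothesis N1 : (1 < N)%N.
Local Notation e := (eps R N).
Local Notation L := (abslog R N).
Implicit Types (z : 'I_N.+1 -> R).

Let e0 : 0 < e. Proof. exact: eps_gt0. Qed.
Let L0 : 0 < L. Proof. exact: abslog_gt0. Qed.

Lemma jump_cellE z i : jump_cell z i = (i < N)%N && (e < L * incr z i.+1 ^+ 2).
Proof.
rewrite /jump_cell; case: (i < N)%N => //=.
have s0 : 0 < Num.sqrt (e * L) by rewrite sqrtr_gt0 mulr_gt0.
have s2 : Num.sqrt (e * L) ^+ 2 = e * L by rewrite sqr_sqrtr// ltW ?mulr_gt0.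
rewrite -/(incr z i.+1) ltr_pdivrMr//.
have d0 : 0 <= `|incr z i.+1| / e * Num.sqrt (e * L).
  by rewrite mulr_ge0 ?divr_ge0 ?normr_ge0 ?(ltW e0) ?(ltW s0).
rewrite -ltr_sqr ?nnegrE// expr1n !exprMn s2 real_normK ?num_real//.
rewrite (_ : _ * (e * L) = L * incr z i.+1 ^+ 2 / e); last by field; rewrite gt_eqF.
by rewrite ltr_pdivlMr// mul1r.
Qed.

(** The derivative of the partial interpolation on the cell from i to i + 1. *)
Definition slope z i : R := if jump_cell z i then 0 else incr z i.+1 / e.

Lemma nonjump_edens z i : (i < N)%N -> ~~ jump_cell z i ->
  incr z i.+1 ^+ 2 / e <= 2 * edens z i.+1.
Proof.
move=> iN; rewrite jump_cellE iN/= -leNgt => h.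
set y := L * (incr z i.+1 ^+ 2 / e).
have y01 : 0 <= y <= 1.
  rewrite /y mulr_ge0 ?divr_ge0 ?sqr_ge0 ?(ltW L0) ?(ltW e0)//=.
  by rewrite mulrA ler_pdivrMr// mul1r.
have := ln1p_ge_half y01.
rewrite /edens real_normK ?num_real// -/y => h2.
rewrite (_ : incr z i.+1 ^+ 2 / e = 2 * (L^-1 * (y / 2))); last first.
  by rewrite /y; field; rewrite !gt_eqF.
by rewrite ler_pM2l// ler_pM2l ?invr_gt0.
Qed.

(** A jump cell carries energy at least ln 2 / L. *)
Lemma jump_edens z i : jump_cell z i -> 1 <= 2 * L * edens z i.+1.
Proof.
rewrite jump_cellE => /andP[iN h].
rewrite /edens real_normK ?num_real// mulrA mulfK ?gt_eqF//.
have := @ln1p_ge_half R 1; rewrite ler01 lexx => /(_ isT) h2.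
have h3 : ln (1 + 1) <= ln (1 + L * (incr z i.+1 ^+ 2 / e)).
  by rewrite ler_ln ?posrE ?arg_gt0// lerD2l mulrA ler_pdivlMr// mul1r ltW.
by move: h2 h3; lra.
Qed.

Lemma slope_sqr_le z : \sum_(0 <= i < N) e * slope z i ^+ 2 <= 2 * perona_malik z.
Proof.
rewrite perona_malikE big_add1/= mulr_sumr; apply: ler_sum_nat => i /andP[_ iN].
rewrite /slope; case: ifPn => [_|h].
  by rewrite expr0n/= mulr0 mulr_ge0// edens_ge0.
apply: le_trans (nonjump_edens iN h); rewrite le_eqVlt; apply/orP; left; apply/eqP.
by field; rewrite gt_eqF.
Qed.

(** Set y = L D^2/eps.  On a cell without jump y <= 1 and the error is
    2 |D|/eps times y/(1+y); on a jump cell the whole flux is the error, and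
    the energy of the cell is at least 1/(2 L).  Both use 2 sqrt y <= 1 + y. *)
Lemma flux_slope z : \sum_(0 <= i < N) e * `|flux z i.+1 - 2 * slope z i| <=
  2 * Num.sqrt (L * e) * perona_malik z.
Proof.
have := mulr_gt0 L0 e0; rewrite -sqrtr_gt0; set s := Num.sqrt _ => s0.
have s2 : s ^+ 2 = L * e by rewrite sqr_sqrtr// mulr_ge0 ?ltW.
rewrite perona_malikE big_add1/= mulr_sumr; apply: ler_sum_nat => i /andP[_ iN].
rewrite /flux/= iN /slope; set D := incr z i.+1.
set d := `|D| / e; have d0 : 0 <= d by rewrite divr_ge0// ltW.
have YE : L * (D ^+ 2 / e) = (s * d) ^+ 2.
  rewrite exprMn s2 /d expr_div_n real_normK ?num_real//.
  by field; rewrite gt_eqF.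
have dn : `|D / e| = d by rewrite normrM /d normfV (gtr0_norm e0).
have q0 : 0 < 1 + (s * d) ^+ 2 by rewrite ltr_wpDr ?sqr_ge0.
rewrite YE; case: ifPn => [h|h].
  rewrite mulr0 subr0 normrM (normrM 2) dn normr_nat normfV (gtr0_norm q0).
  have := jump_edens h; rewrite -/D => h1.
  apply: (@le_trans _ _ (s / L)); last first.
    rewrite ler_pdivrMr//; apply: le_trans (_ : s * (2 * L * edens z i.+1) <= _).
      by rewrite ler_peMr// ltW.
    by rewrite le_eqVlt; apply/orP; left; apply/eqP; ring.
  rewrite (_ : s / L = e / s); last first.
    by rewrite (_ : e = s ^+ 2 / L); [|rewrite s2]; field; rewrite !gt_eqF.
  rewrite ler_pM2l// ler_pdivrMr// [leRHS]mulrC ler_pdivlMr//.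
  have := sqr_ge0 (1 - s * d); rewrite expr2 => h2.
  by nra.
have := nonjump_edens iN h; rewrite -/D => h1.
rewrite (_ : _ - _ = - (2 * (D / e)) * (s * d) ^+ 2 / (1 + (s * d) ^+ 2)); last first.
  by field; rewrite !gt_eqF.
rewrite normrM normrM normrN (normrM 2) dn normr_nat normfV (gtr0_norm q0) (ger0_norm (sqr_ge0 _)).
apply: (@le_trans _ _ (s * (D ^+ 2 / e))); last first.
  by rewrite [leRHS](_ : _ = s * (2 * edens z i.+1)); [rewrite ler_pM2l|ring].
rewrite (_ : D ^+ 2 / e = e * d ^+ 2); last first.
  by rewrite /d expr_div_n real_normK ?num_real//; field; rewrite gt_eqF.
rewrite [leRHS]mulrCA ler_pM2l// ler_pdivrMr//.
have := sqr_ge0 (1 - s * d); have : 0 <= s * d ^+ 2 by rewrite mulr_ge0 ?sqr_ge0 ?ltW.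
move: s0 d0; clear; nra.
Qed.

Lemma flux_L1 z : \sum_(0 <= i < N) e * `|flux z i.+1| <=
  2 + (4 + 2 * Num.sqrt (L * e)) * perona_malik z.
Proof.
have h1 := flux_slope z; have h2 := slope_sqr_le z.
have h3 : \sum_(0 <= i < N) e * `|2 * slope z i| <= 2 + 4 * perona_malik z.
  apply: (@le_trans _ _ (\sum_(0 <= i < N) (e * 2 + 2 * (e * slope z i ^+ 2)))).
    apply: ler_sum => i _; rewrite mulrCA -mulrDr ler_pM2l//.
    rewrite normrM normr_nat.
    have := real_normK (num_real (slope z i)); set t := `|_| => <-.
    by have := sqr_ge0 (t - 1); nra.
  rewrite big_split/= sumr_const_nat subn0 -mulr_sumr -[_ *+ N]mulr_natr (_ : e * 2 * N%:R = 2).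
    by move: h2; lra.
  by rewrite mulrC mulrA epsE// mul1r.
apply: le_trans (_ : \sum_(0 <= i < N) (e * `|flux z i.+1 - 2 * slope z i| + e * `|2 * slope z i|) <= _).
  apply: ler_sum => i _; rewrite -mulrDr ler_pM2l//.
  by rewrite -{1}(subrK (2 * slope z i) (flux z i.+1)) ler_normD.
by rewrite big_split/=; move: h1 h3; lra.
Qed.

(** The square of exp (- L/4) is the square root of eps, so the argument of the
    logarithm is at least exp (L/2). *)
Lemma big_edens z m : 1 <= L -> expR (- L / 4) < `|incr z m| -> 1 <= 2 * edens z m.
Proof.
move=> L1 h; have q0 : 0 < expR (- L / 4) :> R by exact: expR_gt0.
have : L / 2 <= ln (1 + L * (`|incr z m| ^+ 2 / e)).
  rewrite -[leLHS]expRK ler_ln ?posrE ?expR_gt0// ?real_normK ?num_real// ?arg_gt0//.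
  rewrite -real_normK ?num_real//.
  apply: le_trans (_ : L * (`|incr z m| ^+ 2 / e) <= _); last by rewrite lerDr.
  apply: le_trans (_ : `|incr z m| ^+ 2 / e <= _); last first.
    by rewrite ler_peMl// divr_ge0 ?sqr_ge0 ?ltW.
  rewrite ler_pdivlMr// {1}eps_expR// -expRD.
  rewrite (_ : _ + _ = - L / 4 + - L / 4); last by field.
  rewrite expRD -expr2 ltW// ltrXn2r ?nnegrE// ltW//.
rewrite /edens => h2.
rewrite (_ : 2 * _ = ln (1 + L * (`|incr z m| ^+ 2 / e)) * 2 / L); last by field; rewrite gt_eqF.
by rewrite ler_pdivlMr//; move: h2; lra.
Qed.

(** Three regimes: no jump, where |D| <= eps/lam + lam D^2/eps; a jump of size at most exp (- L/4), whose energy is at least 1/(2 L); a larger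
    jump, whose energy is at least 1/2. *)
Lemma incr_le z m (lam beta : R) : (0 < m <= N)%N -> 0 < lam -> 1 <= L ->
  `|incr z m| <= beta ->
  `|incr z m| <= e / lam + (2 * lam + 2 * L * expR (- L / 4) + 2 * beta) * edens z m.
Proof.
move=> /andP[m0 mN] lam0 L1 hb.
have E0 := edens_ge0 N1 z m.
have b0 : 0 <= beta by exact: le_trans hb.
have q0 : 0 < expR (- L / 4) :> R by exact: expR_gt0.
have el : 0 <= e / lam by rewrite divr_ge0 ?ltW.
have t1 : 0 <= 2 * lam * edens z m by apply: mulr_ge0 E0; rewrite mulr_ge0 ?ltW.
have t2 : 0 <= 2 * L * expR (- L / 4) * edens z m by apply: mulr_ge0 E0; rewrite !mulr_ge0 ?ltW.
have t3 : 0 <= 2 * beta * edens z m by apply: mulr_ge0 E0; rewrite mulr_ge0.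
rewrite !mulrDl.
have [h|h] := boolP (jump_cell z m.-1); last first.
  have := nonjump_edens (_ : m.-1 < N)%N h; rewrite !prednK// => /(_ mN) h1.
  have : `|incr z m| <= e / lam + lam * (incr z m ^+ 2 / e).
    rewrite -(real_normK (num_real (incr z m))); set t := `|_|; have t0 : 0 <= t by exact: normr_ge0.
    rewrite -subr_ge0 (_ : _ - _ = (((e - lam * t) ^+ 2 + e * lam * t) / (e * lam))).
      have el0 : 0 < e * lam by rewrite mulr_gt0.
      by rewrite divr_ge0 ?(ltW el0)// addr_ge0 ?sqr_ge0// mulr_ge0 ?(ltW el0).
    by field; rewrite !gt_eqF.
  have : lam * (incr z m ^+ 2 / e) <= lam * (2 * edens z m) by rewrite ler_pM2l.
  by move: t2 t3 el; lra.
have [h2|h2] := leP `|incr z m| (expR (- L / 4)).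
  have := jump_edens h; rewrite prednK// => h3.
  have : expR (- L / 4) <= expR (- L / 4) * (2 * L * edens z m) by rewrite ler_peMr// ltW.
  by move: t1 t3 el h2; lra.
have h3 := big_edens L1 h2.
have : beta <= beta * (2 * edens z m) by rewrite ler_peMr.
by move: t1 t2 el hb; lra.
Qed.

Lemma sum_incr z i j : (i <= j)%N ->
  z (inord j) - z (inord i) = \sum_(i.+1 <= m < j.+1) incr z m.
Proof. by move=> ij; rewrite big_add1/= telescope_sumr. Qed.

(** If no increment exceeded beta, adding up incr_le over the cells would bound
    the total oscillation by the left-hand side of the assumption. *)
Lemma exists_big_incr z (lam beta : R) i j : (i <= j <= N)%N ->
  0 < lam -> 0 <= beta -> 1 <= L ->
  (j - i)%:R * (e / lam) + (2 * lam + 2 * L * expR (- L / 4) + 2 * beta) * perona_malik z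
    < `|z (inord j) - z (inord i)| ->
  exists2 m, (i < m <= j)%N & beta < `|incr z m|.
Proof.
move=> /andP[ij jN] lam0 b0 L1 h; apply: contrapT => /forall2NP hm.
set K := (2 * lam + _ + _) in h.
have K0 : 0 <= K by rewrite !addr_ge0// !mulr_ge0 ?expR_ge0// ltW.
move: h; rewrite ltNge => /negP; apply.
rewrite sum_incr//; apply: le_trans (ler_norm_sum _ _ _) _.
apply: le_trans (_ : \sum_(i.+1 <= m < j.+1) (e / lam + K * edens z m) <= _).
  apply: ler_sum_nat => m /andP[im mj]; rewrite incr_le//; first by lia.
  by have [/negP|] := hm m; [rewrite im -ltnS mj|rewrite ltNge => /negP; rewrite negbK].
rewrite big_split/= sumr_const_nat subSS -[X in X + _]mulr_natl lerD2l.
rewrite -mulr_sumr ler_wpM2l// perona_malikE.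
rewrite [leRHS](big_cat_nat (n := i.+1))//=; last by lia.
rewrite [X in _ <= _ + X](big_cat_nat (n := j.+1))//=.
by rewrite addrCA lerDl addr_ge0// sumr_ge0// => m _; exact: edens_ge0.
Qed.

(** The flux decreases like 2/(L D) for large increments D. *)
Lemma flux_big z m beta : 0 < beta -> beta < `|incr z m| -> `|flux z m| <= 2 / (L * beta).
Proof.
move=> b0 bm; rewrite /flux; case: ifP => _; last first.
  by rewrite normr0 divr_ge0// mulr_ge0 ?ltW.
rewrite normrM normfV (gtr0_norm (arg_gt0 N1 _)) normrM normr_nat normrM normfV (gtr0_norm e0).
rewrite -(real_normK (num_real (incr z m))); set t := `|incr z m| in bm *.
have t0 : 0 < t by exact: lt_trans bm.
apply: (@le_trans _ _ (2 / (L * t))).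
  rewrite ler_pdivrMr; last by rewrite ltr_wpDr// mulr_ge0 ?divr_ge0 ?sqr_ge0 ?ltW.
  rewrite mulrDr mulr1 (_ : 2 / (L * t) * _ = 2 * (t / e)); last by field; rewrite !gt_eqF.
  by rewrite lerDr divr_ge0 ?mulr_ge0 ?ltW.
by rewrite ler_pM2l// lef_pV2 ?posrE ?mulr_gt0// ler_pM2l// ltW.
Qed.

End cells.

(** * Estimates along the minimizing scheme *)

Section scheme.
Variable R : realType.
Variable N : nat.
Hypothesis N1 : (1 < N)%N.
Local Notation e := (eps R N).
Local Notation L := (abslog R N).
Variables (tau : R) (u0 : 'I_N.+1 -> R) (U : nat -> 'I_N.+1 -> R) (M C : R).
Hypothesis tau0 : 0 < tau.
Hypothesis hU : minimizing_scheme tau u0 U.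
Hypothesis hM : perona_malik u0 <= M.
Hypothesis hC : forall i, `|u0 i| <= C.

Let e0 : 0 < e. Proof. exact: eps_gt0. Qed.

Lemma scheme_minimizer k : minimizer tau (U k) (U k.+1).
Proof. by move=> z; have [_] := hU; apply. Qed.

Lemma scheme_bounded k i : `|U k i| <= C.
Proof.
elim: k i => [|k IH] i; first by have [-> _] := hU.
exact: (minimizer_bounded N1 tau0 (scheme_minimizer k) IH).
Qed.

Definition dist2 (z w : 'I_N.+1 -> R) : R :=
  \sum_(0 <= i < N.+1) e * (z (inord i) - w (inord i)) ^+ 2.

Lemma dist2_ge0 z w : 0 <= dist2 z w.
Proof. by apply: sumr_ge0 => i _; rewrite mulr_ge0 ?sqr_ge0 ?ltW. Qed.

Lemma scheme_step k :
  perona_malik (U k.+1) + (2 * tau)^-1 * dist2 (U k.+1) (U k) <= perona_malik (U k).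
Proof.
have := scheme_minimizer k (U k); rewrite /step_energy.
rewrite [X in _ <= _ + _ * X -> _]big1 ?mulr0 ?addr0; last first.
  by move=> i _; rewrite subrr normr0 expr0n/= mulr0.
rewrite sum_inord /dist2; congr (_ + _ * _ <= _).
by apply: eq_bigr => i _; rewrite real_normK ?num_real.
Qed.

(** The energy lost in each step pays for the squared displacement; the sum
    telescopes. *)
Lemma scheme_energy_sum K :
  perona_malik (U K) + (2 * tau)^-1 * \sum_(0 <= k < K) dist2 (U k.+1) (U k) <= M.
Proof.
elim: K => [|K IH]; first by rewrite big_geq// mulr0 addr0; have [-> _] := hU.
rewrite big_nat_recr//= mulrDr.
have := scheme_step K; move: IH; set a := _ * \sum_(0 <= k < K) _; set b := _ * dist2 _ _; lra.
Qed.

Lemma scheme_energy k : perona_malik (U k) <= M.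
Proof.
apply: le_trans (scheme_energy_sum k); rewrite lerDl mulr_ge0 ?invr_ge0 ?mulr_ge0 ?(ltW tau0)//.
by apply: sumr_ge0 => i _; exact: dist2_ge0.
Qed.

Lemma scheme_dist2_sum K : \sum_(0 <= k < K) dist2 (U k.+1) (U k) <= 2 * tau * M.
Proof.
have := scheme_energy_sum K; have := perona_malik_ge0 N1 (U K) => h1 h2.
rewrite mulrC -ler_pdivrMr ?mulr_gt0// mulrC.
by apply: le_trans h2; rewrite lerDr.
Qed.

(** Cauchy-Schwarz over the steps from k to l. *)
Lemma scheme_holder k l : (k <= l)%N ->
  dist2 (U l) (U k) <= (l - k)%:R * (2 * tau * M).
Proof.
move=> kl.
apply: (@le_trans _ _ ((l - k)%:R * \sum_(k <= j < l) dist2 (U j.+1) (U j))); last first.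
  rewrite ler_wpM2l//; apply: le_trans (scheme_dist2_sum l).
  by rewrite [leRHS](big_cat_nat (n := k))//= lerDr sumr_ge0// => i _; exact: dist2_ge0.
rewrite mulr_sumr /dist2.
under [leRHS]eq_bigr do rewrite mulr_sumr.
rewrite exchange_big/=; apply: ler_sum => i _.
under [leRHS]eq_bigr do rewrite mulrCA.
rewrite -!mulr_sumr ler_pM2l//.
rewrite -(@telescope_sumr _ _ _ (fun j => U j (inord i)) kl).
by apply: sqr_sum_le.
Qed.

(** By flux_step the discrete derivative of the flux is the velocity, so this is
    Cauchy-Schwarz in space. *)
Lemma flux_holder k i j : (i <= j <= N.+1)%N ->
  (flux (U k.+1) j - flux (U k.+1) i) ^+ 2 <=
    (j - i)%:R * e * (dist2 (U k.+1) (U k) / tau ^+ 2).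
Proof.
move=> /andP[ij jN].
rewrite -(@telescope_sumr _ _ _ (fun m => flux (U k.+1) m) ij).
apply: le_trans (sqr_sum_le _ ij) _.
rewrite -mulrA ler_wpM2l// /dist2 mulrA mulr_sumr mulr_suml.
have c0 : 0 <= e / tau ^+ 2 by rewrite divr_ge0 ?sqr_ge0 ?ltW.
pose F m := e / tau ^+ 2 * (e * (U k.+1 (inord m) - U k (inord m)) ^+ 2).
have F0 m : 0 <= F m by apply: mulr_ge0 => //; rewrite mulr_ge0 ?sqr_ge0 ?ltW.
apply: (@le_trans _ _ (\sum_(i <= m < j) F m)).
  apply: ler_sum_nat => m /andP[im mj].
  rewrite (flux_step N1 tau0 (scheme_minimizer k)); last by lia.
  by rewrite le_eqVlt; apply/orP; left; apply/eqP; rewrite /F; field; rewrite gt_eqF.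
apply: (@le_trans _ _ (\sum_(0 <= m < N.+1) F m)); last first.
  rewrite le_eqVlt; apply/orP; left; apply/eqP; apply: eq_bigr => m _.
  by rewrite /F; field; rewrite gt_eqF.
rewrite [leRHS](big_cat_nat (n := i))//=; last by lia.
rewrite [X in _ <= _ + X](big_cat_nat (n := j))//=.
by rewrite addrCA lerDl addr_ge0// sumr_ge0.
Qed.

End scheme.

Section asymptotics.
Variable R : realType.
Variable N : nat.
Hypothesis N1 : (1 < N)%N.
Local Notation e := (eps R N).
Local Notation L := (abslog R N).

Lemma abslog_eps_le : L * e <= 2 / L.
Proof.
have L0 := abslog_gt0 R N1.
have := @expR_ge1Dxn R L 1; rewrite (ltW L0) => /(_ isT) h.
rewrite (eps_expR R N1) expRN ler_pdivrMr ?expR_gt0// mulrAC ler_pdivlMr//.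
rewrite -expr2.
have : L ^+ 2 / 2`!%:R <= expR L by apply: le_trans h; rewrite lerDr.
by rewrite ler_pdivrMr// mulrC.
Qed.

Lemma abslog_eps_le1 : L * e <= 1.
Proof.
rewrite (eps_expR R N1) expRN ler_pdivrMr ?expR_gt0// mul1r.
by apply: le_trans (expR_ge1Dx _); rewrite lerDr.
Qed.

(** Here exp (- L/4) is the fourth root of eps. *)
Lemma abslog_root4_eps_le : L * expR (- L / 4) <= 32 / L.
Proof.
have L0 := abslog_gt0 R N1.
have := @expR_ge1Dxn R (L / 4) 1; rewrite divr_ge0 ?(ltW L0)// => /(_ isT) h.
rewrite mulNr expRN ler_pdivrMr ?expR_gt0// mulrAC ler_pdivlMr//.
have : (L / 4) ^+ 2 / 2`!%:R <= expR (L / 4) by apply: le_trans h; rewrite lerDr.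
rewrite ler_pdivrMr// expr_div_n ler_pdivrMr ?exprn_gt0// expr2 => h2.
apply: le_trans h2 _; rewrite le_eqVlt; apply/orP; left; apply/eqP.
by rewrite -natrX -mulrA -natrM mulrC.
Qed.

End asymptotics.

Lemma abslog_infty (R : realType) (N_ : nat -> nat) (hN : forall n, (1 < N_ n)%N) :
  eps R (N_ n) @[n --> \oo] --> 0 -> forall A, \forall n \near \oo, A <= abslog R (N_ n).
Proof.
move=> h0 A; near=> n.
have : eps R (N_ n) < expR (- A).
  by near: n; apply: (cvgr_lt _ h0); exact: expR_gt0.
by rewrite (eps_expR R (hN n)) ltr_expR ltrN2 => /ltW.
Unshelve. all: end_near. Qed.

(** * Smooth bump functions *)

Section flat.
Variable R : realType.
Implicit Types (x y c d : R) (m : nat) (f g : R -> R).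

(** The functions y^(-m) exp (- 1/y), extended by 0 to y <= 0.  The family is
    closed under differentiation up to linear combinations (is_derive_flat). *)
Definition flat m y : R := if 0 < y then y^-1 ^+ m * expR (- y^-1) else 0.

Lemma flat_ge0 m y : 0 <= flat m y.
Proof.
rewrite /flat; case: ifP => // y0.
by rewrite mulr_ge0 ?expR_ge0// exprn_ge0// invr_ge0 ltW.
Qed.

Lemma flat_le m y : flat m y <= m.+2`!%:R * y ^+ 2.
Proof.
rewrite /flat; case: ifPn => [y0|_]; last by rewrite mulr_ge0 ?sqr_ge0.
have := @expR_ge1Dxn _ y^-1 m.+1; rewrite invr_ge0 (ltW y0) => /(_ isT) h.
rewrite expRN ler_pdivrMr ?expR_gt0// -[leLHS](mulfVK (_ : m.+2`!%:R != 0 :> R)); last first.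
  by rewrite pnatr_eq0 -lt0n fact_gt0.
rewrite (_ : y^-1 ^+ m / m.+2`!%:R * m.+2`!%:R = m.+2`!%:R * y ^+ 2 * (y^-1 ^+ m.+2 / m.+2`!%:R)); last first.
  rewrite !exprS; field; rewrite pnatr_eq0 -lt0n fact_gt0/= gt_eqF//.
rewrite ler_wpM2l ?mulr_ge0 ?(ltW y0)//; apply: le_trans h.
by rewrite lerDr.
Qed.

Lemma is_derive_flat m y :
  is_derive y 1 (flat m) (- m%:R * flat m.+1 y + flat m.+2 y).
Proof.
have [y0|y0] := ltP 0 y.
  apply: (@near_eq_is_derive _ _ _ (fun x => x^-1 ^+ m * expR (- x^-1))).
    near=> x; rewrite /flat ifT//; near: x.
    exact: lt_nbhsr.
  pose iv : R -> R := fun x => x^-1.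
  have dV : is_derive y 1 iv (- y ^- 2).
    by apply: is_derive_eq (@is_deriveV _ id y 1 1 _ _) _; rewrite ?gt_eqF//= /GRing.scale/= mulr1.
  have dE : is_derive y 1 (expR \o - iv) (expR (- y^-1) * - (- y ^- 2)).
    exact: is_derive1_comp.
  have dX := is_deriveX m dV.
  have -> : (fun x => x^-1 ^+ m * expR (- x^-1)) = iv ^+ m * (expR \o - iv).
    by apply/funext => x; rewrite fctE exprfctE.
  apply: is_derive_eq (is_deriveM dX dE) _.
  rewrite /flat y0 /GRing.scale/= /iv.
  rewrite exprfctE.
  case: m dX => [|m] dX; rewrite !exprS.
    by rewrite !expr0; field; rewrite gt_eqF.
  by field; rewrite gt_eqF.
have fz k : flat k y = 0 by rewrite /flat ltNge y0.
rewrite !fz mulr0 addr0.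
suff cv : (fun h => h^-1 *: ((flat m \o shift y) (h *: 1) - flat m y)) @ 0^' --> (0 : R).
  by apply: DeriveDef; [apply/cvg_ex; exists 0|exact: cvg_lim cv].
rewrite fz; apply/cvgrPdist_le => /= e e0.
near=> h; rewrite sub0r normrN subr0 normrM normfV ger0_norm ?flat_ge0//.
have h0 : h != 0 by near: h; exact: nbhs_dnbhs_neq.
rewrite ler_pdivrMl ?normr_gt0//.
apply: (@le_trans _ _ (m.+2`!%:R * `|h| ^+ 2)).
  have [hy|hy] := leP (h *: 1 + y) 0.
    by rewrite /= /flat ltNge hy/= mulr_ge0.
  apply: le_trans (flat_le _ _) _; rewrite ler_wpM2l//.
  rewrite real_normK ?num_real// /GRing.scale/= mulr1.
  have h1 : h + y <= h by rewrite gerDl.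
  move: hy; rewrite /GRing.scale/= mulr1 => hy.
  by rewrite lerXn2r ?nnegrE// ltW// (lt_le_trans hy).
rewrite expr2 mulrA mulrC ler_wpM2l//.
rewrite mulrC -ler_pdivlMr ?ltr0n ?fact_gt0//; near: h.
apply: dnbhs0_le; rewrite divr_gt0// ltr0n fact_gt0//.
Unshelve. all: end_near. Qed.

(** The algebra generated by the flat functions of affine arguments.  It is stable
    under differentiation, so all its members are smooth. *)
Inductive flat_algebra : (R -> R) -> Prop :=
| fa_cst c : flat_algebra (fun=> c)
| fa_flat m c d : flat_algebra (fun x => flat m (c * x + d))
| fa_add f g : flat_algebra f -> flat_algebra g -> flat_algebra (f + g)
| fa_mul f g : flat_algebra f -> flat_algebra g -> flat_algebra (f * g).

Lemma flat_algebra_derive f : flat_algebra f ->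
  exists2 f', flat_algebra f' & forall x, is_derive x 1 f (f' x).
Proof.
elim=> {f} [c|m c d|f g fa [f' fa' df] ga [g' ga' dg]|f g fa [f' fa' df] ga [g' ga' dg]].
- by exists (fun=> 0); [exact: fa_cst|move=> x; exact: is_derive_cst].
- exists ((fun=> c) * ((fun=> - m%:R) * (fun x => flat m.+1 (c * x + d))
     + (fun x => flat m.+2 (c * x + d)))).
    apply: fa_mul; first exact: fa_cst.
    by apply: fa_add; [apply: fa_mul; [exact: fa_cst|]|]; exact: fa_flat.
  move=> x; have da : is_derive x 1 (fun x : R => c * x + d) c.
    have -> : (fun x : R => c * x + d) = c \*: (@id R) + cst d by [].
    by apply: is_derive_eq; rewrite addr0 /GRing.scale/= mulr1.
  have := @is_derive1_comp _ (flat m) (fun x => c * x + d) x _ _ (is_derive_flat _ _) da.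
  by rewrite mulrC.
- by exists (f' + g'); [exact: fa_add|move=> x; exact: is_deriveD].
- exists (f * g' + g * f'); first by apply: fa_add; exact: fa_mul.
  by move=> x; exact: is_deriveM.
Qed.

Lemma flat_algebra_smooth f k x : flat_algebra f -> derivable (derive1n k f) x 1.
Proof.
elim: k f => [|k IH] f /flat_algebra_derive[f' fa' df].
  by rewrite derive1n0; exact: ex_derive.
rewrite derive1Sn (_ : derive1 f = f'); first exact: IH.
by apply/funext => y; rewrite derive1E; exact: derive_val.
Qed.

(** Smooth functions with values in [0, 1], supported in [a + 1/(k+1), b - 1/(k+1)],
    that tend to the indicator of ]a, b[ as k grows. *)
Definition smooth_bump (a b : R) (k : nat) x : R :=
  flat 0 (k.+1%:R * x + (- k.+1%:R * a - 1)) * flat 0 (- k.+1%:R * x + (k.+1%:R * b - 1)).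

Lemma flat0_le1 y : flat 0 y <= 1.
Proof.
rewrite /flat; case: ifP => // y0; rewrite expr0 mul1r expR_le1 oppr_le0 invr_ge0 ltW//.
Qed.

Lemma bump01 a b k x : 0 <= smooth_bump a b k x <= 1.
Proof. by rewrite /smooth_bump mulr_ge0 ?flat_ge0//= mulr_ile1 ?flat_ge0 ?flat0_le1. Qed.

Lemma bump_support a b k x :
  ~ (a + k.+1%:R^-1 <= x <= b - k.+1%:R^-1) -> smooth_bump a b k x = 0.
Proof.
have k0 : 0 < k.+1%:R :> R by [].
move=> /negP; rewrite negb_and -!ltNge => /orP[h|h]; rewrite /smooth_bump /flat.
  rewrite ifF ?mul0r//; apply/negbTE; rewrite -leNgt.
  have : k.+1%:R * x < k.+1%:R * (a + k.+1%:R^-1) by rewrite ltr_pM2l.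
  by rewrite mulrDr divff ?gt_eqF//; lra.
rewrite [X in _ * X]ifF ?mulr0//; apply/negbTE; rewrite -leNgt.
have : k.+1%:R * (b - k.+1%:R^-1) < k.+1%:R * x by rewrite ltr_pM2l.
by rewrite mulrBr divff ?gt_eqF//; lra.
Qed.

Lemma bump_test a b k : 0 <= a -> b <= 1 -> test_fun 0 1 (smooth_bump a b k).
Proof.
move=> a0 b1; split=> [j x|].
  by apply: flat_algebra_smooth; apply: fa_mul; exact: fa_flat.
have k0 : 0 < k.+1%:R^-1 :> R by rewrite invr_gt0.
exists `[a + k.+1%:R^-1, b - k.+1%:R^-1]%classic.
  split; first exact: segment_compact.
  move=> x /=; rewrite !in_itv/=; move: k0; set d := (_^-1) => d0 /andP[? ?].
  by apply/andP; split; lra.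
by move=> x /= h; apply: bump_support; move: h; rewrite in_itv.
Qed.

Lemma flat0_cvg1 (y : nat -> R) : y @ \oo --> +oo -> (fun n => flat 0 (y n)) @ \oo --> (1 : R).
Proof.
move=> hy; apply: (@squeeze_cvgr _ _ _ _ (fun n => 1 - (y n)^-1) (fun=> 1)).
- near=> n; rewrite flat0_le1 andbT /flat ifT; last by near: n; exact: cvgry_gt hy 0.
  by rewrite expr0 mul1r -[leLHS]/(1 + - (y n)^-1) expR_ge1Dx.
- rewrite -[X in _ --> X]subr0; apply: cvgB; first exact: cvg_cst.
  have pos : \forall n \near \oo, 0 < y n by exact: cvgry_gt hy 0.
  by have [_] := gtr0_cvgV0 pos; exact.
- exact: cvg_cst.
Unshelve. all: end_near. Qed.

Lemma cvg_affine_pinfty c d : 0 < c -> (fun n => n.+1%:R * c + d) @ \oo --> +oo.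
Proof.
move=> c0; apply/cvgryPge => A; near=> n.
rewrite -lerBlDr -ler_pdivrMr//; apply: le_trans (ltW (truncnS_gt _)) _.
by rewrite ler_nat ltnS; near: n; exact: nbhs_infty_ge.
Unshelve. all: end_near. Qed.

Lemma bump_cvg a b x : smooth_bump a b ^~ x @ \oo --> (\1_(`]a, b[%classic) x : R).
Proof.
rewrite indicE; have [|xab] := boolP (x \in _).
  rewrite inE/= in_itv/= => /andP[ax xb].
  rewrite -[X in _ --> X]mulr1; apply: cvgM; apply: flat0_cvg1.
    rewrite (_ : (fun _ => _) = fun n => n.+1%:R * (x - a) - 1).
      by apply: cvg_affine_pinfty; lra.
    by apply/funext => n; ring.
  rewrite (_ : (fun _ => _) = fun n => n.+1%:R * (b - x) - 1).
    by apply: cvg_affine_pinfty; lra.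
  by apply/funext => n; ring.
rewrite (_ : smooth_bump a b ^~ x = fun=> 0); first exact: cvg_cst.
apply/funext => k.
apply: bump_support => /andP[h1 h2]; move/negP: xab; apply.
have k0 : 0 < k.+1%:R^-1 :> R by rewrite invr_gt0.
rewrite inE/= in_itv/=; move: k0 h1 h2; set d := (_^-1) => *.
by apply/andP; split; lra.
Qed.

End flat.

(** * Integration: dominated convergence and bounded multipliers *)

Section Rintegral_extra.
Context d (T : measurableType d) (R : realType) (m : {measure set T -> \bar R}).
Variables (D : set T).
Hypothesis mD : measurable D.

Lemma dominated_Rintegral_cvg (f_ : nat -> T -> R) (f g : T -> R) :
  (forall n, measurable_fun D (f_ n)) ->
  (forall x, D x -> f_ ^~ x @ \oo --> f x) ->
  m.-integrable D (EFin \o g) ->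
  (forall n x, D x -> `|f_ n x| <= g x) ->
  m.-integrable D (EFin \o f) /\
  \int[m]_(x in D) f_ n x @[n --> \oo] --> \int[m]_(x in D) f x.
Proof.
move=> mf_ cf ig fg.
have mf : measurable_fun D f by apply: (measurable_fun_cvg mf_ cf).
have [|||||fi _ h] := @dominated_convergence _ T R m D mD
  (fun n => EFin \o f_ n) (EFin \o f) (EFin \o g).
- by move=> n; exact/measurable_EFinP.
- exact/measurable_EFinP.
- by apply: nearW => x Dx; apply: cvg_EFin; [exact: nearW|exact: cf].
- exact: ig.
- by apply: nearW => x n Dx; rewrite lee_fin fg.
split=> //; rewrite /Rintegral; apply: fine_cvg.
rewrite fineK; last exact: integrable_fin_num fi.
exact: h.
Qed.

Lemma integrable_sumR (f_ : nat -> T -> R) n :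
  (forall k, m.-integrable D (EFin \o f_ k)) ->
  m.-integrable D (EFin \o (fun x => \sum_(0 <= k < n) f_ k x)).
Proof.
move=> h; elim: n => [|n IH].
  rewrite (_ : _ \o _ = cst 0%E); first exact: integrable0.
  by apply/funext => x /=; rewrite big_geq.
rewrite (_ : _ \o _ = (EFin \o (fun x => \sum_(0 <= k < n) f_ k x)) \+ (EFin \o f_ n)).
  exact: integrableD.
by apply/funext => x /=; rewrite big_nat_recr// EFinD.
Qed.

Lemma Rintegral_sum (f_ : nat -> T -> R) n :
  (forall k, m.-integrable D (EFin \o f_ k)) ->
  \int[m]_(x in D) (\sum_(0 <= k < n) f_ k x) = \sum_(0 <= k < n) \int[m]_(x in D) f_ k x.
Proof.
move=> h; elim: n => [|n IH].
  rewrite big_geq//; under eq_Rintegral do rewrite big_geq//.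
  by rewrite /Rintegral integral0.
rewrite big_nat_recr//= -IH -RintegralD//; last exact: integrable_sumR.
by apply: eq_Rintegral => x _; rewrite big_nat_recr.
Qed.

Lemma integrable_le (f g : T -> R) : measurable_fun D f ->
  m.-integrable D (EFin \o g) -> (forall x, D x -> `|f x| <= g x) ->
  m.-integrable D (EFin \o f).
Proof.
move=> mf ig fg; apply: le_integrable ig => //; first exact/measurable_EFinP.
by move=> x Dx /=; rewrite lee_fin (le_trans (fg _ Dx))// ler_norm.
Qed.

(** The signed measure on D with density g, as a real-valued function of sets. *)
Definition indef_integral (g : T -> R) (S : set T) : R := \int[m]_(x in D) (g x * \1_S x).

Lemma integrable_indicM (g : T -> R) S : measurable S ->
  m.-integrable D (EFin \o g) -> m.-integrable D (EFin \o (fun x => g x * \1_S x)).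
Proof.
move=> mS ig; have mg : measurable_fun D g by exact/measurable_EFinP/(measurable_int _ ig).
apply: (@integrable_le _ (fun x => `|g x|)).
- by apply: measurable_funM => //; exact: measurable_indic.
- exact: integrable_norm.
- move=> x _; rewrite normrM ler_piMr// indicE; case: (_ \in _); rewrite ?normr1 ?normr0//.
Qed.

Lemma indic_trivIset_sum (F : nat -> set T) x : trivIset setT F ->
  (fun n => \sum_(0 <= k < n) \1_(F k) x) @ \oo --> (\1_(\bigcup_k F k) x : R) /\
  forall n, 0 <= \sum_(0 <= k < n) (\1_(F k) x : R) <= 1.
Proof.
move=> tF; have [[k _ Fkx]|nF] := pselect ((\bigcup_k F k) x).
  have E i : \1_(F i) x = (i == k)%:R :> R.
    rewrite indicE; case: eqP => [->|ik]; first by rewrite mem_set.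
    rewrite memNset// => Fix; apply: ik; apply: tF => //.
    by exists x.
  have En n : \sum_(0 <= i < n) (\1_(F i) x : R) = (k < n)%:R.
    under eq_bigr do rewrite E.
    rewrite (eq_bigr (fun i => if i == k then 1 else 0)) => [|i _]; last by case: eqP.
    by rewrite -big_mkcond/= big_nat1_eq leq0n/=; case: ifP.
  split=> [|n]; last by rewrite En; case: (k < n)%N => /=; rewrite ?lexx ?ler01.
  rewrite indicE mem_set; last by exists k.
  apply: cvg_near_cst; near=> n; rewrite En (_ : (k < n)%N)//.
  by near: n; exact: nbhs_infty_gt.
have E i : \1_(F i) x = 0 :> R.
  by rewrite indicE memNset// => Fix; apply: nF; exists i.
split=> [|n]; last by rewrite big1 ?lexx ?ler01// => i _.
rewrite indicE memNset//.
rewrite (_ : (fun _ => _) = fun=> 0); first exact: cvg_cst.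
by apply/funext => n; rewrite big1// => i _.
Unshelve. all: end_near. Qed.

Lemma indef_integral_sigma_additive (g : T -> R) (F : nat -> set T) :
  m.-integrable D (EFin \o g) -> (forall k, measurable (F k)) -> trivIset setT F ->
  (fun n => \sum_(0 <= k < n) indef_integral g (F k)) @ \oo --> indef_integral g (\bigcup_k F k).
Proof.
move=> ig mF tF.
have mg : measurable_fun D g by exact/measurable_EFinP/(measurable_int _ ig).
rewrite (_ : (fun _ => _) = fun n => \int[m]_(x in D) (\sum_(0 <= k < n) (g x * \1_(F k) x))); last first.
  by apply/funext => n; rewrite Rintegral_sum// => k; exact: integrable_indicM.
apply: (@dominated_Rintegral_cvg _ _ (fun x => `|g x|) _ _ _ _).2.
- move=> n; apply/measurable_EFinP/measurable_int/integrable_sumR => k.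
  exact: integrable_indicM.
- move=> x Dx; under eq_fun do rewrite -mulr_sumr.
  by apply: cvgMr; exact: (indic_trivIset_sum x tF).1.
- exact: integrable_norm.
- move=> n x Dx; rewrite -mulr_sumr normrM ler_piMr//.
  by have /andP[h0 h1] := (indic_trivIset_sum x tF).2 n; rewrite ger0_norm.
Qed.

End Rintegral_extra.

Lemma Rintegral_mul_indic d (T : measurableType d) (R : realType)
    (m : {measure set T -> \bar R}) (D E : set T) (f : T -> R) : E `<=` D ->
  \int[m]_(x in D) (f x * \1_E x) = \int[m]_(x in E) f x.
Proof.
move=> ED; rewrite -{2}(setIidr ED) Rintegral_mkcondr; apply: eq_Rintegral => x _.
by rewrite patchE indicE; case: (x \in E); rewrite ?mulr1 ?mulr0.
Qed.

Lemma Rintegral_widen d (T : measurableType d) (R : realType)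
    (m : {measure set T -> \bar R}) (A B : set T) (f : T -> R) : A `<=` B ->
  (forall x, B x -> ~ A x -> f x = 0) -> \int[m]_(x in A) f x = \int[m]_(x in B) f x.
Proof.
move=> AB f0; rewrite Rintegral_mkcond [RHS]Rintegral_mkcond; congr (Rintegral _ _ _).
apply/funext => x; rewrite !patchE; case: ifPn => [/set_mem Ax|/negP nAx].
  by rewrite mem_set//; exact: AB.
by case: ifPn => // /set_mem Bfx; rewrite f0// => Ax; apply: nAx; exact: mem_set.
Qed.

(** * Uniqueness of the absolutely continuous density *)

Section ac_density_unique.
Variable R : realType.
Local Notation mu := (@lebesgue_measure R).
Local Notation borel := (measurableTypeR R).

(** Open intervals form a pi-system that generates the Borel sets, and the sets on
    which a signed measure of total mass 0 vanishes form a Dynkin system. *)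
Lemma sigma_additive_eq0 (Phi : set borel -> R) :
  (forall F : nat -> set borel, (forall k, measurable (F k)) -> trivIset setT F ->
     (fun n => \sum_(0 <= k < n) Phi (F k)) @ \oo --> Phi (\bigcup_k F k)) ->
  (forall a b : R, Phi `]a, b[%classic = 0) -> Phi setT = 0 ->
  forall S, measurable S -> Phi S = 0.
Proof.
move=> addP itvP TP S mS.
have P0 : Phi set0 = 0 by rewrite -(set_itv_ge (_ : ~~ (BRight (1 : R) < BLeft (0:R))%O)) ?addP//= -leNgt bnd_simp.
have E : @measurable _ borel = <<s (@RGenOpens.G R) >> := RGenOpens.measurableE R.
suff H : forall B : set borel, <<s (@RGenOpens.G R) >> B -> Phi B = 0 by apply: H; rewrite -E.
apply: (@dynkin_induction _ borel (@RGenOpens.G R)) => //.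
- move=> _ _ [a [b ->]] [c [d ->]]; exists (Num.max a c), (Num.min b d).
  rewrite predeqE => x /=; rewrite !in_itv/= gt_max lt_min andbACA.
  by split=> [[-> ->]//|/andP[-> ->]].
- by move=> _ [a [b ->]].
- move=> B mB B0; have := addP (bigcup2 B (~` B)).
  rewrite bigcup2E setUv TP => /(_ _ _)/cvg_unique h; apply: esym; apply: h => //.
  + by case=> [|[|k]] //=; exact: measurableC.
  + by rewrite -trivIset_bigcup2 setICr.
  apply: cvg_near_cst; near=> n.
  have n2 : (2 <= n)%N by near: n; exact: nbhs_infty_ge.
  rewrite -(subnK n2) addn2 !big_nat_recl//= B0 add0r big1 ?addr0// => i _.
- move=> F mF tF F0; have := addP _ mF tF.
  rewrite (_ : (fun _ => _) = fun=> 0); last by apply/funext => n; rewrite big1.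
  by move=> /(cvg_unique (@norm_hausdorff _ R)); apply; exact: cvg_cst.
Unshelve. all: end_near. Qed.

Lemma measurable_bump (D : set borel) (a b : R) k : measurable_fun D (smooth_bump a b k : borel -> R).
Proof.
apply: measurable_funTS; apply: continuous_measurable_fun => x.
apply: differentiable_continuous; apply/derivable1_diffP.
have := @flat_algebra_smooth R (smooth_bump a b k) 0 x; rewrite derive1n0; apply.
by apply: fa_mul; exact: fa_flat.
Qed.

Lemma indef_integral_bump_cvg (m : {measure set borel -> \bar R}) (D : set borel) (g : borel -> R) (a b : R) :
  measurable D -> m.-integrable D (EFin \o g) ->
  \int[m]_(x in D) (g x * smooth_bump a b k x) @[k --> \oo] --> indef_integral m D g `]a, b[%classic.
Proof.
move=> mD ig.
have /measurable_EFinP mg := measurable_int _ ig.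
apply: (@dominated_Rintegral_cvg _ _ _ _ _ mD _ _ (fun x => `|g x|) _ _ _ _).2.
- by move=> n; apply: measurable_funM => //; exact: measurable_bump.
- by move=> x _; apply: cvgMr; exact: bump_cvg.
- exact: integrable_norm.
- move=> n x _; rewrite normrM ler_piMr//.
  by have /andP[h0 h1] := bump01 a b n x; rewrite ger0_norm.
Qed.

Lemma indef_integral_null (m : {measure set borel -> \bar R}) (D E A : set borel) :
  measurable D -> measurable E -> measurable A -> m (~` A) = 0%E -> E `<=` ~` A ->
  indef_integral m D (cst 1) E = 0.
Proof.
move=> mD mE mA A0 EA; rewrite /indef_integral /Rintegral.
under eq_integral do rewrite mul1r.
rewrite integral_indic//.
have /eqP -> : m (E `&` D) == 0%E; last by [].
rewrite -measure_le0 -A0; apply: le_measure; rewrite ?inE.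
- exact: measurableI.
- exact: measurableC.
- by move=> x [/EA].
Qed.

(** The two decompositions of the derivative agree on test functions, hence, by
    bump_cvg, on intervals, hence on Borel sets.  Off the two null sets that carry the
    singular parts, this says that the densities have equal integrals. *)
Lemma ac_density_unique (f g1 g2 : R -> R) :
  ac_density f g1 -> ac_density f g2 -> ae_eq mu `]0, 1[%classic g1 g2.
Proof.
move=> [ig1 [p1 [n1 [A1 [mA1 A10 pA1 nA1 E1]]]]] [ig2 [p2 [n2 [A2 [mA2 A20 pA2 nA2 E2]]]]].
set D := `]0, 1[%classic in ig1 ig2 E1 E2 *.
have mD : measurable (D : set borel) by exact: measurable_itv.
have i1 (p : {finite_measure set borel -> \bar R}) : p.-integrable D (EFin \o cst 1).
  exact: finite_measure_integrable_cst.
have [ip1 in1 ip2 in2] := And4 (i1 p1) (i1 n1) (i1 p2) (i1 n2).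
have i1' (p : {finite_measure set borel -> \bar R}) phi : test_fun 0 1 phi ->
    \int[p]_(x in D) phi x = \int[p]_(x in D) (cst 1 x * phi x).
  by move=> _; apply: eq_Rintegral => x _; rewrite mul1r.
pose W (S : set borel) := indef_integral mu D g1 S + indef_integral p1 D (cst 1) S - indef_integral n1 D (cst 1) S.
pose W' (S : set borel) := indef_integral mu D g2 S + indef_integral p2 D (cst 1) S - indef_integral n2 D (cst 1) S.
pose Phi S := W S - W' S.
have itv0 (a b : R) : 0 <= a -> b <= 1 -> Phi `]a, b[%classic = 0.
  move=> a0 b1; apply/esym.
  have c1 : (fun k => (\int[mu]_(x in D) (g1 x * smooth_bump a b k x)
       + \int[p1]_(x in D) (cst 1 x * smooth_bump a b k x)
       - \int[n1]_(x in D) (cst 1 x * smooth_bump a b k x))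
    - (\int[mu]_(x in D) (g2 x * smooth_bump a b k x)
       + \int[p2]_(x in D) (cst 1 x * smooth_bump a b k x)
       - \int[n2]_(x in D) (cst 1 x * smooth_bump a b k x))) @ \oo --> Phi `]a, b[%classic.
    by apply: cvgB; (apply: cvgB; [apply: cvgD|]; exact: indef_integral_bump_cvg).
  apply: cvg_unique c1 => //.
  rewrite (_ : (fun _ => _) = fun=> 0); first exact: cvg_cst.
  apply/funext => k; have tb := bump_test k a0 b1.
  have := E1 _ tb; rewrite E2// => /oppr_inj.
  rewrite (i1' p1 _ tb) (i1' n1 _ tb) (i1' p2 _ tb) (i1' n2 _ tb) => ->.
  by rewrite subrr.
have wE (m : {measure set borel -> \bar R}) (g : borel -> R) S S' : D `&` S = D `&` S' ->
    indef_integral m D g S = indef_integral m D g S'.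
  move=> SS'; apply: eq_Rintegral => x /set_mem Dx; congr (_ * _).
  rewrite !indicE; congr (_%:R); congr (nat_of_bool _).
  apply/idP/idP => /set_mem Sx; apply/mem_set.
    by have [] : (D `&` S') x by rewrite -SS'.
  by have [] : (D `&` S) x by rewrite SS'.
have PhiE S S' : D `&` S = D `&` S' -> Phi S = Phi S'.
  by move=> SS'; rewrite /Phi /W /W' !(wE _ _ _ _ SS').
have Phi0 S : measurable S -> Phi S = 0.
  apply: sigma_additive_eq0 => [F mF tF|a b|].
  - have sumE n : \sum_(0 <= k < n) Phi (F k) =
      (\sum_(0 <= k < n) indef_integral mu D g1 (F k) + \sum_(0 <= k < n) indef_integral p1 D (cst 1) (F k)
        - \sum_(0 <= k < n) indef_integral n1 D (cst 1) (F k)) -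
      (\sum_(0 <= k < n) indef_integral mu D g2 (F k) + \sum_(0 <= k < n) indef_integral p2 D (cst 1) (F k)
        - \sum_(0 <= k < n) indef_integral n2 D (cst 1) (F k)).
      by rewrite -!big_split/= -!sumrB.
    under eq_fun do rewrite sumE.
    by apply: cvgB; (apply: cvgB; [apply: cvgD|]; exact: indef_integral_sigma_additive).
  - rewrite (PhiE _ `]Num.max 0 a, Num.min 1 b[%classic).
      by apply: itv0; rewrite ?le_max ?ge_min lexx.
    rewrite /D predeqE => x /=; rewrite !in_itv/= gt_max lt_min.
    split=> [[/andP[x0 x1] /andP[ax xb]]|[/andP[x0 x1] /andP[/andP[_ ->] /andP[_ ->]]]].
      by rewrite x0 x1 ax xb.
    by rewrite x0 x1.
  - by rewrite (PhiE _ D) ?setIT ?setIid// itv0.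
have mA : measurable (A1 `|` A2) by exact: measurableU.
have mD' : measurable (D `\` (A1 `|` A2)) by exact: measurableD.
have DD' : D `\` (A1 `|` A2) `<=` D by exact: subDsetl.
have : ae_eq mu (D `\` (A1 `|` A2)) (EFin \o g1) (EFin \o g2).
  apply: integral_ae_eq => //.
  - exact: integrableS ig1.
  - exact: measurable_funS mD DD' (measurable_int _ ig2).
  - move=> E ED mE.
    have ED' : E `<=` D by exact: subset_trans ED DD'.
    have EA1 : E `<=` ~` A1 by move=> x /ED[_ h] ?; apply: h; left.
    have EA2 : E `<=` ~` A2 by move=> x /ED[_ h] ?; apply: h; right.
    have := Phi0 _ mE; rewrite /Phi /W /W'.
    rewrite (indef_integral_null mD mE mA1 pA1)// (indef_integral_null mD mE mA1 nA1)//.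
    rewrite (indef_integral_null mD mE mA2 pA2)// (indef_integral_null mD mE mA2 nA2)//.
    rewrite !addr0 !subr0 /indef_integral !Rintegral_mul_indic// => /eqP; rewrite subr_eq0 => /eqP h.
    rewrite -[LHS]fineK ?integrable_fin_num//; last exact: integrableS ig1.
    rewrite -[RHS]fineK ?integrable_fin_num//; last exact: integrableS ig2.
    by congr (_%:E).
have A0 : {ae mu, forall x, ~ (A1 `|` A2) x}.
  rewrite /almost_everywhere; apply: (@negligibleS _ _ _ _ (A1 `|` A2)).
    by move=> x /= /contrapT.
  by apply: negligibleU; [exact/negligibleP|exact/negligibleP].
apply: filterS2 A0 => x nA h Dx.
by have [] : EFin (g1 x) = EFin (g2 x) by apply: h; split.
Qed.

End ac_density_unique.

(** * Integration over a uniform grid *)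

Lemma integrable_setU_disj d (T : measurableType d) (R : realType)
    (m : {measure set T -> \bar R}) (A B : set T) (f : T -> \bar R) :
  measurable A -> measurable B -> [disjoint A & B] ->
  m.-integrable A f -> m.-integrable B f -> m.-integrable (A `|` B) f.
Proof.
move=> mA mB AB /integrableP[mfA fA] /integrableP[mfB fB].
have mf : measurable_fun (A `|` B) f by exact/measurable_funU.
apply/integrableP; split => //; rewrite ge0_integral_setU//.
- by rewrite lte_add_pinfty.
- exact: measurableT_comp.
Qed.

Section grid.
Variable R : realType.
Local Notation mu := (@lebesgue_measure R).
Implicit Types (x h : R).

Definition cell h x : nat := Num.truncn (x / h).

Lemma pc_extE N (z : 'I_N.+1 -> R) x : pc_ext z x = z (inord (cell (eps R N) x)).
Proof. by []. Qed.

Lemma cellE h x i : 0 < h -> i%:R * h <= x < i.+1%:R * h -> cell h x = i.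
Proof.
by move=> h0 hx; apply: truncn_def; rewrite ler_pdivlMr// ltr_pdivrMr.
Qed.

Lemma cell_itv h x : 0 < h -> 0 <= x -> (cell h x)%:R * h <= x < (cell h x).+1%:R * h.
Proof.
move=> h0 x0; have := truncn_itv (_ : 0 <= x / h); rewrite divr_ge0 ?(ltW h0)// => /(_ isT).
by rewrite ler_pdivlMr// ltr_pdivrMr.
Qed.

Lemma cell_lt h x K : 0 < h -> 0 <= x -> x < K%:R * h -> (cell h x < K)%N.
Proof. by move=> h0 x0 xK; rewrite /cell truncn_lt_nat ?divr_ge0 ?(ltW h0)// ltr_pdivrMr. Qed.

Lemma derive_continuous (F f : R -> R) : (forall x, is_derive x 1 F (f x)) -> continuous F.
Proof.
move=> dF x; apply: differentiable_continuous; apply/derivable1_diffP.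
by have [] := dF x.
Qed.

Lemma continuous_integrable_co (f : R -> R) a b : continuous f ->
  mu.-integrable `[a, b[%classic (EFin \o f).
Proof.
move=> cf; have icc : mu.-integrable `[a, b] (EFin \o f).
  apply: continuous_compact_integrable; first exact: segment_compact.
  exact: continuous_subspaceT.
by apply: integrableS icc => //; exact: subset_itv_co_cc.
Qed.

Lemma FTC_co (F f : R -> R) a b : a < b -> continuous f ->
  (forall x, is_derive x 1 F (f x)) ->
  \int[mu]_(x in `[a, b[%classic) f x = F b - F a.
Proof.
move=> ab cf dF; have cF := derive_continuous dF.
rewrite Rintegral_itv_bndo_bndc; last exact: continuous_integrable_co.
rewrite /Rintegral (@continuous_FTC2 _ f F)//.
- exact: continuous_subspaceT.
- split; first by move=> x _; have [] := dF x.
  + by apply: cvg_at_right_filter; exact: cF.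
  + by apply: cvg_at_left_filter; exact: cF.
by move=> x _; rewrite derive1E; have [] := dF x.
Qed.

Section cells.
Variables (G : nat -> R -> R) (h : R).
Hypothesis h0 : 0 < h.
Hypothesis cG : forall i, continuous (G i).

Let cellG K x : x \in `[K%:R * h, K.+1%:R * h[%classic -> G K x = G (cell h x) x.
Proof. by rewrite inE/= in_itv/= => /(cellE h0) ->. Qed.

Let splitU K : `[0, K.+1%:R * h[%classic =
  `[0, K%:R * h[%classic `|` `[K%:R * h, K.+1%:R * h[%classic :> set R.
Proof.
apply: itv_bndbnd_setU; rewrite bnd_simp; first by rewrite mulr_ge0// ltW.
by rewrite ler_pM2r// ler_nat.
Qed.

Let disj K : [disjoint (`[0, K%:R * h[%classic : set R) & `[K%:R * h, K.+1%:R * h[%classic].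
Proof.
rewrite disj_set2E; apply/eqP; rewrite -subset0 => x [] /=; rewrite !in_itv/= => /andP[_ h1] /andP[h2 _].
by move: h1; rewrite ltNge h2.
Qed.

Let cell_integrable K : mu.-integrable `[K%:R * h, K.+1%:R * h[%classic
  (EFin \o (fun x => G (cell h x) x)).
Proof.
have i1 := @continuous_integrable_co (G K) (K%:R * h) (K.+1%:R * h) (@cG K).
by apply: eq_integrable i1 => // x xK /=; rewrite (cellG xK).
Qed.

Lemma grid_integrable_co K :
  mu.-integrable `[0, K%:R * h[%classic (EFin \o (fun x => G (cell h x) x)).
Proof.
elim: K => [|K IH]; first by rewrite mul0r set_itvco0; exact: integrable_set0.
by rewrite splitU; apply: integrable_setU_disj.
Qed.

Lemma grid_integrable K :
  mu.-integrable `]0, K%:R * h[%classic (EFin \o (fun x => G (cell h x) x)).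
Proof.
by apply: integrableS (grid_integrable_co K) => //; exact: subset_itv_oo_co.
Qed.

(** The fundamental theorem of calculus on each cell, with a different primitive
    on every cell. *)
Lemma grid_FTC FF K : (forall i x, is_derive x 1 (FF i) (G i x)) ->
  \int[mu]_(x in `]0, K%:R * h[%classic) G (cell h x) x =
    \sum_(0 <= i < K) (FF i (i.+1%:R * h) - FF i (i%:R * h)).
Proof.
move=> dFF; rewrite Rintegral_itv_obnd_cbnd; last exact: grid_integrable.
elim: K => [|K IH].
  by rewrite mul0r set_itvco0 big_geq// Rintegral_set0.
have KK : K%:R * h < K.+1%:R * h by rewrite ltr_pM2r// ltr_nat.
rewrite splitU Rintegral_setU//; last by rewrite -splitU; exact: grid_integrable_co.
rewrite big_nat_recr//= IH -(FTC_co KK (@cG K) (dFF K)).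
by congr (_ + _); apply: eq_Rintegral => x /cellG.
Qed.

End cells.

End grid.

Section atoms.
Variable R : realType.
Local Notation borel := (measurableTypeR R).
Variables (c : nat -> {nonneg R}) (p : nat -> borel) (N : nat).

Definition atoms : set borel -> \bar R := msum (fun i => mscale (c i) (\d_(p i))) N.

HB.instance Definition _ := Measure.on atoms.

Let atoms_fin : fin_num_fun atoms.
Proof.
move=> A mA; rewrite /atoms /msum/=; apply/sum_fin_numP => i _ _.
by rewrite fin_numM// fin_num_measure.
Qed.

HB.instance Definition _ := Measure_isFinite.Build _ _ _ atoms atoms_fin.

Lemma atoms_compl (A : set borel) : (forall i, A (p i)) -> atoms (~` A) = 0%E.
Proof.
move=> pA; rewrite /atoms /msum big1// => i _.
by rewrite /= /mscale/= diracE memNset ?mule0//; apply.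
Qed.

Lemma ge0_integral_atoms (D : set borel) (f : borel -> \bar R) : measurable D ->
  measurable_fun D f -> (forall x, D x -> 0 <= f x)%E -> (forall i, D (p i) \/ f (p i) = 0%E) ->
  (\int[atoms]_(x in D) f x = \sum_(i < N) (c i)%:num%:E * f (p i))%E.
Proof.
move=> mD mf f0 pD; rewrite /atoms ge0_integral_measure_sum//; apply: eq_bigr => i _.
rewrite ge0_integral_mscale// integral_dirac//; congr (_ * _)%E.
rewrite diracE; have [Dp|->] := pD i; last by rewrite mule0.
by rewrite mem_set// mul1e.
Qed.

Lemma Rintegral_atoms (D : set borel) (f : borel -> R) : measurable D ->
  measurable_fun D f -> (forall i, D (p i) \/ f (p i) = 0) ->
  \int[atoms]_(x in D) f x = \sum_(i < N) (c i)%:num * f (p i).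
Proof.
move=> mD mf pD; rewrite /Rintegral integralE.
have mE : measurable_fun D (EFin \o f) by exact/measurable_EFinP.
rewrite !ge0_integral_atoms//; last 4 first.
- exact: measurable_funeneg.
- by move=> i; have [|h] := pD i; [left|right; rewrite funenegE /= h oppr0 maxxx].
- exact: measurable_funepos.
- by move=> i; have [|h] := pD i; [left|right; rewrite funeposE /= h maxxx].
rewrite funerpos funerneg.
have S g : (\sum_(i < N) (c i)%:num%:E * (EFin \o g) (p i) = (\sum_(i < N) (c i)%:num * g (p i))%:E)%E.
  by rewrite -sumEFin; apply: eq_bigr => i _; rewrite EFinM.
rewrite !S -EFinB/= -sumrB; apply: eq_bigr => i _.
by rewrite -mulrBr -[in RHS](funrposBneg f).
Qed.

End atoms.

(** * Cells of small flux *)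

(** With lam as both the parameter and the threshold in exists_big_incr, the
    contributions of the length of the interval and of the energy are at most c/8
    and 3c/16, which add up to less than c/2.  So some increment exceeds lam, and
    the flux across that cell is small. *)
Lemma exists_small_flux (R : realType) N (N1 : (1 < N)%N) (z : 'I_N.+1 -> R) (c B eta y1 y2 : R) :
  let e := eps R N in let L := abslog R N in let lam := c / (32 * (B + 1)) in
  0 < c -> 0 < eta -> perona_malik z <= B -> 0 <= y1 -> y1 <= y2 -> y2 <= 1 ->
  y2 - y1 + e <= c * lam / 8 ->
  1 <= L -> 64 / (c / (16 * (B + 1))) <= L -> 2 / (lam * eta) <= L ->
  c / 2 < `|pc_ext z y2 - pc_ext z y1| ->
  exists2 y, [/\ 0 <= y, y1 - e <= y & y <= y2] & `|flux z (cell e y).+1| <= eta.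
Proof.
move=> e L lam c0 eta0 PM y10 y12 y21 close L1 L2 L3; rewrite !pc_extE -/e => gap.
have e0 : 0 < e by exact: eps_gt0.
have L0 : 0 < L by exact: abslog_gt0.
have PM0 := perona_malik_ge0 N1 z.
have B0 : 0 < B + 1 by rewrite ltr_wpDl// (le_trans PM0).
have lam0 : 0 < lam by rewrite divr_gt0// mulr_gt0.
have /andP[i1 i2] := cell_itv e0 y10; have /andP[j1 j2] := cell_itv e0 (le_trans y10 y12).
move: i1 i2 j1 j2 gap; set i := cell _ y1; set j := cell _ y2.
rewrite -(natr1 i) -(natr1 j) !mulrDl !mul1r => i1 i2 j1 j2 gap.
have ij : (i <= j)%N.
  rewrite -ltnS -(ltr_nat R) -(ltr_pM2r e0) -natr1 mulrDl mul1r.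
  exact: le_lt_trans i1 (le_lt_trans y12 j2).
have jN : (j <= N)%N by rewrite -(ler_nat R) -(ler_pM2r e0) epsE// (le_trans j1).
have t1 : (j - i)%:R * (e / lam) <= c / 8.
  rewrite mulrA ler_pdivrMr// natrB// mulrBl [leRHS]mulrAC.
  by apply: le_trans close; move: i2 j1; clear; lra.
have t2 : (2 * lam + 2 * L * expR (- L / 4) + 2 * lam) * perona_malik z <= 3 * (c / 16).
  have -> : 3 * (c / 16) = (2 * lam + c / (16 * (B + 1)) + 2 * lam) * (B + 1).
    by rewrite /lam; field; rewrite gt_eqF.
  apply: ler_pM => //; last by rewrite (le_trans PM)// lerDl.
    have l0 := mulr_ge0 (ler0n R 2) (ltW lam0).
    apply: (addr_ge0 _ l0); apply: (addr_ge0 l0).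
    exact: mulr_ge0 (mulr_ge0 (ler0n R 2) (ltW L0)) (expR_ge0 _).
  rewrite lerD2r lerD2l -mulrA; have h4 := abslog_root4_eps_le R N1.
  apply: le_trans (ler_wpM2l (ler0n _ 2) h4) _.
  by rewrite mulrA -natrM ler_pdivrMr// mulrC -ler_pdivrMr// divr_gt0// mulr_gt0.
have sum : c / 8 + 3 * (c / 16) < c / 2 by move: c0; clear; lra.
have ijN : (i <= j <= N)%N by rewrite ij.
have [m /andP[im mj] big] := exists_big_incr N1 ijN lam0 (ltW lam0) L1
  (lt_trans (le_lt_trans (lerD t1 t2) sum) gap).
have m0 : (0 < m)%N by exact: leq_ltn_trans im.
exists (m.-1%:R * e); last first.
  rewrite (@cellE _ _ _ m.-1)//; last by rewrite lexx ltr_pM2r// ltr_nat ltnSn.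
  rewrite prednK//; apply: le_trans (flux_big N1 lam0 big) _.
  rewrite (ler_pdivrMr _ _ (mulr_gt0 L0 lam0)) mulrC -mulrA.
  by move: L3; rewrite (ler_pdivrMr _ _ (mulr_gt0 lam0 eta0)).
split; first by rewrite mulr_ge0// ltW.
  rewrite lerBlDr; apply: le_trans (ltW i2) _; rewrite lerD2r ler_pM2r// ler_nat.
  by rewrite -ltnS prednK.
apply: le_trans j1; rewrite ler_pM2r// ler_nat; exact: leq_trans (leq_pred _) mj.
Qed.

(** * The derivative of a partial interpolation *)

Section test_functions.
Variable R : realType.
Implicit Types phi : R -> R.

Lemma test_fun_derive a b phi (x : R) : test_fun a b phi -> is_derive x 1 phi (derive1 phi x).
Proof.
move=> [h _]; have := h 0%N x; rewrite derive1n0 => d.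
by rewrite derive1E; apply: DeriveDef.
Qed.

Lemma test_fun_continuous a b phi : test_fun a b phi -> continuous phi.
Proof. by move=> tp; apply: (@derive_continuous R phi (derive1 phi)) => x; exact: test_fun_derive tp. Qed.

Lemma test_fun_derive_continuous a b phi : test_fun a b phi -> continuous (derive1 phi).
Proof.
move=> [h _] x; apply: differentiable_continuous; apply/derivable1_diffP.
by have := h 1%N x; rewrite derive1n1.
Qed.

Lemma test_fun_out a b phi (x : R) : test_fun a b phi -> x \notin `]a, b[ -> phi x = 0.
Proof. by move=> [_ [K [_ Kab] K0]] /negP xab; apply: K0 => /Kab. Qed.

End test_functions.

Section partial_interp.
Variable R : realType.
Variable N : nat.
Hypothesis N1 : (1 < N)%N.
Local Notation e := (eps R N).
Local Notation mu := (@lebesgue_measure R).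
Implicit Types (z : 'I_N.+1 -> R).

Let e0 : 0 < e. Proof. exact: eps_gt0. Qed.

Lemma cell_ltN x : 0 < x < 1 -> (cell e x < N)%N.
Proof. by move=> /andP[x0 x1]; apply: cell_lt => //; [exact: ltW|rewrite epsE]. Qed.

Lemma partial_interpE z x : 0 < x < 1 ->
  partial_interp z x = z (inord (cell e x)) + slope z (cell e x) * (x - (cell e x)%:R * e).
Proof.
move=> x01; have := cell_ltN x01; rewrite /partial_interp -/(cell e x) /slope.
set i := cell e x => iN; rewrite (ltn_eqF iN) orbF.
case: ifP => _; first by rewrite mul0r addr0.
by rewrite /incr /=; field; rewrite gt_eqF.
Qed.

Lemma is_derive_affine_mul (a s c x : R) (phi : R -> R) : is_derive x 1 phi (derive1 phi x) ->
  is_derive x 1 (fun y => (a + s * (y - c)) * phi y)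
    ((a + s * (x - c)) * derive1 phi x + s * phi x).
Proof.
move=> dp.
have da : is_derive x 1 (fun y : R => a + s * (y - c)) s.
  have -> : (fun y : R => a + s * (y - c)) = cst a + s \*: (@id R - cst c) by [].
  by apply: is_derive_eq; rewrite subr0 add0r /GRing.scale/= mulr1.
by have := is_deriveM da dp; rewrite /GRing.scale/= [phi x * s]mulrC.
Qed.

Lemma max0_ge0 (x : R) : 0 <= Num.max x 0. Proof. by rewrite le_max lexx orbT. Qed.

Definition jump_height z i : R := if jump_cell z i then incr z i.+1 else 0.

(** Integration by parts cell by cell; the values at the nodes telescope except for
    the jumps. *)
Lemma integral_partial_interp z phi : test_fun 0 1 phi ->
  [/\ mu.-integrable `]0, 1[%classic (EFin \o (fun x => partial_interp z x * derive1 phi x)),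
      mu.-integrable `]0, 1[%classic (EFin \o (fun x => slope z (cell e x) * phi x)) &
    \int[mu]_(x in `]0, 1[) (partial_interp z x * derive1 phi x) =
    - (\int[mu]_(x in `]0, 1[) (slope z (cell e x) * phi x)
       + \sum_(0 <= i < N) jump_height z i * phi (i.+1%:R * e))].
Proof.
move=> tp; have cp := test_fun_continuous tp; have cdp := test_fun_derive_continuous tp.
pose A i x := z (inord i) + slope z i * (x - i%:R * e).
have cA i : continuous (A i).
  move=> x; apply: cvgD; first exact: cvg_cst.
  by apply: cvgMr; apply: cvgB; [exact: cvg_id|exact: cvg_cst].
pose G i x := A i x * derive1 phi x + slope z i * phi x.
pose FF i x := A i x * phi x.
have cG i : continuous (G i).
  by move=> x; apply: cvgD; [apply: cvgM; [exact: cA|exact: cdp]|apply: cvgMr; exact: cp].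
have dFF i (x : R) : is_derive x 1 (FF i) (G i x).
  by apply: is_derive_affine_mul; exact: test_fun_derive tp.
have i1 := grid_integrable e0 cG N.
have I1 := grid_FTC e0 cG N dFF.
have i2 : mu.-integrable `]0, N%:R * e[%classic (EFin \o (fun x => slope z (cell e x) * phi x)).
  have cs i : continuous (fun x => slope z i * phi x) by move=> x; apply: cvgMr; exact: cp.
  exact: (grid_integrable e0 cs N).
rewrite epsE// in i1 I1 i2.
have E (x : R) : x \in `]0, 1[%classic -> partial_interp z x * derive1 phi x =
   G (cell e x) x - slope z (cell e x) * phi x.
  rewrite inE/= in_itv/= => x01.
  by rewrite partial_interpE// /G addrK.
have i3 : mu.-integrable `]0, 1[%classic (EFin \o (fun x => partial_interp z x * derive1 phi x)).
  apply: eq_integrable (integrableB _ i1 i2) => // x x01 /=.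
  by rewrite E.
split=> //.
transitivity (\int[mu]_(x in `]0, 1[) (G (cell e x) x - slope z (cell e x) * phi x)).
  exact: eq_Rintegral.
rewrite RintegralB// I1 opprD addrC; congr (_ + _).
rewrite (eq_bigr (fun i => (z (inord i.+1) * phi (i.+1%:R * e) - z (inord i) * phi (i%:R * e))
   - jump_height z i * phi (i.+1%:R * e))) => [|i _]; last first.
  rewrite /FF /A subrr mulr0 addr0 /slope /jump_height.
  have -> : i.+1%:R * e - i%:R * e = e by rewrite -natr1; ring.
  by case: ifP => _; rewrite ?mul0r ?addr0 /incr/= ?mulfVK ?gt_eqF//; ring.
rewrite sumrB telescope_sumr// epsE// mul0r.
rewrite !(test_fun_out tp) ?mulr0 ?subrr ?add0r//; by rewrite in_itv/= ltxx ?andbF.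
Qed.

(** The singular part is atomic: the positive jumps give one measure, the negative
    jumps the other. *)
Lemma ac_density_partial_interp z :
  ac_density (partial_interp z) (fun x => slope z (cell e x)).
Proof.
split.
  have cs i : continuous (fun _ : R => slope z i) by move=> x; exact: cvg_cst.
  by have := grid_integrable e0 cs N; rewrite epsE.
pose p i : R := i.+1%:R * e.
pose cp i : {nonneg R} := NngNum (max0_ge0 (jump_height z i)).
pose cn i : {nonneg R} := NngNum (max0_ge0 (- jump_height z i)).
have cA : countable (range p) by apply: (sub_countable (card_image_le p setT)); exact: countableP.
exists (atoms cp p N), (atoms cn p N), (range p); split.
- exact: countable_measurable.
- exact: countable_lebesgue_measure0.
- by apply: atoms_compl => i; exists i.
- by apply: atoms_compl => i; exists i.
move=> phi tp; have [_ _ ->] := integral_partial_interp z tp.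
have mphi : measurable_fun (`]0, 1[%classic : set (measurableTypeR R)) phi.
  by apply: measurable_funTS; apply: continuous_measurable_fun; exact: test_fun_continuous tp.
have out i : (`]0, 1[%classic : set (measurableTypeR R)) (p i) \/ phi (p i) = 0.
  have [h|h] := boolP (p i \in `]0, 1[); first by left.
  by right; exact: test_fun_out tp h.
rewrite !Rintegral_atoms//; congr (- _); rewrite -addrA; congr (_ + _).
rewrite big_mkord -sumrB; apply: eq_bigr => i _ /=.
rewrite -mulrBl; congr (_ * _).
by rewrite /Order.max; case: ltgtP; rewrite ?oppr_lt0 ?oppr_gt0; case: ltgtP; lra.
Qed.

Lemma ac_deriv_partial_interp z :
  ae_eq mu `]0, 1[%classic (ac_deriv (partial_interp z)) (fun x => slope z (cell e x)).
Proof.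
apply: (ac_density_unique _ (ac_density_partial_interp z)).
have := @xgetPex _ (cst 0) [set g | ac_density (partial_interp z) g].
by apply; exists (fun x => slope z (cell e x)); exact: ac_density_partial_interp.
Qed.

End partial_interp.

(** * Square-integrable functions and step functions *)

Lemma bounded_integrable d (T : measurableType d) (R : realType)
    (m : {measure set T -> \bar R}) (A : set T) (f : T -> R) C :
  measurable A -> (m A < +oo)%E -> measurable_fun A f ->
  (forall x, A x -> `|f x| <= C) -> m.-integrable A (EFin \o f).
Proof.
move=> mA Afin mf fC; apply: measurable_bounded_integrable => //.
exists C; split; first exact: num_real.
by move=> C' CC' x Ax /=; apply: le_trans (fC _ Ax) (ltW CC').
Qed.

Section bounded_multiplier.
Context d (T : measurableType d) (R : realType) (m : {measure set T -> \bar R}).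
Variables (A : set T) (f psi : T -> R) (B : R).
Hypotheses (mA : measurable A) (intf : m.-integrable A (EFin \o f)).
Hypotheses (mpsi : measurable_fun A psi) (hB : forall x, A x -> `|psi x| <= B).

Lemma integrable_mul_bounded : m.-integrable A (EFin \o (fun x => f x * psi x)).
Proof.
have /measurable_EFinP mf := measurable_int _ intf.
apply: (@integrable_le _ _ _ _ _ _ _ (fun x => B * `|f x|)) => //.
- exact: measurable_funM.
- have := integrableZl mA B (integrable_norm intf); exact.
- by move=> x Ax; rewrite normrM mulrC ler_wpM2r// hB.
Qed.

Lemma normr_Rintegral_mul_le : 
  `|\int[m]_(x in A) (f x * psi x)| <= B * \int[m]_(x in A) `|f x|.
Proof.
apply: le_trans (le_normr_Rintegral mA integrable_mul_bounded) _.
rewrite -RintegralZl//; last exact: integrable_norm.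
apply: le_Rintegral => //.
- exact: integrable_norm integrable_mul_bounded.
- have := integrableZl mA B (integrable_norm intf); exact.
- by move=> x Ax; rewrite normrM mulrC ler_wpM2r// hB.
Qed.

End bounded_multiplier.

Section L2.
Variable R : realType.
Local Notation mu := (@lebesgue_measure R).
Local Notation D := (`]0, 1[%classic : set (measurableTypeR R)).
Implicit Types f g : R -> R.

(** The square of the L^2 norm on ]0, 1[, which avoids roots in the estimates. *)
Definition sqL2 f : \bar R := \int[mu]_(x in D) (f x ^+ 2)%:E.

Lemma sqL2_ge0 f : (0 <= sqL2 f)%E.
Proof. by apply: integral_ge0 => x _; rewrite lee_fin sqr_ge0. Qed.

Lemma L2norm_sqr f : (L2norm 0 1 f `^ 2 = sqL2 f)%E.
Proof.
rewrite /L2norm poweR_Lnorm// /sqL2 [RHS]integral_mkcond; apply: eq_integral => x _.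
rewrite /= patchE /patch; case: ifP => _ /=; last by rewrite normr0 powR0.
by rewrite powR_mulrn// real_normK ?num_real.
Qed.

Lemma L2norm_le f c : (L2norm 0 1 f <= c%:E)%E -> (sqL2 f <= (c ^+ 2)%:E)%E.
Proof.
move=> h; have c0 : 0 <= c by rewrite -lee_fin (le_trans _ h)// Lnorm_ge0.
rewrite -L2norm_sqr -(powR_mulrn _ c0).
have -> : (c `^ 2%:R)%:E = (c%:E `^ 2%:R)%E by [].
by apply: gt0_ler_poweR; rewrite ?in_itv/= ?leey ?andbT ?Lnorm_ge0// lee_fin.
Qed.

Lemma L2_measurable f : L2 0 1 f -> measurable_fun D f.
Proof.
move=> h; have mf : measurable_fun setT (f \_ D).
  by have := sub_Lfun_mfun h; rewrite inE.
exact/(measurable_restrictT f _).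
Qed.

Lemma L2_sqr_integrable f : L2 0 1 f -> mu.-integrable D (EFin \o (fun x => f x ^+ 2)).
Proof.
move=> /Lfun2_integrable_sqr h.
apply/(integrable_mkcond _ _).2 => //.
apply: eq_integrable h => // x _ /=.
by rewrite !patchE; case: ifP => //=; rewrite expr0n.
Qed.

Lemma bounded_L2 f C : measurable_fun D f -> (forall x, D x -> `|f x| <= C) -> L2 0 1 f.
Proof.
move=> mf fC.
have sq : mu.-integrable D (EFin \o (fun x => f x ^+ 2)).
  apply: (bounded_integrable (C := C ^+ 2)) => //.
  - by rewrite [X in (X < _)%E]lebesgue_measure_itv/= lte01 oppr0 adde0 ltry.
  - exact: measurable_funX.
  - move=> x Dx; rewrite ger0_norm ?sqr_ge0// -real_normK ?num_real//.
    by rewrite lerXn2r ?nnegrE// ?(le_trans _ (fC _ Dx))// fC.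
rewrite /L2 inE; apply/andP; split.
  by rewrite inE/=; apply/(measurable_restrictT f _).
rewrite inE/= /finite_norm; apply: (@lty_poweRy _ _ 2) => //.
rewrite -/(L2norm 0 1 f) L2norm_sqr.
by have := integrable_fin_num _ sq; rewrite fin_numE => /(_ _)/andP[] // _; rewrite -ltey.
Qed.

Lemma sqL2_add3 f g (h : R -> R) : measurable_fun D f -> measurable_fun D g -> measurable_fun D h ->
  (sqL2 (fun x => f x + g x + h x)%R <= 3%:E * (sqL2 f + sqL2 g + sqL2 h))%E.
Proof.
move=> mf mg mh.
have mX (k : R -> R) : measurable_fun D k -> measurable_fun D (fun x => (k x ^+ 2)%:E).
  by move=> mk; apply/measurable_EFinP; exact: measurable_funX.
have p x (k : R -> R) : (0 <= (k x ^+ 2)%:E)%E by rewrite lee_fin sqr_ge0.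
have [mf2 mg2 mh2] := And3 (mX _ mf) (mX _ mg) (mX _ mh).
have mfg := emeasurable_funD mf2 mg2; have mfgh := emeasurable_funD mfg mh2.
rewrite /sqL2 -ge0_integralD//.
rewrite -ge0_integralD//; last by move=> x _; rewrite adde_ge0.
rewrite -ge0_integralZl_EFin//; last by move=> x _; rewrite !adde_ge0.
apply: ge0_le_integral => //.
- by apply: (mX (fun x => f x + g x + h x)); exact: measurable_funD (measurable_funD mf mg) mh.
- exact: measurable_funeM.
- move=> x _; rewrite -!EFinD -EFinM lee_fin.
  have := sqr_ge0 (f x - g x); have := sqr_ge0 (f x - h x); have := sqr_ge0 (g x - h x).
  nra.
Qed.

End L2.

Section step_functions.
Variable R : realType.
Local Notation mu := (@lebesgue_measure R).
Local Notation borel := (measurableTypeR R).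
Implicit Types (h x : R) (a : nat -> R).

Lemma step_integrable h a K : 0 < h ->
  mu.-integrable `]0, K%:R * h[%classic (EFin \o (fun x => a (cell h x))).
Proof.
move=> h0; have c i : continuous (fun _ : R => a i) by move=> x; exact: cvg_cst.
exact: (grid_integrable h0 c K).
Qed.

Lemma step_integral h a K : 0 < h ->
  \int[mu]_(x in `]0, K%:R * h[%classic) a (cell h x) = \sum_(0 <= i < K) h * a i.
Proof.
move=> h0; have c i : continuous (fun _ : R => a i) by move=> x; exact: cvg_cst.
have d i (x : R) : is_derive x 1 (fun x => a i * x) (a i).
  have -> : (fun x => a i * x) = a i \*: (@id R) by [].
  by apply: is_derive_eq; rewrite /GRing.scale/= mulr1.
rewrite (grid_FTC h0 c K d); apply: eq_bigr => i _.
by rewrite -natr1; ring.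
Qed.

Lemma measurable_step h a K : 0 < h ->
  measurable_fun (`]0, K%:R * h[%classic : set borel) (fun x => a (cell h x)).
Proof.
by move=> h0; have /measurable_EFinP := measurable_int _ (@step_integrable h a K h0).
Qed.

Section pc.
Variable N : nat.
Hypothesis N1 : (1 < N)%N.
Local Notation e := (eps R N).
Implicit Types z w : 'I_N.+1 -> R.

Lemma measurable_step01 a : measurable_fun (`]0, 1[%classic : set borel) (fun x => a (cell e x)).
Proof. by have := @measurable_step e a N (eps_gt0 R N1); rewrite epsE. Qed.

Lemma step_integral01 a : \int[mu]_(x in `]0, 1[%classic) a (cell e x) = \sum_(0 <= i < N) e * a i.
Proof. by rewrite -step_integral ?eps_gt0// epsE. Qed.

Lemma step_integrable01 a :
  mu.-integrable `]0, 1[%classic (EFin \o (fun x => a (cell e x))).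
Proof. by have := @step_integrable e a N (eps_gt0 R N1); rewrite epsE. Qed.

Lemma measurable_pc_ext z : measurable_fun (`]0, 1[%classic : set borel) (pc_ext z).
Proof. exact: (measurable_step01 (fun i => z (inord i))). Qed.

Lemma sqL2_pc_ext z w : (sqL2 (fun x => pc_ext z x - pc_ext w x)%R <= (dist2 z w)%:E)%E.
Proof.
pose a i := (z (inord i) - w (inord i)) ^+ 2.
have -> : sqL2 (fun x => pc_ext z x - pc_ext w x) = (\int[mu]_(x in `]0, 1[%classic) a (cell e x))%:E.
  by rewrite /Rintegral fineK// (integrable_fin_num _ (step_integrable01 a)).
rewrite step_integral01 lee_fin /dist2 big_nat_recr//= lerDl.
by rewrite mulr_ge0 ?sqr_ge0// ltW// eps_gt0.
Qed.

End pc.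
End step_functions.

Lemma ae_exists_itv (R : realType) (P : R -> Prop) (a b : R) : a < b ->
  {ae @lebesgue_measure R, forall x, P x} -> exists2 x, a < x < b & P x.
Proof.
move=> ab [B [mB B0 PB]]; apply: contrapT => nP.
have sub : (`]a, b[%classic : set (measurableTypeR R)) `<=` B.
  move=> x /=; rewrite in_itv/= => xab; apply: PB => /= Px.
  by apply: nP; exists x.
have : (@lebesgue_measure R `]a, b[%classic <= @lebesgue_measure R B)%E.
  by apply: le_measure sub; rewrite inE.
by rewrite B0 lebesgue_measure_itv/= lte_fin ab -EFinB lee_fin subr_le0 leNgt ab.
Qed.

(** A mean value inequality for the average over ]a, b[, written as an integral
    against a bounded function on ]0, 1[, the form in which weak convergence
    applies. *)
Lemma average_near (R : realType) (f : R -> R) (a b c eta : R) :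
  let D := (`]0, 1[%classic : set (measurableTypeR R)) in
  0 <= a -> a < b -> b <= 1 -> (@lebesgue_measure R).-integrable D (EFin \o f) ->
  (forall y, a < y < b -> `|f y - c| <= eta) ->
  `|\int[@lebesgue_measure R]_(x in D) (f x * (\1_(`]a, b[%classic) x / (b - a))) - c| <= eta.
Proof.
move=> D a0 ab b1 intf hf; set psi := fun x => \1_(`]a, b[%classic) x / (b - a).
have ba : 0 < b - a by rewrite subr_gt0.
have mJ : measurable (`]a, b[%classic : set (measurableTypeR R)) by exact: measurable_itv.
have mD : measurable D by exact: measurable_itv.
have mpsi : measurable_fun D psi.
  by apply: measurable_funM => //; exact: measurable_indic.
have psi01 x : 0 <= psi x <= (b - a)^-1.
  by rewrite /psi indicE; case: (_ \in _); rewrite ?mul1r ?mul0r ?lexx ?invr_ge0 ltW// invr_gt0.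
have bpsi x : D x -> `|psi x| <= (b - a)^-1.
  by move=> _; have /andP[h0 h1] := psi01 x; rewrite ger0_norm.
have ipsi : (@lebesgue_measure R).-integrable D (EFin \o psi).
  apply: (bounded_integrable (C := (b - a)^-1)) => //.
  by rewrite [X in (X < _)%E]lebesgue_measure_itv/= lte01 oppr0 adde0 ltry.
have intpsi : \int[@lebesgue_measure R]_(x in D) psi x = 1.
  rewrite RintegralZr//; last first.
    apply: (bounded_integrable (C := 1)) => //.
    - by rewrite [X in (X < _)%E]lebesgue_measure_itv/= lte01 oppr0 adde0 ltry.
    - by move=> x _; rewrite indicE; case: (_ \in _); rewrite ?normr0 ?normr1.
  rewrite /Rintegral integral_indic// setIidl; last by apply: subset_itvSoo; rewrite bnd_simp.
  have := lebesgue_measure_itv `]a, b[; rewrite /= lte_fin ab -EFinB => -> /=.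
  by rewrite divff ?gt_eqF.
have ifpsi := integrable_mul_bounded _ intf mpsi bpsi.
have icpsi k : (@lebesgue_measure R).-integrable D (EFin \o (fun x => k * psi x)).
  by have := integrableZl mD k ipsi.
have key x : (c - eta) * psi x <= f x * psi x <= (c + eta) * psi x.
  have [xJ|xJ] := boolP (x \in (`]a, b[%classic : set R)); last first.
    by rewrite /psi indicE (negPf xJ) mul0r !mulr0 lexx.
  have : `|f x - c| <= eta by apply: hf; move: xJ; rewrite inE /= in_itv.
  rewrite ler_distl => /andP[h1 h2]; have /andP[p0 _] := psi01 x.
  by rewrite !ler_wpM2r.
have h k : \int[@lebesgue_measure R]_(x in D) (k * psi x) = k.
  by rewrite RintegralZl// intpsi mulr1.
rewrite ler_distl -[X in X <= _ <= _]h -[X in _ <= _ <= X]h.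
apply/andP; split; apply: le_Rintegral => //; do ?exact: ifpsi.
- by move=> x _; have /andP[] := key x.
- by move=> x _; have /andP[] := key x.
Qed.

Section fatou.
Local Open Scope ereal_scope.
Variable R : realType.
Implicit Types (a : nat -> \bar R) (c : \bar R).

Lemma limn_einf_le_near a c : (\forall n \near \oo, a n <= c) -> limn_einf a <= c.
Proof.
move=> h; rewrite limn_einf_lim; apply: lime_le; first exact: is_cvg_einfs.
near=> n; apply: (@le_trans _ _ (a n)); last by near: n.
by apply: ereal_inf_lbound; exists n => /=.
Unshelve. all: end_near. Qed.

Lemma limn_einf_lt_often a c : limn_einf a < c -> forall m, exists2 n, (m <= n)%N & a n < c.
Proof.
move=> h m; apply: contrapT => nh; move: h; rewrite ltNge => /negP; apply.
rewrite limn_einf_lim; apply: lime_ge; first exact: is_cvg_einfs.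
near=> n; apply: le_ereal_inf_tmp => _ [k /= nk <-]; rewrite leNgt; apply/negP => kc.
apply: nh; exists k => //; apply: leq_trans nk; near: n; exact: nbhs_infty_ge.
Unshelve. all: end_near. Qed.

(** Fatou bounds the integral of the lower limit, which is therefore finite almost
    everywhere, and zero almost everywhere if the bound is zero. *)
Lemma fatou_ae d (T : measurableType d) (m : {measure set T -> \bar R}) (D : set T)
    (f : nat -> T -> R) (c : R) :
  measurable D -> (forall n, measurable_fun D (f n)) -> (forall n x, D x -> (0 <= f n x)%R) ->
  limn_einf (fun n => \int[m]_(x in D) (f n x)%:E) <= c%:E ->
  {ae m, forall x, D x -> limn_einf (fun n => (f n x)%:E) < +oo} /\
  (c = 0%R -> {ae m, forall x, D x -> limn_einf (fun n => (f n x)%:E) = 0}).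
Proof.
move=> mD mf f0 hc.
pose G x := limn_einf (fun n => (f n x)%:E).
have mG : measurable_fun D G.
  have h : measurable_fun D (fun x => limn_esup (\- (fun n => (f n x)%:E))).
    apply: (@measurable_fun_limn_esup _ _ R D (fun n x => - (f n x)%:E)) => n.
    by apply: measurableT_comp => //; exact/measurable_EFinP.
  exact: measurableT_comp h.
have G0 x : D x -> 0 <= G x.
  move=> Dx; rewrite /G limn_einf_lim; apply: lime_ge; first exact: is_cvg_einfs.
  by apply: nearW => n; apply: le_ereal_inf_tmp => _ [k _ <-]; rewrite lee_fin f0.
have IG : \int[m]_(x in D) G x <= c%:E.
  by apply: le_trans hc; apply: fatou => // n; exact/measurable_EFinP.
have iG : m.-integrable D G.
  apply/integrableP; split => //.
  rewrite (eq_integral G) => [|x /set_mem Dx]; last by rewrite gee0_abs// G0.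
  by rewrite (le_lt_trans IG)// ltry.
split.
  have := integrable_ae mD iG; apply: filterS => x /= h Dx.
  by have := h Dx; rewrite ge0_fin_numE// G0.
move=> c0; have I0 : \int[m]_(x in D) `|G x| = 0.
  rewrite (eq_integral G) => [|x /set_mem Dx]; last by rewrite gee0_abs// G0.
  by move: IG; rewrite c0 => IG; apply/eqP; rewrite eq_le IG integral_ge0.
by have /(ae_eq_integral_abs _ mD mG) := I0; apply: filterS => x /= h /h.
Qed.

End fatou.

(** * Test functions in space and time *)

Section space_time_tests.
Variable R : realType.
Implicit Types (phi psi : R -> R -> R) (K : set (R * R)).

Definition jointly_continuous psi := continuous (fun p : R * R => psi p.1 p.2).

Lemma slice_cvg_x (t x : R) : (fun y : R => (t, y)) @ x --> ((t, x) : R * R).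
Proof. exact: (@cvg_pair R R R (nbhs x) (nbhs t) (nbhs x) _ _ _ (fun=> t) id (cvg_cst t) cvg_id). Qed.

Lemma slice_cvg_t (t x : R) : (fun s : R => (s, x)) @ t --> ((t, x) : R * R).
Proof. exact: (@cvg_pair R R R (nbhs t) (nbhs t) (nbhs x) _ _ _ id (fun=> x) cvg_id (cvg_cst x)). Qed.

Lemma jointly_continuous_x psi t : jointly_continuous psi -> continuous (psi t).
Proof.
move=> c x.
exact: (@cvg_comp _ _ _ (fun y => (t, y)) (fun p => psi p.1 p.2) (nbhs x) (nbhs ((t, x) : R * R)) _ (@slice_cvg_x t x) (c ((t, x) : R * R))).
Qed.

Lemma jointly_continuous_t psi x : jointly_continuous psi -> continuous (psi^~ x).
Proof.
move=> c t.
exact: (@cvg_comp _ _ _ (fun s => (s, x)) (fun p => psi p.1 p.2) (nbhs t) (nbhs ((t, x) : R * R)) _ (@slice_cvg_t t x) (c ((t, x) : R * R))).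
Qed.

Lemma supported_bounded K psi : compact K -> jointly_continuous psi ->
  (forall t x, ~ K (t, x) -> psi t x = 0) -> exists2 B, 0 <= B & forall t x, `|psi t x| <= B.
Proof.
move=> cK c out.
have : bounded_set ((fun p : R * R => psi p.1 p.2) @` K).
  apply: compact_bounded; apply: continuous_compact => //.
  exact: continuous_subspaceT.
move=> [B [_ hB]]; exists (`|B| + 1) => [|t x]; first by rewrite addr_ge0.
have [Kp|nK] := pselect (K (t, x)); last by rewrite out// normr0 addr_ge0.
apply: hB; first by rewrite ltr_pwDr// ler_norm.
by exists (t, x).
Qed.

Lemma partial_t_out K psi : closed K -> (forall t x, ~ K (t, x) -> psi t x = 0) ->
  forall t x, ~ K (t, x) -> partial_t psi t x = 0.
Proof.
move=> cK out t x nK; rewrite /partial_t derive1E.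
rewrite (@near_eq_derive _ _ _ _ (cst 0)) ?derive_cst//.
have cx := @slice_cvg_t t x.
have oK : nbhs ((t, x) : R * R) (~` K) by apply: open_nbhs_nbhs; split => //; exact: closed_openC.
have h : \forall s \near t, (~` K) (s, x) := cx _ oK.
by apply: filterS h => s; exact: out.
Qed.

Lemma partial_x_out K psi : closed K -> (forall t x, ~ K (t, x) -> psi t x = 0) ->
  forall t x, ~ K (t, x) -> partial_x psi t x = 0.
Proof.
move=> cK out t x nK; rewrite /partial_x derive1E.
rewrite (@near_eq_derive _ _ _ _ (cst 0)) ?derive_cst//.
have cx := @slice_cvg_x t x.
have oK : nbhs ((t, x) : R * R) (~` K) by apply: open_nbhs_nbhs; split => //; exact: closed_openC.
have h : \forall y \near x, (~` K) (t, y) := cx _ oK.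
by apply: filterS h => s; exact: out.
Qed.

(** The estimates on a test function that the passage to the limit relies on: its
    support lies in ]0, T[ x ]0, 1[, the first derivatives are bounded, and phi_t
    is Lipschitz in space. *)
Record tame phi (T Bt Bx Btx : R) : Prop := Tame {
  tame_T : 0 < T;
  tame_Bt : 0 <= Bt; tame_Bx : 0 <= Bx; tame_Btx : 0 <= Btx;
  tame_dt : forall t x : R, is_derive t 1 (phi^~ x) (partial_t phi t x);
  tame_dx : forall t x : R, is_derive x 1 (phi t) (partial_x phi t x);
  tame_cont_t : jointly_continuous (partial_t phi);
  tame_cont_x : jointly_continuous (partial_x phi);
  tame_cont : jointly_continuous phi;
  tame_boundt : forall t x, `|partial_t phi t x| <= Bt;
  tame_boundx : forall t x, `|partial_x phi t x| <= Bx;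
  tame_lip : forall t x y, `|partial_t phi t x - partial_t phi t y| <= Btx * `|x - y|;
  tame_out : forall t x, ~ [/\ 0 < t, t < T & 0 < x < 1] ->
     [/\ phi t x = 0, partial_t phi t x = 0 & partial_x phi t x = 0]
}.

Lemma test_fun2_tame phi : test_fun2 phi -> exists T Bt Bx Btx, tame phi T Bt Bx Btx.
Proof.
move=> [Cphi [K [cK Ksub] out]].
have [c0 [dt dx [ct _] [cx _]]] := Cphi 1%N.
have [_ [_ _ [_ [_ dtx _ [ctx _]]] _]] := Cphi 2%N.
have clK : closed K by apply: compact_closed => //; exact: norm_hausdorff.
have outt := partial_t_out clK out; have outx := partial_x_out clK out.
have outtx := partial_x_out clK outt.
have [Bt Bt0 hBt] := supported_bounded cK ct outt.
have [Bx Bx0 hBx] := supported_bounded cK cx outx.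
have [Btx Btx0 hBtx] := supported_bounded cK ctx outtx.
have : bounded_set (fst @` K).
  apply: compact_bounded; apply: continuous_compact => //.
  by apply: continuous_subspaceT => p; exact: cvg_fst.
move=> [T [_ hT]]; exists (`|T| + 2), Bt, Bx, Btx.
have T0 : 0 < `|T| + 2 by rewrite ltr_wpDl.
split=> //.
- by move=> t x; rewrite /partial_t derive1E; apply: DeriveDef => //; exact: dt.
- by move=> t x; rewrite /partial_x derive1E; apply: DeriveDef => //; exact: dx.
- move=> t x y; wlog xy : x y / x <= y => [hw|].
    by case: (leP x y) => [|/ltW] /hw//; rewrite distrC (distrC y).
  have ctt : {within `[x, y], continuous (partial_t phi t)}.
    exact/continuous_subspaceT/jointly_continuous_x.
  have dtt w : w \in `]x, y[ -> is_derive w 1 (partial_t phi t) (partial_x (partial_t phi) t w).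
    by move=> _; rewrite /partial_x derive1E; apply: DeriveDef => //; exact: dtx.
  have [c _] := MVT_segment xy dtt ctt.
  rewrite distrC => ->; rewrite normrM (distrC x); apply: ler_wpM2r => //.
- move=> t x h; have nK : ~ K (t, x).
    move=> Ktx; apply: h; have [/= h1 h2] := Ksub _ Ktx; split => //.
    apply: le_lt_trans (ler_norm t) _; apply: (@le_lt_trans _ _ (`|T| + 1)).
      by apply: (hT (`|T| + 1)); [rewrite ltr_pwDr// ler_norm|exists (t, x)].
    by rewrite ltrD2l ltr1n.
  by rewrite out// outt// outx.
Qed.

End space_time_tests.

(** * Strong convergence at every time *)

Section evolution.
Variable R : realType.
Local Notation mu := (@lebesgue_measure R).
Local Notation D := (`]0, 1[%classic : set (measurableTypeR R)).
Variables (u0 : forall N : nat, 'I_N.+1 -> R) (C M : R).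
Hypothesis hC : forall N (i : 'I_N.+1), (1 < N)%N -> `|u0 i| <= C.
Hypothesis henergy : forall N, (1 < N)%N -> perona_malik (@u0 N) <= M.
Variable U : forall N : nat, R -> nat -> 'I_N.+1 -> R.
Hypothesis hU : forall N (tau : R), (1 < N)%N -> 0 < tau ->
  minimizing_scheme tau (@u0 N) (@U N tau).
Variables (N_ : nat -> nat) (tau_ : nat -> R).
Hypotheses (hN : forall n, (1 < N_ n)%N) (htau : forall n, 0 < tau_ n).
Hypothesis hN0 : eps R (N_ n) @[n --> \oo] --> 0.
Hypothesis htau0 : tau_ n @[n --> \oo] --> 0.
Variable u : R -> R -> R.
Hypothesis hu : holder_half_L2 u.

Local Notation z n t := (time_ext (tau_ n) (@U (N_ n) (tau_ n)) t).

Hypothesis hcv : forall T : R, 0 <= T -> cvg_LinftyL2 T (fun n t => pc_ext (z n t)) u.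
Hypothesis hweak : forall t : R, 0 <= t ->
  weak_cvg_L2 (fun n => ac_deriv (partial_interp (z n t))) (ac_deriv (u t)).

Local Notation e n := (eps R (N_ n)).
Local Notation L n := (abslog R (N_ n)).
Local Notation err n t := (fun x => pc_ext (z n t) x - u t x).

(** The essential supremum of the errors over [0, m] tends to 0 for each m. *)
Lemma ae_L2norm_cvg : {ae mu, forall t, 0 <= t ->
  L2norm 0 1 (pc_ext (z n t) \- u t) @[n --> \oo] --> 0%E}.
Proof.
have key (m : nat) : {ae mu, forall t, 0 <= t <= m%:R ->
    L2norm 0 1 (pc_ext (z n t) \- u t) @[n --> \oo] --> 0%E}.
  have := hcv (ler0n R m); rewrite /cvg_LinftyL2; set F := (F in F n @[n --> _]) => hL.
  have mT : (0 < mu [set: R])%E by rewrite -set_itvNyy lebesgue_measure_itv/= ltry.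
  have hn n : {ae mu, forall t, (`|((fun t => L2norm 0 1 (pc_ext (z n t) \- u t)%R) \_ `[0%R, m%:R]%classic) t| <= F n)%E}.
    rewrite /F unlock mT; exact: ess_sup_ge.
  have := ae_foralln hn; apply: filterS => t ht /andP[t0 tm].
  apply: (squeeze_cvge _ (cvg_cst 0%E) hL); apply: nearW => n.
  have L0 : (0 <= L2norm 0 1 (pc_ext (z n t) \- u t)%R)%E by exact: Lnorm_ge0.
  have := ht n; rewrite patchE mem_set; last by rewrite /= in_itv/= t0.
  by rewrite gee0_abs// L0.
have := ae_foralln key; apply: filterS => t ht t0; apply: (ht (Num.truncn t).+1).
by rewrite t0/= ltW// truncnS_gt.
Qed.

Lemma measurable_u t : 0 <= t -> measurable_fun D (u t).
Proof. by move=> t0; apply: L2_measurable; apply: hu.1. Qed.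

Lemma energy_bound n k : perona_malik (@U (N_ n) (tau_ n) k) <= M.
Proof. exact: (scheme_energy (hN n) (htau n) (hU (hN n) (htau n)) (henergy (hN n))). Qed.

Lemma M_ge0 : 0 <= M.
Proof. exact: le_trans (perona_malik_ge0 (hN 0) _) (energy_bound 0 0). Qed.

(** The Hoelder estimate of the scheme, with the error tau_ n of rounding the times. *)
Lemma sqL2_time n (s t : R) : 0 <= s <= t ->
  (sqL2 (fun x => pc_ext (z n t) x - pc_ext (z n s) x)%R <= (2 * M * (t - s + tau_ n))%:E)%E.
Proof.
move=> /andP[s0 st]; apply: (le_trans (sqL2_pc_ext (hN n) _ _)); rewrite lee_fin.
have t0 := htau n.
have ts : 0 <= s / tau_ n <= t / tau_ n by rewrite divr_ge0 ?ler_pM2r ?invr_gt0// ltW.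
have kl : (Num.truncn (s / tau_ n) <= Num.truncn (t / tau_ n))%N.
  by move/andP: ts => [s1 s2]; rewrite truncn_ge_nat ?(le_trans s1)// (le_trans _ s2)// truncn_le.
apply: le_trans (scheme_holder (hN n) t0 (hU (hN n) t0) (henergy (hN n)) kl) _.
rewrite (_ : _ * (2 * tau_ n * M) = 2 * M * ((Num.truncn (t / tau_ n))%:R * tau_ n - (Num.truncn (s / tau_ n))%:R * tau_ n)); last first.
  by rewrite natrB//; ring.
rewrite ler_wpM2l ?mulr_ge0 ?M_ge0//.
have /andP[h1 _] := cell_itv t0 (le_trans s0 st).
have /andP[_ h2] := cell_itv t0 s0.
by move: h1 h2; rewrite /cell -natr1; lra.
Qed.

(** Convergence holds at some time s slightly after t; the uniform Hoelder
    continuity in time of the discrete evolutions and of u carries it back to t. *)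
Lemma sqL2_cvg t (eta : R) : 0 <= t -> 0 < eta ->
  \forall n \near \oo, (sqL2 (err n t) <= eta%:E)%E.
Proof.
move=> t0 eta0; have [_ [Ch hCh]] := hu.
(* The error at t is a sum of three terms, and the square of a sum of three
   terms is at most three times the sum of the squares. *)
pose K := 2 * M + Ch ^+ 2 + 1; pose del := eta / (12 * K).
have M0 := M_ge0; have Ch0 := sqr_ge0 Ch.
have K0 : 0 < K by rewrite /K; lra.
have delE : del * K = eta / 12 by rewrite /del; field; rewrite gt_eqF.
have del0 : 0 < del by rewrite divr_gt0// mulr_gt0.
have tdel : t < t + del by rewrite ltrDl.
have [s /andP[ts sd] hs] := ae_exists_itv tdel ae_L2norm_cvg.
have s0 : 0 <= s by rewrite (le_trans t0)// ltW.
have e0 : 0 < Num.sqrt (eta / 12) by rewrite sqrtr_gt0 divr_gt0.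
have hs' : \forall n \near \oo, (L2norm 0 1 (pc_ext (z n s) \- u s)%R <= (Num.sqrt (eta / 12))%:E)%E.
  have /fine_cvgP[hf hc] := hs s0; near=> n.
  rewrite -[leLHS]fineK; last by near: n; exact: hf.
  by rewrite lee_fin ltW//; near: n; exact: (cvgr_lt _ hc).
near=> n.
have taun : tau_ n < del.
  by near: n; exact: (cvgr_lt _ htau0).
have h1 : (sqL2 (err n s) <= (eta / 12)%:E)%E.
  rewrite -(sqr_sqrtr (ltW (divr_gt0 eta0 (ltr0n R 12) : 0 < eta / 12))); apply: L2norm_le.
  by near: n.
have h2 : (sqL2 (fun x => pc_ext (z n t) x - pc_ext (z n s) x)%R <= (2 * M * (s - t + tau_ n))%:E)%E.
  have := @sqL2_time n t s; rewrite t0/= (ltW ts) => /(_ isT); congr (_ <= _)%E.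
  by apply: eq_integral => x _; congr (_%:E); ring.
have h3 : (sqL2 (fun x => u s x - u t x)%R <= (Ch ^+ 2 * (s - t))%:E)%E.
  have := L2norm_le (hCh _ _ t0 s0); rewrite exprMn sqr_sqrtr// ger0_norm//.
  by rewrite subr_ge0 ltW.
have mz r : measurable_fun D (pc_ext (z n r)) by exact: measurable_pc_ext.
have ms := measurable_u s0; have mt := measurable_u t0.
have -> : err n t = (fun x => (pc_ext (z n t) x - pc_ext (z n s) x) + (pc_ext (z n s) x - u s x) + (u s x - u t x)).
  by apply/funext => x; ring.
apply: (le_trans (sqL2_add3 _ _ _)); try exact: measurable_funB.
apply: (@le_trans _ _ (3%:E * ((2 * M * (s - t + tau_ n))%:E + (eta / 12)%:E + (Ch ^+ 2 * (s - t))%:E))%E).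
  by rewrite lee_pmul2l// !leeD.
rewrite -!EFinD -EFinM lee_fin.
have : (2 * M + Ch ^+ 2) * (s - t) <= (2 * M + Ch ^+ 2) * del by rewrite ler_wpM2l; lra.
have : 2 * M * tau_ n <= 2 * M * del by rewrite ler_wpM2l; lra.
have : 0 <= Ch ^+ 2 * del by rewrite mulr_ge0// ltW.
have : 0 <= M * del by rewrite mulr_ge0// ltW.
by have := delE; rewrite /K; lra.
Unshelve. all: end_near. Qed.

(** * Weak convergence of the flux *)

Definition wflux n t x : R := flux (z n t) (cell (e n) x).+1.

Lemma wflux_integrable n t : mu.-integrable D (EFin \o wflux n t).
Proof. exact: (step_integrable01 (hN n) (fun i => flux (z n t) i.+1)). Qed.

Lemma wflux_L1 n t : \int[mu]_(x in D) `|wflux n t x| <= 2 + 6 * M.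
Proof.
rewrite (step_integral01 (hN n) (fun i => `|flux (z n t) i.+1|)).
apply: le_trans (flux_L1 (hN n) _) _.
have h1 : Num.sqrt (L n * e n) <= 1.
  by rewrite -[leRHS](@sqrtr1 R) ler_sqrt// abslog_eps_le1.
have h2 := energy_bound n (Num.truncn (t / tau_ n)).
have h3 := perona_malik_ge0 (hN n) (z n t).
have h4 := sqrtr_ge0 (L n * e n).
by rewrite /time_ext in h3 *; nra.
Qed.

Lemma wflux_mul_le n t (psi : R -> R) B : 0 <= B -> measurable_fun D psi ->
  (forall x, D x -> `|psi x| <= B) ->
  `|\int[mu]_(x in D) (wflux n t x * psi x)| <= B * (2 + 6 * M).
Proof.
move=> B0 mpsi hB; have iw := wflux_integrable n t.
apply: le_trans (normr_Rintegral_mul_le _ iw mpsi hB) _ => //.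
by rewrite ler_wpM2l// wflux_L1.
Qed.

(** By flux_slope the flux differs from twice the derivative of the partial
    interpolation by a sequence that tends to 0 in L^1. *)
Lemma wflux_weak_cvg t (psi : R -> R) B : 0 <= t -> measurable_fun D psi ->
  (forall x, D x -> `|psi x| <= B) ->
  \int[mu]_(x in D) (wflux n t x * psi x) @[n --> \oo] -->
  2 * \int[mu]_(x in D) (ac_deriv (u t) x * psi x).
Proof.
move=> t0 mpsi hB.
have B0 : 0 <= B by apply: le_trans (hB 2^-1 _) => //=; rewrite in_itv/=; lra.
have [h1 h2 h3] := hweak t0; have {}h3 := h3 psi (bounded_L2 mpsi hB).
pose s n x := slope (z n t) (cell (e n) x).
have is_ n : mu.-integrable D (EFin \o s n) := step_integrable01 (hN n) (slope (z n t)).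
have ms n : measurable_fun D (s n) by have /measurable_EFinP := measurable_int _ (is_ n).
have isp n : mu.-integrable D (EFin \o (fun x => s n x * psi x)).
  exact: (integrable_mul_bounded _ (is_ n) mpsi hB).
have idiff n : mu.-integrable D (EFin \o (fun x => wflux n t x - 2 * s n x)).
  exact: (step_integrable01 (hN n) (fun i => flux (z n t) i.+1 - 2 * slope (z n t) i)).
have sE n : \int[mu]_(x in D) (ac_deriv (partial_interp (z n t)) x * psi x) = \int[mu]_(x in D) (s n x * psi x).
  rewrite /Rintegral; congr fine; apply: ae_eq_integral => //.
  - by apply/measurable_EFinP; apply: measurable_funM => //; exact: L2_measurable.
  - by apply/measurable_EFinP; exact: measurable_funM.
  - apply: filterS (ac_deriv_partial_interp (hN n) (z n t)) => x /= hx Dx.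
    by rewrite hx.
have h4 : \int[mu]_(x in D) (s n x * psi x) @[n --> \oo] --> \int[mu]_(x in D) (ac_deriv (u t) x * psi x).
  by under eq_fun do rewrite -sE.
rewrite (_ : (fun _ => _) = fun n => 2 * \int[mu]_(x in D) (s n x * psi x)
   + \int[mu]_(x in D) ((wflux n t x - 2 * s n x) * psi x)); last first.
  apply/funext => n; rewrite -RintegralZl// -RintegralD//.
  - by apply: eq_Rintegral => x _; ring.
  - by have := integrableZl _ 2 (isp n); exact.
  - exact: (integrable_mul_bounded _ (idiff n) mpsi hB).
rewrite -[X in _ --> X]addr0; apply: cvgD; first by apply: cvgMr.
apply/cvgr0Pnorm_le => eta eta0.
pose K := B * (2 * M) + 1.
have K0 : 0 < K by rewrite ltr_wpDl// !mulr_ge0// (le_trans _ (energy_bound 0 0))// perona_malik_ge0.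
near=> n.
apply: le_trans (normr_Rintegral_mul_le _ (idiff n) mpsi hB) _ => //.
rewrite (step_integral01 (hN n) (fun i => `|flux (z n t) i.+1 - 2 * slope (z n t) i|)).
have PM0 := perona_malik_ge0 (hN n) (z n t).
have PM : perona_malik (z n t) <= M := energy_bound n (Num.truncn (t / tau_ n)).
have sq : Num.sqrt (L n * e n) <= eta / K.
  rewrite -(ger0_norm (divr_ge0 (ltW eta0) (ltW K0))) -sqrtr_sqr ler_sqrt ?sqr_ge0//.
  apply: le_trans (abslog_eps_le R (hN n)) _.
  rewrite ler_pdivrMr ?abslog_gt0// mulrC -ler_pdivrMr ?exprn_gt0 ?divr_gt0//.
  near: n; exact: abslog_infty.
apply: le_trans (ler_wpM2l B0 (flux_slope (hN n) (z n t))) _.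
apply: (@le_trans _ _ (Num.sqrt (L n * e n) * K)); last by rewrite -ler_pdivlMr.
rewrite /K mulrDr mulr1 -[leLHS]addr0 lerD ?sqrtr_ge0//.
rewrite (_ : _ * (_ * _ * _) = Num.sqrt (L n * e n) * (B * (2 * perona_malik (z n t)))); last by ring.
by rewrite !ler_wpM2l ?sqrtr_ge0.
Unshelve. all: end_near. Qed.

(** * The limit equation *)

Section pde.

Definition val n k i : R := @U (N_ n) (tau_ n) k (inord i).
Definition speed n k i : R := (val n k i - val n k.-1 i) / tau_ n.

(** On the time cell k this is affine from the value at step k - 1 to the value at
    step k.  Its slope is thus the velocity of the step that produced the flux at
    the current time, at the cost of a constant value on the first cell, where
    k.-1 = k = 0. *)
Definition uhat n i k t : R := val n k.-1 i + speed n k i * (t - k%:R * tau_ n).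

Variables (phi : R -> R -> R) (T Bt Bx Btx : R).
Hypothesis tphi : tame phi T Bt Bx Btx.
Let e0 n : 0 < e n. Proof. exact: eps_gt0. Qed.

(** A Riemann sum in space for the integral of u phi_t. *)
Definition uhat_phit n t : R :=
  \sum_(0 <= i < N_ n) e n * (uhat n i (cell (tau_ n) t) t * partial_t phi t (i%:R * e n)).

(** A Riemann sum in space for the integral of u_t phi. *)
Definition speed_phi n t : R :=
  \sum_(0 <= i < N_ n) e n * (speed n (cell (tau_ n) t) i * phi t (i%:R * e n)).

Lemma continuous_uhat n i k : continuous (uhat n i k).
Proof.
move=> t; apply: cvgD; first exact: cvg_cst.
by apply: cvgMr; apply: cvgB; [exact: cvg_id|exact: cvg_cst].
Qed.

Lemma uhat_phit_integrable n K :
  mu.-integrable `]0, K%:R * tau_ n[%classic (EFin \o uhat_phit n).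
Proof.
apply: integrable_sumR => [//|i].
pose G k t := e n * (uhat n i k t * partial_t phi t (i%:R * e n)).
have cG k : continuous (G k).
  move=> t; apply: cvgMr; apply: cvgM; first exact: continuous_uhat.
  by apply: jointly_continuous_t; exact: tame_cont_t tphi.
exact: (grid_integrable (htau n) cG K).
Qed.

Lemma speed_phi_integrable n K :
  mu.-integrable `]0, K%:R * tau_ n[%classic (EFin \o speed_phi n).
Proof.
apply: integrable_sumR => [//|i].
pose G k t := e n * (speed n k i * phi t (i%:R * e n)).
have cG k : continuous (G k).
  move=> t; apply: cvgMr; apply: cvgMr.
  by apply: jointly_continuous_t; exact: tame_cont tphi.
exact: (grid_integrable (htau n) cG K).
Qed.

(** For each node, the derivative in time of uhat phi is uhat phi_t plus the
    velocity times phi, and phi vanishes at both ends of the interval. *)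
Lemma parts_in_time n K : T <= K%:R * tau_ n ->
  \int[mu]_(t in `]0, K%:R * tau_ n[) uhat_phit n t + \int[mu]_(t in `]0, K%:R * tau_ n[) speed_phi n t = 0.
Proof.
move=> TK; have t0 := htau n.
rewrite -RintegralD//; [|exact: uhat_phit_integrable|exact: speed_phi_integrable].
pose G i k t := uhat n i k t * partial_t phi t (i%:R * e n) + speed n k i * phi t (i%:R * e n).
pose FF i k t := uhat n i k t * phi t (i%:R * e n).
have cG i k : continuous (G i k).
  move=> t; apply: cvgD.
    apply: cvgM; first exact: continuous_uhat.
    by apply: jointly_continuous_t; exact: tame_cont_t tphi.
  apply: cvgMr; by apply: jointly_continuous_t; exact: tame_cont tphi.
have dFF i k (t : R) : is_derive t 1 (FF i k) (G i k t).
  exact: is_derive_affine_mul (tame_dt tphi _ _).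
have IG i : \int[mu]_(t in `]0, K%:R * tau_ n[) G i (cell (tau_ n) t) t = 0.
  rewrite (grid_FTC t0 (cG i) K (dFF i)).
  rewrite (eq_bigr (fun k => val n k.+1.-1 i * phi (k.+1%:R * tau_ n) (i%:R * e n)
     - val n k.-1 i * phi (k%:R * tau_ n) (i%:R * e n))) => [|k _]; last first.
    rewrite /FF /uhat subrr mulr0 addr0 /speed.
    have -> : k.+1%:R * tau_ n - k%:R * tau_ n = tau_ n by rewrite -natr1; ring.
    by rewrite mulfVK ?gt_eqF// addrCA subrr addr0.
  rewrite (telescope_sumr (fun k => val n k.-1 i * phi (k%:R * tau_ n) (i%:R * e n)))//.
  have /(tame_out tphi)[-> _ _] : ~ [/\ 0 < K%:R * tau_ n, K%:R * tau_ n < T & 0 < i%:R * e n < 1].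
    by move=> [_]; rewrite ltNge TK.
  have /(tame_out tphi)[-> _ _] : ~ [/\ 0 < 0%:R * tau_ n, 0%:R * tau_ n < T & 0 < i%:R * e n < 1].
    by move=> []; rewrite mul0r ltxx.
  by rewrite !mulr0 subrr.
transitivity (\int[mu]_(t in `]0, K%:R * tau_ n[) (\sum_(0 <= i < N_ n) e n * G i (cell (tau_ n) t) t)).
  apply: eq_Rintegral => t _; rewrite /uhat_phit /speed_phi -big_split/=; apply: eq_bigr => i _.
  by rewrite -mulrDr.
rewrite Rintegral_sum//; last first.
  by move=> i; have := integrableZl _ (e n) (grid_integrable t0 (cG i) K); exact.
rewrite big1// => i _; rewrite RintegralZl ?IG ?mulr0//.
exact: (grid_integrable t0 (cG i) K).
Qed.

(** Summation by parts: the velocities are the increments of the flux, which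
    vanishes at node 0, and phi vanishes at x = 1. *)
Lemma speed_phi_flux n t : tau_ n <= t ->
  speed_phi n t = - \int[mu]_(x in D) (wflux n t x * partial_x phi t x).
Proof.
move=> taut; have t0 := htau n; have tt : 0 <= t by rewrite (le_trans (ltW t0)).
pose f i := flux (z n t) i.
have cG i : continuous (fun x => f i.+1 * partial_x phi t x).
  move=> x; apply: cvgMr; by apply: jointly_continuous_x; exact: tame_cont_x tphi.
have dFF i (x : R) : is_derive x 1 (fun x => f i.+1 * phi t x) (f i.+1 * partial_x phi t x).
  have := @is_deriveZ _ _ _ (phi t) (f i.+1) x 1 _ (tame_dx tphi t x).
  by rewrite /GRing.scale.
have := grid_FTC (e0 n) cG (N_ n) dFF; rewrite epsE// => IE.
rewrite [X in - X](_ : _ = \sum_(0 <= i < N_ n) (f i.+1 * phi t (i.+1%:R * e n) - f i.+1 * phi t (i%:R * e n))) //.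
(* Before time tau_ n the current values are the initial data, which satisfy
   no Euler-Lagrange equation. *)
have k1 : (0 < cell (tau_ n) t)%N by rewrite /cell truncn_gt0 ler_pdivlMr// mul1r.
have spE i : (i < N_ n)%N -> e n * (speed n (cell (tau_ n) t) i * phi t (i%:R * e n)) =
    (f i.+1 - f i) * phi t (i%:R * e n).
  move=> iN; rewrite /f /time_ext -/(cell (tau_ n) t) -(prednK k1).
  rewrite (flux_step (hN n) t0 (scheme_minimizer (hU (hN n) t0) _)); last exact: ltnW.
  by rewrite /speed /val/= !mulrA; congr (_ * _); ring.
rewrite /speed_phi (eq_big_nat _ _ (F2 := fun i => (f i.+1 - f i) * phi t (i%:R * e n))); last first.
  by move=> i /andP[_ iN]; exact: spE.
rewrite -sumrN; apply/eqP; rewrite -subr_eq0 -sumrB; apply/eqP.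
rewrite (eq_bigr (fun i => f i.+1 * phi t (i.+1%:R * e n) - f i * phi t (i%:R * e n))) => [|i _]; last by ring.
rewrite telescope_sumr// epsE// mul0r.
have /(tame_out tphi)[-> _ _] : ~ [/\ 0 < t, t < T & 0 < (1:R) < 1].
  by move=> []; rewrite ltxx andbF.
by rewrite mulr0 subrr.
Qed.

Lemma val_le n k i : `|val n k i| <= C.
Proof. exact: (scheme_bounded (hN n) (htau n) (hU (hN n) (htau n)) (fun i => hC i (hN n))). Qed.

Lemma C_ge0 : 0 <= C.
Proof. exact: le_trans (val_le 0 0 0). Qed.

Lemma sum_increments_le n k : \sum_(0 <= i < N_ n) e n * (val n k i - val n k.-1 i) ^+ 2 <= 2 * tau_ n * M.
Proof.
have := scheme_holder (hN n) (htau n) (hU (hN n) (htau n)) (henergy (hN n)) (leq_pred k).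
rewrite /dist2 big_nat_recr//= => h.
apply: (@le_trans _ _ ((k - k.-1)%:R * (2 * tau_ n * M))).
  by apply: le_trans h; rewrite lerDl mulr_ge0 ?sqr_ge0// ltW.
rewrite ler_piMl ?mulr_ge0 ?M_ge0 ?(ltW (htau n))//.
by rewrite lern1; case: k {h} => [|k] /=; rewrite ?subnn ?subSnn.
Qed.

Lemma uhat_near n i t : 0 <= t ->
  `|uhat n i (cell (tau_ n) t) t - val n (cell (tau_ n) t) i|
    <= `|val n (cell (tau_ n) t) i - val n (cell (tau_ n) t).-1 i|.
Proof.
move=> tt; have t0 := htau n; have := cell_itv t0 tt; set k := cell _ _ => /andP[h1 h2].
rewrite /uhat /speed; set d := val n k i - val n k.-1 i.
rewrite [X in `|X| <= _](_ : _ = - (d * (1 - (t - k%:R * tau_ n) / tau_ n))); last first.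
  by rewrite /d; field; rewrite gt_eqF.
rewrite normrN normrM ler_piMr//.
have q0 : 0 <= (t - k%:R * tau_ n) / tau_ n by rewrite divr_ge0 ?(ltW t0)// subr_ge0.
have q1 : (t - k%:R * tau_ n) / tau_ n <= 1.
  by rewrite ler_pdivrMr// mul1r lerBlDr; move: h2; rewrite -natr1; lra.
by rewrite ger0_norm; lra.
Qed.

Lemma uhat_le n i t : 0 <= t -> `|uhat n i (cell (tau_ n) t) t| <= 3 * C.
Proof.
move=> tt; have := uhat_near n i tt; set k := cell _ _.
have h1 := val_le n k i; have h2 := val_le n k.-1 i.
rewrite -[X in `|X| <= 3 * C](subrK (val n k i)) => h3.
apply: le_trans (ler_normD _ _) _; have := ler_normB (val n k i) (val n k.-1 i).
by move: h1 h2 h3; lra.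
Qed.

Lemma uhat_phit_le n t : 0 <= t -> `|uhat_phit n t| <= 3 * C * Bt.
Proof.
move=> tt; apply: le_trans (ler_norm_sum _ _ _) _.
apply: (@le_trans _ _ (\sum_(0 <= i < N_ n) e n * (3 * C * Bt))).
  apply: ler_sum => i _; rewrite normrM (gtr0_norm (e0 n)) ler_pM2l//.
  by rewrite normrM ler_pM// ?uhat_le// (tame_boundt tphi).
by rewrite sumr_const_nat subn0 -[_ *+ N_ n]mulr_natl mulrA epsE// mul1r.
Qed.

Lemma speed_phi_le n t : 0 <= t -> `|speed_phi n t| <= Bx * (2 + 6 * M).
Proof.
move=> tt; have [taut|ttau] := leP (tau_ n) t.
  rewrite speed_phi_flux// normrN; apply: wflux_mul_le; first exact: tame_Bx tphi.
    apply: measurable_funTS; apply: continuous_measurable_fun.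
    by apply: jointly_continuous_x; exact: tame_cont_x tphi.
  by move=> x _; exact: tame_boundx tphi _ _.
have k0 : cell (tau_ n) t = 0%N.
  by apply: cellE => //; rewrite mul0r tt mul1r.
rewrite /speed_phi k0 big1 ?normr0; last first.
  by move=> i _; rewrite /speed/= subrr !mul0r mulr0.
by rewrite mulr_ge0 ?(tame_Bx tphi)// addr_ge0// mulr_ge0// M_ge0.
Qed.

(** Three errors at each x: uhat against the value at the current step, phi_t at the
    node against phi_t at x, and the current value against u.  The parameter eta
    makes the first and the last quadratic. *)
Lemma uhat_phit_estimate n t eta : 0 <= t -> 0 < eta -> (sqL2 (err n t) < +oo)%E ->
  `|uhat_phit n t - \int[mu]_(x in D) (u t x * partial_t phi t x)| <=
  (2 * Bt * eta + C * Btx * e n) + Bt / eta * (2 * tau_ n * M) + Bt / eta * fine (sqL2 (err n t)).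
Proof.
move=> tt eta0 fin; set k := cell (tau_ n) t.
have Bt0 := tame_Bt tphi; have Btx0 := tame_Btx tphi; have Cg := C_ge0.
have mu1 : mu D = 1%E by rewrite lebesgue_measure_itv/= lte01 oppr0 adde0.
pose a i := uhat n i k t * partial_t phi t (i%:R * e n).
pose b i := (val n k i - val n k.-1 i) ^+ 2.
have mut := measurable_u tt.
have mpt : measurable_fun D (partial_t phi t).
  apply: measurable_funTS; apply: continuous_measurable_fun.
  by apply: jointly_continuous_x; exact: tame_cont_t tphi.
have merr : measurable_fun D (err n t).
  by apply: measurable_funB => //; exact: measurable_pc_ext.
have PE : uhat_phit n t = \int[mu]_(x in D) a (cell (e n) x) by rewrite (step_integral01 (hN n)).
have ia := step_integrable01 (hN n) a.
have ib := step_integrable01 (hN n) b.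
have ierr : mu.-integrable D (EFin \o (fun x => err n t x ^+ 2)).
  apply/integrableP; split; first by apply/measurable_EFinP; exact: measurable_funX.
  by apply: le_lt_trans fin; rewrite le_eqVlt; apply/orP; left; apply/eqP; apply: eq_integral => x _;
    rewrite /= ger0_norm ?sqr_ge0.
have ic (c : R) : mu.-integrable D (EFin \o cst c).
  apply: (bounded_integrable (C := `|c|)) => //.
  by rewrite [X in (X < _)%E]mu1 ltry.
pose c0 := 2 * Bt * eta + C * Btx * e n; pose c1 := Bt / eta.
pose r x := c0 + c1 * b (cell (e n) x) + c1 * err n t x ^+ 2.
have i1 : mu.-integrable D (EFin \o (fun x => c1 * b (cell (e n) x))).
  by have := integrableZl _ c1 ib; exact.
have i2 : mu.-integrable D (EFin \o (fun x => c1 * err n t x ^+ 2)).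
  by have := integrableZl _ c1 ierr; exact.
have i01 : mu.-integrable D (EFin \o (fun x => c0 + c1 * b (cell (e n) x))).
  by have := integrableD _ (ic c0) i1; exact.
have ir : mu.-integrable D (EFin \o r) by have := integrableD _ i01 i2; exact.
have pw x : D x -> `|a (cell (e n) x) - u t x * partial_t phi t x| <= r x.
  move=> Dx; have x01 : 0 < x < 1 by move: Dx; rewrite /= in_itv.
  set i := cell (e n) x; have /andP[i1' i2'] : i%:R * e n <= x < i.+1%:R * e n.
    by apply: cell_itv => //; move/andP: x01 => [/ltW].
  have hv : `|val n k i| <= C := val_le n k i.
  have hd := uhat_near n i tt; rewrite -/k in hd.
  have h1 := amgm_norm (val n k i - val n k.-1 i) eta0.
  have h2 : `|val n k i - u t x| <= eta + err n t x ^+ 2 / eta := amgm_norm (err n t x) eta0.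
  have -> : a i - u t x * partial_t phi t x =
    (uhat n i k t - val n k i) * partial_t phi t (i%:R * e n)
    + val n k i * (partial_t phi t (i%:R * e n) - partial_t phi t x)
    + (val n k i - u t x) * partial_t phi t x by rewrite /a; ring.
  rewrite /r /c0 /c1 -/i.
  have -> : 2 * Bt * eta + C * Btx * e n + Bt / eta * b i + Bt / eta * err n t x ^+ 2 =
    (eta + b i / eta) * Bt + C * (Btx * e n) + (eta + err n t x ^+ 2 / eta) * Bt.
    by field; rewrite gt_eqF.
  apply: le_trans (ler_normD _ _) _; apply: lerD.
    apply: le_trans (ler_normD _ _) _; apply: lerD.
      rewrite normrM; apply: ler_pM => //; last exact: (tame_boundt tphi).
      exact: le_trans hd h1.
    rewrite normrM; apply: ler_pM => //.
    apply: le_trans (tame_lip tphi _ _ _) _; rewrite ler_wpM2l//.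
    rewrite distrC ger0_norm ?subr_ge0// lerBlDl; apply: ltW.
    by move: i2'; rewrite -natr1 mulrDl mul1r.
  by rewrite normrM; apply: ler_pM => //; exact: (tame_boundt tphi).
have mdiff : measurable_fun D (fun x => a (cell (e n) x) - u t x * partial_t phi t x).
  have /measurable_EFinP ma := measurable_int _ ia.
  by apply: measurable_funB => //; exact: measurable_funM.
have idiff : mu.-integrable D (EFin \o (fun x => a (cell (e n) x) - u t x * partial_t phi t x)).
  exact: integrable_le ir pw.
have iu : mu.-integrable D (EFin \o (fun x => u t x * partial_t phi t x)).
  have := integrableB _ ia idiff; move=> /(_ _)/eq_integrable; apply=> // x _ /=.
  by rewrite -EFinB opprB addrC subrK.
rewrite PE -RintegralB//; apply: le_trans (le_normr_Rintegral _ idiff) _ => //.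
apply: (@le_trans _ _ (\int[mu]_(x in D) r x)).
  apply: le_Rintegral => //; exact: integrable_norm idiff.
have mD : measurable D by exact: measurable_itv.
have E1 : \int[mu]_(x in D) (c1 * b (cell (e n) x)) = c1 * \int[mu]_(x in D) b (cell (e n) x).
  exact: RintegralZl.
have E2 : \int[mu]_(x in D) (c1 * err n t x ^+ 2) = c1 * \int[mu]_(x in D) (err n t x ^+ 2).
  exact: RintegralZl.
have E0 : \int[mu]_(x in D) cst c0 x = c0 by rewrite Rintegral_cst// [X in fine X]mu1 mulr1.
have -> : \int[mu]_(x in D) r x =
    c0 + c1 * \int[mu]_(x in D) b (cell (e n) x) + c1 * \int[mu]_(x in D) (err n t x ^+ 2).
  rewrite -E1 -E2 -{1}E0 -(RintegralD _ (ic c0) i1)//.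
  exact: (RintegralD _ i01 i2).
rewrite (step_integral01 (hN n)) lerD// lerD// ler_wpM2l ?divr_ge0 ?(ltW eta0)//.
exact: sum_increments_le.
Qed.

Lemma uhat_phit_cvg t : 0 <= t ->
  uhat_phit n t @[n --> \oo] --> \int[mu]_(x in D) (u t x * partial_t phi t x).
Proof.
move=> tt; apply/cvgrPdist_le => eps1 eps10.
have Bt0 := tame_Bt tphi; have Btx0 := tame_Btx tphi; have Cg := C_ge0.
pose K := 4 * Bt + C * Btx + 1.
have K0 : 0 < K by rewrite ltr_wpDl// addr_ge0 ?mulr_ge0.
pose eta := eps1 / K; have eta0 : 0 < eta by rewrite divr_gt0.
have CBtx0 : 0 <= C * Btx by rewrite mulr_ge0.
have Bte0 : 0 <= Bt / eta by rewrite divr_ge0// ltW.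
near=> n.
have h1 : (sqL2 (err n t) <= (eta ^+ 2)%:E)%E.
  by near: n; apply: sqL2_cvg => //; rewrite exprn_gt0.
have h2 : e n <= eta by apply: ltW; near: n; exact: (cvgr_lt _ hN0).
have h3 : 2 * tau_ n * M <= eta ^+ 2.
  have : tau_ n < eta ^+ 2 / (2 * M + 1).
    near: n; apply: (cvgr_lt _ htau0); rewrite divr_gt0 ?exprn_gt0//.
    by rewrite ltr_wpDl// mulr_ge0// M_ge0.
  rewrite ltr_pdivlMr ?ltr_wpDl ?mulr_ge0 ?M_ge0//.
  by have := htau n; lra.
have fin : (sqL2 (err n t) < +oo)%E by apply: le_lt_trans h1 _; rewrite ltry.
have est := uhat_phit_estimate tt eta0 fin.
rewrite distrC; apply: (le_trans est).
have h4 : fine (sqL2 (err n t)) <= eta ^+ 2.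
  by rewrite -lee_fin fineK// ge0_fin_numE// sqL2_ge0.
have -> : eps1 = (2 * Bt * eta + C * Btx * eta) + Bt / eta * eta ^+ 2 + Bt / eta * eta ^+ 2 + eta.
  rewrite (_ : eps1 = eta * K); last by rewrite /eta mulfVK ?gt_eqF.
  by rewrite /K; field; rewrite gt_eqF.
have g1 : C * Btx * e n <= C * Btx * eta by exact: ler_wpM2l.
have g2 : Bt / eta * (2 * tau_ n * M) <= Bt / eta * eta ^+ 2 by exact: ler_wpM2l.
have g3 : Bt / eta * fine (sqL2 (err n t)) <= Bt / eta * eta ^+ 2 by exact: ler_wpM2l.
by lra.
Unshelve. all: end_near. Qed.

Lemma speed_phi_cvg t : 0 < t ->
  - speed_phi n t / 2 @[n --> \oo] --> \int[mu]_(x in D) (ac_deriv (u t) x * partial_x phi t x).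
Proof.
move=> t0.
have mpx : measurable_fun D (partial_x phi t).
  apply: measurable_funTS; apply: continuous_measurable_fun.
  by apply: jointly_continuous_x; exact: tame_cont_x tphi.
have h := @wflux_weak_cvg t _ _ (ltW t0) mpx (fun x _ => tame_boundx tphi t x).
have h2 : 2^-1 * \int[mu]_(x in D) (wflux n t x * partial_x phi t x) @[n --> \oo]
   --> \int[mu]_(x in D) (ac_deriv (u t) x * partial_x phi t x).
  rewrite -[X in _ --> X](mulKf (_ : 2 != 0 :> R))//; exact: cvgMr.
apply: cvg_trans h2; apply: near_eq_cvg; near=> n.
rewrite speed_phi_flux ?opprK 1?mulrC//; apply: ltW; near: n; exact: (cvgr_lt _ htau0).
Unshelve. all: end_near. Qed.

(** Dominated convergence in time, with uhat_phit_le and speed_phi_le. *)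
Lemma integral_u_phit :
  \int[mu]_(t in `]0, T[) \int[mu]_(x in D) (u t x * partial_t phi t x) =
  2 * \int[mu]_(t in `]0, T[) \int[mu]_(x in D) (ac_deriv (u t) x * partial_x phi t x).
Proof.
pose TT := (`]0, T[%classic : set (measurableTypeR R)).
have T0 := tame_T tphi.
pose K n := (Num.truncn (T / tau_ n)).+1.
have TK n : T <= (K n)%:R * tau_ n.
  by rewrite -ler_pdivrMr ?htau// ltW// truncnS_gt.
have sub n : TT `<=` `]0, (K n)%:R * tau_ n[%classic.
  by apply: subset_itvl; rewrite bnd_simp.
have out n t : ~ TT t -> uhat_phit n t = 0 /\ speed_phi n t = 0.
  move=> nt; have o (x : R) : ~ [/\ 0 < t, t < T & 0 < x < 1].
    by move=> [t0 tT _]; apply: nt; rewrite /TT /= in_itv/= t0.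
  by split; apply: big1 => i _; have [h1 h2 _] := tame_out tphi (o (i%:R * e n)); rewrite ?h1 ?h2 !mulr0.
have iP n : mu.-integrable TT (EFin \o uhat_phit n).
  have h := uhat_phit_integrable n (K n).
  by apply: (@integrableS _ _ _ mu _ TT _ _ _ (sub n) h); exact: measurable_itv.
have iQ n : mu.-integrable TT (EFin \o speed_phi n).
  have h := speed_phi_integrable n (K n).
  by apply: (@integrableS _ _ _ mu _ TT _ _ _ (sub n) h); exact: measurable_itv.
have PQ n : \int[mu]_(t in TT) uhat_phit n t + \int[mu]_(t in TT) speed_phi n t = 0.
  rewrite (Rintegral_widen _ (sub n)); last by move=> t _ /(out n)[].
  rewrite [X in _ + X](Rintegral_widen _ (sub n)); last by move=> t _ /(out n)[].
  exact: parts_in_time.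
have muT : (mu TT < +oo)%E by rewrite lebesgue_measure_itv/= lte_fin T0 -EFinB ltry.
have mTT : measurable TT by exact: measurable_itv.
have ic (c : R) : mu.-integrable TT (EFin \o cst c).
  by apply: (bounded_integrable (C := `|c|) mTT muT).
have TTP t : TT t -> 0 < t by rewrite /TT /= in_itv/= => /andP[].
have [_ cP] : mu.-integrable TT (EFin \o (fun t => \int[mu]_(x in D) (u t x * partial_t phi t x))) /\
    \int[mu]_(t in TT) uhat_phit n t @[n --> \oo] -->
    \int[mu]_(t in TT) \int[mu]_(x in D) (u t x * partial_t phi t x).
  apply: (dominated_Rintegral_cvg mTT (g := cst (3 * C * Bt))) => //.
  - by move=> n; have /measurable_EFinP := measurable_int _ (iP n).
  - by move=> t /TTP/ltW; exact: uhat_phit_cvg.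
  - by move=> n t /TTP/ltW; exact: uhat_phit_le.
have [_ cQ] : mu.-integrable TT (EFin \o (fun t => \int[mu]_(x in D) (ac_deriv (u t) x * partial_x phi t x))) /\
    \int[mu]_(t in TT) (- speed_phi n t / 2) @[n --> \oo] -->
    \int[mu]_(t in TT) \int[mu]_(x in D) (ac_deriv (u t) x * partial_x phi t x).
  apply: (dominated_Rintegral_cvg mTT (g := cst (Bx * (2 + 6 * M)))) => //.
  - move=> n; have /measurable_EFinP mQ := measurable_int _ (iQ n).
    by apply: measurable_funM => //; exact: measurableT_comp.
  - by move=> t /TTP; exact: speed_phi_cvg.
  - move=> n t /TTP/ltW t0; rewrite normrM normrN normfV normr_nat.
    by rewrite ler_pdivrMr// (le_trans (speed_phi_le n t0))// ler_peMr ?ler1n// (le_trans _ (speed_phi_le 0 t0)).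
have QE n : \int[mu]_(t in TT) (- speed_phi n t / 2) = 2^-1 * \int[mu]_(t in TT) uhat_phit n t.
  have -> : \int[mu]_(t in TT) uhat_phit n t = - \int[mu]_(t in TT) speed_phi n t.
    by apply/eqP; rewrite -subr_eq0 opprK PQ.
  rewrite mulrN -mulNr -RintegralZl//.
  by apply: eq_Rintegral => t _; ring.
rewrite (_ : (fun n => \int[mu]_(t in TT) (- speed_phi n t / 2)) =
  (fun n => 2^-1 * \int[mu]_(t in TT) uhat_phit n t)) in cQ; last by apply/funext => n; exact: QE.
move: cP cQ; rewrite -/TT.
set p := (fun n => \int[mu]_(t in TT) uhat_phit n t).
set IA := (X in p n @[n --> _] --> X -> _).
set IB := (X in _ -> _ --> X -> _).
move=> cP cQ; have c2 : 2^-1 * p n @[n --> \oo] --> 2^-1 * IA.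
  by apply: cvgMr; exact: cP.
have h : IB = 2^-1 * IA by exact: (cvg_unique (@norm_hausdorff _ R) cQ c2).
transitivity (2 * (2^-1 * IA)); first by rewrite mulrA divff// mul1r.
by congr (2 * _); exact: esym h.
Qed.

Lemma weak_equation : distr_t (distribution_of u) phi =
  2 * distr_x (distribution_of (fun t => ac_deriv (u t))) phi.
Proof.
rewrite /distr_t /distr_x /distribution_of mulrN; congr (- _).
have sub : (`]0, T[%classic : set (measurableTypeR R)) `<=` `]0, +oo[%classic.
  by apply: subset_itvl; rewrite bnd_simp.
have o t : `]0, +oo[%classic t -> ~ `]0, T[%classic t -> forall x : R, ~ [/\ 0 < t, t < T & 0 < x < 1].
  by move=> _ nt x [t0 tT _]; apply: nt; rewrite /= in_itv/= t0.
have E1 := @Rintegral_widen _ _ _ mu _ _ (fun t => \int[mu]_(x in D) (u t x * partial_t phi t x)) sub.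
have E2 := @Rintegral_widen _ _ _ mu _ _ (fun t => \int[mu]_(x in D) (ac_deriv (u t) x * partial_x phi t x)) sub.
apply: etrans (esym (E1 _)) _.
  move=> t t1 t2; rewrite /Rintegral integral0_eq// => x _.
  by have [_ -> _] := tame_out tphi (o _ t1 t2 x); rewrite mulr0.
rewrite integral_u_phit; congr (2 * _); apply: E2.
move=> t t1 t2; rewrite /Rintegral integral0_eq// => x _.
by have [_ _ ->] := tame_out tphi (o _ t1 t2 x); rewrite mulr0.
Qed.

End pde.

(** * The initial datum *)

(** At time 0 the errors tend to 0 in L^2, so their lower limit is 0 almost
    everywhere by Fatou. *)
Lemma initial_datum (u0lim : R -> R) :
  {ae mu, forall x : R, 0 < x < 1 -> pc_ext (@u0 (N_ n)) x @[n --> \oo] --> u0lim x} ->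
  ae_eq mu `]0, 1[%classic (u 0) u0lim.
Proof.
move=> hlim.
have z0 n : z n 0 = @u0 (N_ n).
  by rewrite /time_ext mul0r truncn0; have [-> _] := hU (hN n) (htau n).
have merr n : measurable_fun D (err n 0).
  by apply: measurable_funB; [exact: measurable_pc_ext|exact: measurable_u].
have [|||_ /(_ erefl) h0] := @fatou_ae R _ _ mu D (fun n x => err n 0 x ^+ 2) 0 (measurable_itv _).
- by move=> n; exact: measurable_funX.
- by move=> n x _; exact: sqr_ge0.
- apply/lee_addgt0Pr => eta eta0; rewrite add0e.
  by apply: limn_einf_le_near; exact: sqL2_cvg.
move: h0 hlim; apply: filterS2 => x h1 h2 Dx.
have x01 : 0 < x < 1 by move: Dx; rewrite /= in_itv.
have c1 : (err n 0 x ^+ 2)%:E @[n --> \oo] --> ((u0lim x - u 0 x) ^+ 2)%:E.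
  apply: cvg_EFin; first exact: nearW.
  rewrite expr2; under eq_fun do rewrite /= expr2.
  have c2 : err n 0 x @[n --> \oo] --> u0lim x - u 0 x.
    apply: cvgB; last exact: cvg_cst.
    by under eq_fun do rewrite z0; exact: h2.
  exact: cvgM.
have := h1 Dx; rewrite (cvg_limn_einf_sup c1).1 => -[] /eqP.
by rewrite sqrf_eq0 subr_eq0 => /eqP ->.
Qed.

(** * Boundary and jump conditions *)

Local Notation I0 T := (`]0, T[%classic : set (measurableTypeR R)).

Definition speed_sqr n k : R := dist2 (@U (N_ n) (tau_ n) k) (@U (N_ n) (tau_ n) k.-1) / tau_ n ^+ 2.

Lemma speed_sqr_ge0 n k : 0 <= speed_sqr n k.
Proof. by rewrite divr_ge0 ?sqr_ge0// dist2_ge0. Qed.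

Lemma integral_speed_sqr n (T : R) :
  (\int[mu]_(t in (I0 T)) (speed_sqr n (cell (tau_ n) t))%:E <= (2 * M)%:E)%E.
Proof.
have t0 := htau n; set K := (Num.truncn (T / tau_ n)).+1.
have TK : T <= K%:R * tau_ n by rewrite -ler_pdivrMr// ltW// truncnS_gt.
have iK := step_integrable (speed_sqr n) K t0.
have mK : measurable_fun (I0 (K%:R * tau_ n)%R) (fun t => (speed_sqr n (cell (tau_ n) t))%:E).
  exact: measurable_int iK.
have h1 : (\int[mu]_(t in I0 T) (speed_sqr n (cell (tau_ n) t))%:E <=
    \int[mu]_(t in I0 (K%:R * tau_ n)%R) (speed_sqr n (cell (tau_ n) t))%:E)%E.
  apply: ge0_subset_integral => //.
  - by move=> t _; rewrite lee_fin speed_sqr_ge0.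
  - by apply: subset_itvl; rewrite bnd_simp.
apply: (le_trans h1).
have -> : (\int[mu]_(t in (I0 (K%:R * tau_ n)%R)) (speed_sqr n (cell (tau_ n) t))%:E =
   (\int[mu]_(t in (I0 (K%:R * tau_ n)%R)) speed_sqr n (cell (tau_ n) t))%:E)%E.
  by rewrite /Rintegral fineK// (integrable_fin_num _ iK).
rewrite step_integral// lee_fin /K big_nat_recl//= /speed_sqr.
have d0 z : dist2 z z = 0 :> R by apply: big1 => i _; rewrite subrr expr0n/= mulr0.
rewrite d0 mul0r mulr0 add0r.
have h := scheme_dist2_sum (hN n) t0 (hU (hN n) t0) (henergy (hN n)) (Num.truncn (T / tau_ n)).
rewrite (eq_bigr (fun k => (tau_ n)^-1 * dist2 (@U (N_ n) (tau_ n) k.+1) (@U (N_ n) (tau_ n) k))) => [|k _]; last first.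
  by field; rewrite gt_eqF.
rewrite -mulr_sumr ler_pdivrMl//; apply: le_trans h _.
by rewrite le_eqVlt; apply/orP; left; apply/eqP; ring.
Qed.

(** The integrals over bounded time intervals of the squared velocities are bounded,
    so by Fatou their lower limit is finite for almost every t. *)
Lemma good_times : {ae mu, forall t, 0 <= t ->
  exists G, exists h : nat -> nat, forall k, [/\ (k <= h k)%N, tau_ (h k) <= t &
     speed_sqr (h k) (cell (tau_ (h k)) t) <= G]}.
Proof.
have key (m : nat) : {ae mu, forall t, (I0 m%:R) t ->
    (limn_einf (fun n => (speed_sqr n (cell (tau_ n) t))%:E) < +oo)%E}.
  apply: (@fatou_ae R _ _ mu (I0 m%:R) (fun n t => speed_sqr n (cell (tau_ n) t)) (2 * M) _ _ _ _).1 => //.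
  - move=> n; set K := (Num.truncn (m%:R / tau_ n)).+1.
    have TK : m%:R <= K%:R * tau_ n by rewrite -ler_pdivrMr ?htau// ltW// truncnS_gt.
    have sub : (I0 m%:R) `<=` I0 (K%:R * tau_ n) by apply: subset_itvl; rewrite bnd_simp.
    have mS := @measurable_step R (tau_ n) (speed_sqr n) K (htau n).
    by apply: (measurable_funS _ sub mS).
  - by move=> n t _; exact: speed_sqr_ge0.
  - apply: limn_einf_le_near; apply: nearW => n; exact: integral_speed_sqr.
(* The condition tau_ (h k) <= t fails at t = 0. *)
have n0 : {ae mu, forall t : R, t != 0}.
  exists [set 0]; split => //; first by rewrite lebesgue_measure_set1.
  by move=> t /= /negP; rewrite negbK => /eqP.
move: (ae_foralln key) n0; apply: filterS2 => t ht tn0 tt.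
have t0 : 0 < t by rewrite lt_neqAle eq_sym tn0.
have fin := ht (Num.truncn t).+1 _; have {fin} fin := fin (_ : I0 (Num.truncn t).+1%:R t).
have : exists G : R, (limn_einf (fun n => (speed_sqr n (cell (tau_ n) t))%:E) < G%:E)%E.
  have : (limn_einf (fun n => (speed_sqr n (cell (tau_ n) t))%:E) < +oo)%E.
    by apply: fin; rewrite /= in_itv/= t0 truncnS_gt.
  case: (limn_einf _) => [x| |] //.
    by exists (x + 1); rewrite lte_fin ltrDl.
  by exists 0; rewrite ltNyr.
move=> [G hG]; exists G.
have [N0 _ hN0'] : \forall n \near \oo, tau_ n < t by exact: (cvgr_lt _ htau0).
have /choice[h hh] : forall k, exists n, [/\ (k <= n)%N, tau_ n <= t & speed_sqr n (cell (tau_ n) t) <= G].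
  move=> k; have [n kn hn] := limn_einf_lt_often hG (maxn k N0).
  exists n; split; first exact: leq_trans (leq_maxl _ _) kn.
    by apply/ltW/hN0'; exact: leq_trans (leq_maxr _ _) kn.
  by move: hn; rewrite lte_fin => /ltW.
by exists h.
Qed.

(** Otherwise the error would exceed eta almost everywhere on ]a, b[, so its
    squared norm would be at least eta^2 (b - a). *)
Lemma close_point n t (a b c eta : R) : 0 <= t -> 0 <= a -> a < b -> b <= 1 -> 0 < eta ->
  {ae mu, forall y, a < y < b -> `|u t y - c| < eta} ->
  (sqL2 (err n t) < (eta ^+ 2 * (b - a))%:E)%E ->
  exists2 y, a < y < b & `|pc_ext (z n t) y - c| < 2 * eta.
Proof.
move=> tt a0 ab b1 eta0 hae hsq; apply: contrapT => ny.
have {}ny y : a < y < b -> 2 * eta <= `|pc_ext (z n t) y - c|.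
  by move=> yab; rewrite leNgt; apply/negP => hy; apply: ny; exists y.
move: hsq; rewrite ltNge => /negP; apply.
have merr : measurable_fun D (fun x => (err n t x ^+ 2)%:E).
  apply/measurable_EFinP; apply: measurable_funX; apply: measurable_funB.
    exact: measurable_pc_ext.
  exact: measurable_u.
have sub : (`]a, b[%classic : set (measurableTypeR R)) `<=` D.
  by apply: subset_itvSoo; rewrite bnd_simp.
apply: (@le_trans _ _ (\int[mu]_(x in (`]a, b[%classic : set (measurableTypeR R))) (err n t x ^+ 2)%:E)%E); last first.
  by apply: ge0_subset_integral => // x _; rewrite lee_fin sqr_ge0.
have -> : ((eta ^+ 2 * (b - a))%:E = \int[mu]_(x in (`]a, b[%classic : set (measurableTypeR R))) (cst (eta ^+ 2)%:E x))%E.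
  rewrite integral_cst// EFinM; congr (_ * _)%E.
  by have := lebesgue_measure_itv `]a, b[; rewrite /= lte_fin ab -EFinB => <-.
apply: ae_ge0_le_integral => //.
- by move=> x _; rewrite lee_fin sqr_ge0.
- by move=> x _; rewrite lee_fin sqr_ge0.
- exact: measurable_funS merr.
apply: (@filterS _ _ (@ae_filter_ringOfSetsType _ _ R mu) _ _ _ hae) => x hx; rewrite /= in_itv/= => xab.
have := ny x xab; have := hx xab => h1 h2.
rewrite lee_fin -[leRHS]real_normK ?num_real//.
rewrite lerXn2r ?nnegrE ?(ltW eta0)//.
have : `|pc_ext (z n t) x - c| <= `|err n t x| + `|u t x - c|.
  by rewrite (le_trans _ (ler_normD _ _))//; rewrite addrA subrK.
by move: h1 h2; lra.
Qed.

Section good_time.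
Variables (t G : R) (h : nat -> nat).
Hypotheses (tt : 0 <= t).
Hypothesis hh : forall k, [/\ (k <= h k)%N, tau_ (h k) <= t &
  speed_sqr (h k) (cell (tau_ (h k)) t) <= G].

Local Notation W k x := (wflux (h k) t x).
Let e0 n : 0 < e n. Proof. exact: eps_gt0. Qed.

Lemma good_time_G_ge0 : 0 <= G.
Proof. by have [_ _] := hh 0; apply: le_trans; rewrite divr_ge0 ?sqr_ge0 ?dist2_ge0. Qed.
Let G0 := good_time_G_ge0.

Lemma near_h (P : set nat) : (\forall n \near \oo, P n) -> \forall k \near \oo, P (h k).
Proof.
move=> [N0 _ hP]; exists N0 => // k /= Nk; apply: hP => /=.
by have [kh _ _] := hh k; exact: leq_trans kh.
Qed.

Lemma cvg_h (f : nat -> R) (l : R) : f @ \oo --> l -> (f \o h) @ \oo --> l.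
Proof. by move=> cf P /cf /near_h. Qed.

Lemma flux_good_time k i j : (i <= j <= (N_ (h k)).+1)%N ->
  (flux (z (h k) t) j - flux (z (h k) t) i) ^+ 2 <= (j - i)%:R * e (h k) * G.
Proof.
move=> ij; have [_ taut hG] := hh k; have t0 := htau (h k).
have c0 : (0 < cell (tau_ (h k)) t)%N.
  by rewrite /cell truncn_gt0 ler_pdivlMr// mul1r.
have := flux_holder (hN (h k)) t0 (hU (hN (h k)) t0) (henergy (hN (h k))) (cell (tau_ (h k)) t).-1 ij.
by rewrite prednK// => /le_trans; apply; rewrite ler_wpM2l ?mulr_ge0// ?(ltW (e0 _))//.
Qed.

Lemma wflux_holder k x y : 0 <= x -> x <= y -> y <= 1 ->
  (W k y - W k x) ^+ 2 <= (y - x + e (h k)) * G.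
Proof.
move=> x0 xy y1; have y0 := le_trans x0 xy.
have /andP[cx1 cx2] := cell_itv (e0 (h k)) x0; have /andP[cy1 cy2] := cell_itv (e0 (h k)) y0.
have cxy : (cell (e (h k)) x <= cell (e (h k)) y)%N.
  by rewrite -ltnS -(ltr_nat R) -(ltr_pM2r (e0 (h k))); lra.
have cyN : (cell (e (h k)) y <= N_ (h k))%N.
  rewrite -(ler_nat R) -(ler_pM2r (e0 (h k))) (epsE R (hN (h k))); lra.
apply: le_trans (flux_good_time _) _; first by rewrite !ltnS cxy cyN.
rewrite ler_wpM2r// subSS natrB// mulrBl; move: cx2; rewrite -natr1 mulrDl mul1r.
by move: cy1; lra.
Qed.

(** The flux vanishes at node 0, which is one cell to the left of the flux at x = 0. *)
Lemma wflux_sqr_le k x : 0 <= x <= 1 -> W k x ^+ 2 <= (x + e (h k)) * G.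
Proof.
move=> /andP[x0 x1]; have /andP[cx1 cx2] := cell_itv (e0 (h k)) x0.
have cN : (cell (e (h k)) x <= N_ (h k))%N.
  rewrite -(ler_nat R) -(ler_pM2r (e0 (h k))) (epsE R (hN (h k))); lra.
have := @flux_good_time k 0 (cell (e (h k)) x).+1; rewrite ltnS cN => /(_ isT).
have -> : flux (z (h k) t) 0 = 0 by rewrite /flux.
rewrite !subr0 => /le_trans; apply; rewrite ler_wpM2r// -natr1 mulrDl mul1r; lra.
Qed.

Lemma wflux_at1 k : W k 1 = 0.
Proof.
have c1 : cell (e (h k)) 1 = N_ (h k).
  by apply: cellE => //; rewrite (epsE R (hN (h k))) lexx/= -natr1 mulrDl mul1r (epsE R (hN (h k))) ltrDl.
by rewrite /wflux c1 /flux ltnn andbF.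
Qed.

Lemma wflux_bounded k x : 0 <= x <= 1 -> `|W k x| <= 1 + 2 * G.
Proof.
move=> x01; have h1 := wflux_sqr_le k x01; have h2 := ltW (eps_lt1 R (hN (h k))).
have /andP[_ x1] := x01.
have h3 : (x + e (h k)) * G <= 2 * G by rewrite ler_wpM2r//; lra.
have := sqr_ge0 (`|W k x| - 1); rewrite sqrrB1 real_normK ?num_real//.
have := G0; move: h1 h3; lra.
Qed.

Lemma wflux_equicontinuous eta : 0 < eta -> exists2 del : R, 0 < del &
  \forall k \near \oo, forall x y, 0 <= x <= 1 -> 0 <= y <= 1 -> `|y - x| <= del ->
    `|W k y - W k x| <= eta.
Proof.
move=> eta0; have G1 : 0 < 2 * (G + 1) by rewrite mulr_gt0// ltr_wpDl.
exists (eta ^+ 2 / (2 * (G + 1))); first by rewrite divr_gt0 ?exprn_gt0.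
set del := _ / _; have del0 : 0 < del by rewrite divr_gt0 ?exprn_gt0.
have : \forall k \near \oo, e (h k) <= del by apply: (@near_h (fun n => e n <= del)); exact: (cvgr_le _ hN0).
apply: filterS => k ek x y x01 y01; wlog xy : x y x01 y01 / x <= y.
  move=> H; have [|/ltW] := leP x y; first exact: H.
  by move=> yx; rewrite distrC (distrC (W k y)); exact: H.
rewrite ger0_norm ?subr_ge0// => yx.
rewrite -(@ler_pXn2r _ 2)// ?nnegrE ?(ltW eta0)// real_normK ?num_real//.
move: x01 y01 => /andP[x0 x1] /andP[y0 y1].
apply: le_trans (wflux_holder k x0 xy y1) _.
apply: (@le_trans _ _ (2 * del * (G + 1))).
  by apply: ler_pM => //; [rewrite addr_ge0 ?subr_ge0// ltW | lra | lra].
by rewrite /del le_eqVlt; apply/orP; left; apply/eqP; field; lra.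
Qed.

(** By equicontinuity the value at x is close to the averages over small intervals
    around x, and these converge by weak convergence. *)
Lemma wflux_is_cvg x : 0 <= x <= 1 -> cvg (W k x @[k --> \oo]).
Proof.
move=> x01; apply/cauchy_cvgP; apply: cauchy_exP => eta eta0.
have [del del0 hdel] := wflux_equicontinuous (divr_gt0 eta0 (ltr0n R 2)).
(* At an end point of [0, 1] the average is one-sided. *)
pose a := Num.max (x - del) 0; pose b := Num.min (x + del) 1.
move: x01 => /andP[x0 x1].
have a0 : 0 <= a by rewrite /a le_max lexx orbT.
have b1 : b <= 1 by rewrite /b ge_min lexx orbT.
have ab : a < b by rewrite /a /b lt_min !gt_max; apply/andP; split; apply/andP; split; lra.
pose psi y : R := \1_(`]a, b[%classic) y / (b - a).
have mpsi : measurable_fun D psi.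
  by apply: measurable_funM => //; apply: measurable_indic; exact: measurable_itv.
have bpsi y : D y -> `|psi y| <= (b - a)^-1.
  move=> _; have i0 : 0 <= (b - a)^-1 by rewrite invr_ge0 subr_ge0 ltW.
  by rewrite /psi indicE; case: (_ \in _); rewrite ?mul1r ?mul0r ?normr0// ger0_norm.
have c1 := cvg_h (wflux_weak_cvg tt mpsi bpsi).
set l := (X in _ --> X) in c1; exists l.
have c2 : \forall k \near \oo, `|l - \int[mu]_(x in D) (W k x * psi x)| < eta / 2.
  by have /cvgrPdist_lt := c1; apply; rewrite divr_gt0.
suff : \forall k \near \oo, `|l - W k x| < eta by [].
move: hdel c2; apply: filterS2 => k h1 h2.
have h3 : `|\int[mu]_(x in D) (W k x * psi x) - W k x| <= eta / 2.
  apply: average_near => //; first exact: wflux_integrable.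
  move=> y /andP[ay yb]; move: ay yb; rewrite /a /b gt_max lt_min => /andP[ay y0] /andP[yb y1].
  by apply: h1; rewrite ?x0 ?x1 ?(ltW y0) ?(ltW y1)// ler_distl; lra.
by move: h2 h3; rewrite !ltr_norml ler_norml; lra.
Qed.

Definition flux_limit (x : R) : R := lim (W k x @[k --> \oo]).
Local Notation Winf := flux_limit.

Lemma wflux_cvg x : 0 <= x <= 1 -> W k x @[k --> \oo] --> Winf x.
Proof. exact: wflux_is_cvg. Qed.

Lemma flux_limit_holder x y : 0 <= x -> x <= y -> y <= 1 ->
  (Winf y - Winf x) ^+ 2 <= (y - x) * G.
Proof.
move=> x0 xy y1; have x01 : 0 <= x <= 1 by rewrite x0 (le_trans xy).
have y01 : 0 <= y <= 1 by rewrite y1 (le_trans x0).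
have c1 : (fun k => W k y - W k x) @ \oo --> Winf y - Winf x.
  by apply: cvgB; exact: wflux_cvg.
have c2 : (fun k => (y - x + e (h k)) * G) @ \oo --> (y - x + 0) * G.
  by apply: cvgMl; apply: cvgD; [exact: cvg_cst|exact: (cvg_h hN0)].
rewrite addr0 in c2; apply: (ler_cvg_to (cvgM c1 c1) c2).
by apply: nearW => k; exact: wflux_holder.
Qed.

Lemma flux_limit0 : Winf 0 = 0.
Proof.
have c1 : (fun k => W k 0) @ \oo --> Winf 0 by apply: wflux_cvg; rewrite lexx ler01.
have c2 : (fun k => (0 + e (h k)) * G) @ \oo --> (0 + 0) * G.
  by apply: cvgMl; apply: cvgD; [exact: cvg_cst|exact: (cvg_h hN0)].
rewrite addr0 mul0r in c2.
have h1 : Winf 0 ^+ 2 <= 0.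
  apply: (ler_cvg_to (cvgM c1 c1) c2); apply: nearW => k; apply: wflux_sqr_le.
  by rewrite lexx ler01.
by apply/eqP; rewrite -sqrf_eq0 eq_le h1 sqr_ge0.
Qed.

Lemma flux_limit1 : Winf 1 = 0.
Proof.
have c1 : (fun k => W k 1) @ \oo --> Winf 1 by apply: wflux_cvg; rewrite lexx ler01.
have c2 : (fun k => W k 1) @ \oo --> (0 : R).
  by rewrite (_ : (fun _ => _) = cst 0); [exact: cvg_cst|apply/funext => k; exact: wflux_at1].
exact: (cvg_unique (@norm_hausdorff _ R) c1 c2).
Qed.

Lemma flux_limit_continuous : {within `[0, 1], continuous Winf}.
Proof.
apply/subspace_continuousP => x /=; rewrite in_itv/= => x01.
apply/cvgrPdist_lt => eta eta0.
have G1 : 0 < G + 1 by rewrite ltr_wpDl.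
have d0 : 0 < eta ^+ 2 / (G + 1) by rewrite divr_gt0 ?exprn_gt0.
rewrite near_withinE; near=> y => /=; rewrite in_itv/= => y01.
have xy : `|x - y| < eta ^+ 2 / (G + 1).
  by near: y; have /cvgrPdist_lt := @cvg_id _ (nbhs x); apply.
have {}xy : `|x - y| * G < eta ^+ 2.
  apply: (@le_lt_trans _ _ (`|x - y| * (G + 1))); first by rewrite ler_wpM2l// lerDl.
  by rewrite -ltr_pdivlMr.
rewrite -(@ltr_pXn2r _ 2)// ?nnegrE ?(ltW eta0)// real_normK ?num_real//.
apply: le_lt_trans xy; move: x01 y01 => /andP[x0 x1] /andP[y0 y1].
have [xy|/ltW yx] := leP x y.
  by rewrite -sqrrN opprB distrC ger0_norm ?subr_ge0//; exact: flux_limit_holder.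
by rewrite ger0_norm ?subr_ge0//; exact: flux_limit_holder.
Unshelve. all: end_near. Qed.

(** By dominated convergence the weak and the pointwise limit have the same integral
    over every Borel subset of ]0, 1[. *)
Lemma ac_deriv_flux_limit : ae_eq mu D (ac_deriv (u t)) (fun x => Winf x / 2).
Proof.
have mD : measurable D by exact: measurable_itv.
have muD : (mu D < +oo)%E by rewrite [X in (X < _)%E]lebesgue_measure_itv/= lte01 oppr0 adde0 ltry.
have D01 x : D x -> 0 <= x <= 1 by rewrite /= in_itv/= => /andP[x0 x1]; rewrite !ltW.
have mW k : measurable_fun D (fun x => W k x) by exact: (measurable_step01 (hN (h k)) (fun i => flux (z (h k) t) i.+1)).
have mWinf : measurable_fun D Winf.
  apply: (@measurable_fun_cvg _ _ _ D (fun k x => W k x)) => // x Dx.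
  exact: wflux_cvg (D01 _ Dx).
have icst : mu.-integrable D (EFin \o cst (1 + 2 * G)).
  by apply: (bounded_integrable (C := `|1 + 2 * G|)) => //.
have [_ L2ux _] := hweak tt.
have mux := L2_measurable L2ux.
have iux : mu.-integrable D (EFin \o ac_deriv (u t)).
  apply: (integrable_le mD (g := fun x => 1 + ac_deriv (u t) x ^+ 2)) => //.
    have i1 : mu.-integrable D (EFin \o (cst 1 : R -> R)).
      by apply: (bounded_integrable (C := 1)) => // x _; rewrite normr1.
    by have := integrableD mD i1 (L2_sqr_integrable L2ux).
  move=> x _; have := sqr_ge0 (`|ac_deriv (u t) x| - 1); rewrite sqrrB1 real_normK ?num_real//.
  by have := sqr_ge0 (ac_deriv (u t) x); lra.
suff : ae_eq mu D (EFin \o ac_deriv (u t)) (EFin \o (fun x => Winf x / 2)).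
  by apply: filterS => x /= hx Dx; have := hx Dx => -[].
apply: integral_ae_eq => //.
  by apply/measurable_EFinP; exact: measurable_funM.
move=> E ED mE.
have mI : measurable_fun D (\1_E : R -> R) by exact: measurable_indic.
have bI x : D x -> `|\1_E x : R| <= 1.
  by move=> _; rewrite indicE; case: (_ \in _); rewrite ?normr0 ?normr1.
have c1 := cvg_h (wflux_weak_cvg tt mI bI).
have [_ c2] : mu.-integrable D (EFin \o (fun x => Winf x * \1_E x)) /\
    \int[mu]_(x in D) (W k x * \1_E x) @[k --> \oo] --> \int[mu]_(x in D) (Winf x * \1_E x).
  apply: (@dominated_Rintegral_cvg _ _ _ mu D mD _ _ (cst (1 + 2 * G))) => //.
  - by move=> k; exact: measurable_funM.
  - by move=> x Dx; apply: cvgMl; exact: wflux_cvg (D01 _ Dx).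
  - move=> k x Dx; rewrite normrM -[leRHS]mulr1; apply: ler_pM => //.
      exact: wflux_bounded (D01 _ Dx).
    exact: bI.
have {c1 c2} E1 := cvg_unique (@norm_hausdorff _ R) c1 c2.
have iEu : mu.-integrable E (EFin \o ac_deriv (u t)) by exact: integrableS iux.
have iWinf : mu.-integrable D (EFin \o Winf).
  apply: (integrable_le mD (g := cst (1 + 2 * G))) => // x Dx.
  have c3 : (fun k => `|W k x|) @ \oo --> `|Winf x| by apply: cvg_norm; exact: wflux_cvg (D01 _ Dx).
  by apply: (cvgr_to_le c3); apply: nearW => k; exact: wflux_bounded (D01 _ Dx).
have iW2 : mu.-integrable D (EFin \o (fun x => Winf x / 2)).
  by have := integrableZr mD 2^-1 iWinf.
have iEW : mu.-integrable E (EFin \o (fun x => Winf x / 2)) by exact: integrableS iW2.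
rewrite -[LHS]fineK ?(integrable_fin_num _ iEu)// -[RHS]fineK ?(integrable_fin_num _ iEW)//.
congr (_%:E); rewrite -![fine _]/(Rintegral _ _ _).
rewrite RintegralZr//; last exact: integrableS iWinf.
move: E1; rewrite !Rintegral_mul_indic//= => <-.
by rewrite mulrAC divff ?mul1r// pnatr_eq0.
Qed.

(** At distance at most d from the jump point there are, on either side, points where
    the discrete evolution is close to the one-sided limits.  Between them
    exists_small_flux gives a flux below eta, and equicontinuity transports the
    bound to the jump point. *)
Lemma flux_limit_jump xb : jump_set (u t) xb -> Winf xb = 0.
Proof.
move=> [/andP[xb0 xb1] [l [r [ll lr lneq]]]].
have c0 : 0 < `|l - r| by rewrite normr_gt0 subr_eq0.
set c := `|l - r| in c0.
have M0 : 0 < M + 1 by rewrite ltr_wpDl// M_ge0.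
suff key eta : 0 < eta -> `|Winf xb| <= 2 * eta.
  apply/eqP; rewrite -normr_le0; apply/ler_addgt0Pl => eta eta0; rewrite addr0.
  have := key (eta / 2) (divr_gt0 eta0 (ltr0n R 2)).
  by rewrite mulrCA divff ?mulr1// pnatr_eq0.
move=> eta0; have c8 : 0 < c / 8 by rewrite divr_gt0.
have [r1 r10 hl] := ll _ c8; have [r2 r20 hr] := lr _ c8.
(* The value of lam in exists_small_flux. *)
pose lam := c / (32 * (M + 1)).
have lam0 : 0 < lam by rewrite divr_gt0// mulr_gt0.
have [del0 del00 hdel] := wflux_equicontinuous eta0.
(* Within distance d both one-sided limits are nearly attained.  The points
   that exists_small_flux compares are less than 2 d apart, and the cell that
   it finds is at distance at most 2 d from xb, since eps <= d eventually. *)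
have [d [d0 [dr1 dr2 dx dx1] [ddel dlam]]] : exists d : R, [/\ 0 < d,
    [/\ d <= r1, d <= r2, d <= xb & d <= 1 - xb] & 2 * d <= del0 /\ d <= c * lam / 24].
  exists (Num.min (Num.min r1 r2) (Num.min (Num.min xb (1 - xb)) (Num.min (del0 / 2) (c * lam / 24)))).
  set m := Num.min _ _; have : m <= m by [].
  rewrite {2}/m !le_min => /andP[/andP[m1 m2] /andP[/andP[m3 m4] /andP[m5 m6]]].
  split; [|by []|split => //; last by rewrite mulrC -ler_pdivlMr].
  by rewrite /m !lt_min r10 r20 xb0 subr_gt0 xb1 !divr_gt0// mulr_gt0.
have hl' : {ae mu, forall y, xb - d < y < xb -> `|u t y - l| < c / 8}.
  apply: (@filterS _ _ (@ae_filter_ringOfSetsType _ _ R mu) _ _ _ hl) => y hy /andP[y1 y2].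
  by apply: hy; rewrite y2 andbT (le_lt_trans _ y1)// lerD2l lerN2.
have hr' : {ae mu, forall y, xb < y < xb + d -> `|u t y - r| < c / 8}.
  apply: (@filterS _ _ (@ae_filter_ringOfSetsType _ _ R mu) _ _ _ hr) => y hy /andP[y1 y2].
  by apply: hy; rewrite y1/= (lt_le_trans y2)// lerD2l.
have n1 : \forall k \near \oo, e (h k) <= d.
  by apply: (@near_h (fun n => e n <= d)); exact: (cvgr_le _ hN0).
have n2 : \forall k \near \oo,
    Num.max 1 (Num.max (64 / (c / (16 * (M + 1)))) (2 / (lam * eta))) <= L (h k).
  by apply: (@near_h (fun n => _ <= L n)); exact: abslog_infty.
have n3 : \forall k \near \oo, (sqL2 (err (h k) t) <= ((c / 8) ^+ 2 * d / 2)%:E)%E.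
  apply: (@near_h (fun n => (sqL2 (err n t) <= ((c / 8) ^+ 2 * d / 2)%:E)%E)).
  by apply: sqL2_cvg => //; rewrite divr_gt0// mulr_gt0// exprn_gt0.
have c1 : (fun k => `|W k xb|) @ \oo --> `|Winf xb|.
  by apply: cvg_norm; apply: wflux_cvg; rewrite !ltW.
apply: (cvgr_to_le c1); near=> k.
have ed : e (h k) <= d by near: k.
have : Num.max 1 (Num.max (64 / (c / (16 * (M + 1)))) (2 / (lam * eta))) <= L (h k) by near: k.
rewrite !ge_max => /andP[L1 /andP[L2 L3]].
have sq : (sqL2 (err (h k) t) < ((c / 8) ^+ 2 * d)%:E)%E.
  apply: (@le_lt_trans _ _ ((c / 8) ^+ 2 * d / 2)%:E); first by near: k.
  by rewrite lte_fin ltr_pdivrMr// ltr_pMr ?ltr1n// mulr_gt0// exprn_gt0.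
have weq : forall x y, 0 <= x <= 1 -> 0 <= y <= 1 -> `|y - x| <= del0 -> `|W k y - W k x| <= eta.
  by near: k.
have xd0 : 0 <= xb - d by rewrite subr_ge0.
have xd1 : xb + d <= 1 by rewrite addrC -lerBrDr.
have [y1 /andP[y11 y12] hy1] : exists2 y, xb - d < y < xb & `|pc_ext (z (h k) t) y - l| < 2 * (c / 8).
  by apply: close_point => //; rewrite ?ltrBlDr ?ltrDl// ?(ltW xb1)// opprB addrC subrK.
have [y2 /andP[y21 y22] hy2] : exists2 y, xb < y < xb + d & `|pc_ext (z (h k) t) y - r| < 2 * (c / 8).
  by apply: close_point => //; rewrite ?ltrDl// ?(ltW xb0)// addrAC subrr add0r.
(* Both values are within c/4 of the one-sided limits. *)
have gap : c / 2 < `|pc_ext (z (h k) t) y2 - pc_ext (z (h k) t) y1|.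
  move: hy1 hy2; set v1 := pc_ext _ y1; set v2 := pc_ext _ y2 => hy1 hy2.
  have : c <= `|v2 - r| + `|v2 - v1| + `|v1 - l|.
    rewrite /c -[l - r](_ : (v2 - r) - (v2 - v1) - (v1 - l) = _); last by ring.
    by apply: le_trans (ler_normB _ _) _; rewrite lerD2r ler_normB.
  by move: hy1 hy2; lra.
have close : y2 - y1 + e (h k) <= c * lam / 8.
  by move: y11 y22 ed dlam; lra.
have y10 : 0 <= y1 by exact: le_trans xd0 (ltW y11).
have y201 : y2 <= 1 by exact: le_trans (ltW y22) xd1.
have [y [y0 yl yr] fy] := exists_small_flux (hN (h k)) c0 eta0 (energy_bound (h k) _)
  y10 (ltW (lt_trans y12 y21)) y201 close L1 L2 L3 gap.
have : `|W k xb - W k y| <= eta.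
  apply: weq; rewrite ?y0 ?(ltW xb0) ?(ltW xb1) ?(le_trans yr y201)//.
  by apply: le_trans ddel; rewrite ler_distl; move: y11 y22 ed yl yr d0; lra.
have := ler_normD (W k xb - W k y) (W k y); rewrite subrK => h1 h2.
by apply: le_trans h1 _; rewrite mulrDl mul1r lerD.
Unshelve. all: end_near. Qed.

End good_time.

Lemma ae_flux_conditions : {ae mu, forall t : R, 0 <= t -> exists g : R -> R,
  [/\ {within `[0, 1], continuous g}, ae_eq mu D (ac_deriv (u t)) g &
      forall x, (jump_set (u t) `|` [set 0; 1]) x -> g x = 0]}.
Proof.
apply: (@filterS _ _ (@ae_filter_ringOfSetsType _ _ R mu) _ _ _ good_times) => t ht tt.
have [G [h hh]] := ht tt; exists (fun x => flux_limit t h x / 2); split.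
- have c := flux_limit_continuous tt hh.
  by move=> x; apply: cvgMl; exact: c.
- exact: ac_deriv_flux_limit tt hh.
- move=> x [/(flux_limit_jump tt hh) ->|[->|->]]; rewrite ?mul0r//.
    by rewrite (flux_limit0 tt hh) mul0r.
  by rewrite (flux_limit1 tt hh) mul0r.
Qed.

End evolution.

Theorem theorem4 (R : realType)
  (u0 : forall N : nat, 'I_N.+1 -> R)
  (hbound : exists C : R, forall N (i : 'I_N.+1), (1 < N)%N -> `|u0 N i| <= C)
  (M : R) (hM : 0 < M)
  (henergy : forall N, (1 < N)%N -> perona_malik (u0 N) <= M)
  (* the discrete evolutions u^k_{eps,tau} with eps = 1/N *)
  (U : forall N : nat, R -> nat -> 'I_N.+1 -> R)
  (hU : forall N (tau : R), (1 < N)%N -> 0 < tau ->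
     minimizing_scheme tau (u0 N) (U N tau))
  (N_ : nat -> nat) (tau_ : nat -> R)
  (hN : forall n, (1 < N_ n)%N) (htau : forall n, 0 < tau_ n)
  (hN0 : eps R (N_ n) @[n --> \oo] --> 0)
  (htau0 : tau_ n @[n --> \oo] --> 0)
  (u : R -> R -> R) (hu : holder_half_L2 u) :
  let z n t := time_ext (tau_ n) (U (N_ n) (tau_ n)) t in
  let v n t := pc_ext (z n t) in
  let vtilde n t := partial_interp (z n t) in
  (forall T : R, 0 <= T ->
     [/\ cvg_LinftyL2 T v u, cvg_LinftyL2 T vtilde u,
         cvg_ae_cylinder T v u & cvg_ae_cylinder T vtilde u]) ->
  (forall t : R, 0 <= t ->
     piecewise_H1 (u t) /\
     weak_cvg_L2 (fun n => ac_deriv (vtilde n t)) (ac_deriv (u t))) ->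
  (forall (t xbar : R), 0 <= t -> jump_set (u t) xbar ->
     exists (h : nat -> nat) (xs : nat -> R),
       [/\ {homo h : i j / (i < j)%N},
           forall k, jump_set (vtilde (h k) t) (xs k) &
           xs k @[k --> \oo] --> xbar]) ->
  let ux := fun t => ac_deriv (u t) in
  [/\ (forall phi, test_fun2 phi ->
         distr_t (distribution_of u) phi =
         2 * distr_x (distribution_of ux) phi),
      (forall u0lim : R -> R,
         {ae lebesgue_measure, forall x : R, 0 < x < 1 ->
            pc_ext (u0 (N_ n)) x @[n --> \oo] --> u0lim x} ->
         ae_eq (@lebesgue_measure R) `]0, 1[%classic (u 0) u0lim) &
      {ae lebesgue_measure, forall t : R, 0 <= t ->
         exists g : R -> R,
           [/\ {within `[0, 1], continuous g},
               ae_eq (@lebesgue_measure R) `]0, 1[%classic (ux t) g &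
               forall x, (jump_set (u t) `|` [set 0; 1]) x -> g x = 0]}].
Proof.
move=> z v vtilde hcv hweak _ ux.
have [C hC] := hbound.
have hcv' T : 0 <= T -> cvg_LinftyL2 T v u by move=> /hcv[].
have hweak' t : 0 <= t -> weak_cvg_L2 (fun n => ac_deriv (vtilde n t)) (ac_deriv (u t)).
  by move=> /hweak[].
split.
- move=> phi /test_fun2_tame[T [Bt [Bx [Btx tphi]]]].
  exact: (weak_equation hC henergy hU hN htau hN0 htau0 hu hcv' hweak' tphi).
- move=> u0lim h; exact: (initial_datum henergy hU hN htau htau0 hu hcv' h).
- exact: (ae_flux_conditions henergy hU hN htau hN0 htau0 hu hcv' hweak').
Qed.
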